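(* Let $1<p<\infty$ and $\Lambda>1$. There are constants $0<c\le C<\infty$ depending only on $\Lambda$ and $p$ such that for every weight $w\in A_p^{\mathcal{D}}$ on $\mathbb{R}$, $$c\,N(w)\le\sup_{\mathcal{S}}\|\mathcal{A}_{\mathcal{S}}:L^p(w)\to L^p(w)\|\le C\,N(w),$$ where the supremum is over all sparse collections $\mathcal{S}\subset\mathcal{D}$ with Carleson constant $\Lambda$ and no infinitely increasing chains, and $$N(w):=\sup_{b}\frac{\|\Pi_b:L^p(w)\to L^p(w)\|}{\|b\|_{BMO^{\mathcal{D}}}}+\sup_{b}\frac{\|\Pi_b^*:L^p(w)\to L^p(w)\|}{\|b\|_{BMO^{\mathcal{D}}}}+\sup_{\tau}\frac{\|T_\tau:L^p(w)\to L^p(w)\|}{\|\tau\|_\infty},$$ with suprema over all $b\in BMO^{\mathcal{D}}(\mathbb{R})$ with $\|b\|_{BMO^{\mathcal{D}}}\neq0$ and over all nonzero bounded sequences $\tau=\{\tau_J\}_{J\in\mathcal{D}}$.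
   Context: $\mathcal{D}$ is a fixed dyadic grid on $\mathbb{R}$: a collection of intervals of lengths $2^k$, $k\in\mathbb{Z}$, such that for each fixed $k$ those of length $2^k$ partition $\mathbb{R}$, and $I\cap J\in\{I,J,\emptyset\}$ for all $I,J\in\mathcal{D}$. $\mathcal{S}\subset\mathcal{D}$ has Carleson constant $\Lambda>1$ (is $\Lambda$-Carleson) if $\sum_{I\in\mathcal{S},I\subset J}|I|\le\Lambda|J|$ for all $J\in\mathcal{D}$; it is sparse if it is $\Lambda$-Carleson for some $\Lambda>1$. $\mathcal{S}$ has an infinitely increasing chain if there are $I_k\in\mathcal{S}$, $k\in\mathbb{N}$, with $I_k\subsetneq I_{k+1}$ for all $k$. $h_I=|I|^{-1/2}(\mathbf{1}_{I_+}-\mathbf{1}_{I_-})$ with $I_+,I_-$ the right and left halves of $I$; $(f,g)=\int fg\,dx$; $\langle f\rangle_I=\frac1{|I|}\int_If\,dx$. A weight is a locally integrable, a.e. positive function; $L^p(w)$ is $L^p$ of the measure $w\,dx$. With $1/p+1/p'=1$, $w'=w^{1-p'}$, $w\in A_p^{\mathcal{D}}$ means $\sup_{I\in\mathcal{D}}\langle w\rangle_I\langle w'\rangle_I^{p-1}<\infty$. $\|b\|_{BMO^{\mathcal{D}}}=\sup_{I\in\mathcal{D}}\frac1{|I|}\int_I|b-\langle b\rangle_I|\,dx$. Operators: $\mathcal{A}_{\mathcal{S}}f=\sum_{I\in\mathcal{S}}\langle f\rangle_I\mathbf{1}_I$; $\Pi_bf=\sum_{I\in\mathcal{D}}(b,h_I)\langle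 f\rangle_Ih_I$; $\Pi_b^*f=\sum_{I\in\mathcal{D}}(b,h_I)(f,h_I)\frac{\mathbf{1}_I}{|I|}$; $T_\tau f=\sum_{J\in\mathcal{D}}\tau_J(f,h_J)h_J$ (martingale transform), with $\|\tau\|_\infty=\sup_J|\tau_J|$. $\|T:X\to Y\|$ is the operator norm. *)

(* Defs.v *)
From HB Require Import structures.
From mathcomp Require Import all_boot all_order all_algebra.
From mathcomp Require Import all_classical all_reals all_analysis.

Set Implicit Arguments.
Unset Strict Implicit.
Unset Printing Implicit Defensive.

Import Order.TTheory GRing.Theory Num.Theory.
Import numFieldNormedType.Exports.

Local Open Scope classical_set_scope.
Local Open Scope ring_scope.

Local Notation leb := lebesgue_measure.

Definition len {R : realType} (I : set R) : R := fine (leb I).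

(* The intervals may contain any of their endpoints. *)
Definition dyadic_grid {R : realType} (D : set (set R)) : Prop :=
  [/\ forall I, D I ->
        is_interval I /\ exists k : int, leb I = ((2 : R) ^ k)%:E,
      forall k : int,
        partition [set I | D I /\ leb I = ((2 : R) ^ k)%:E] id [set: R] &
      forall I J, D I -> D J ->
        [\/ I `&` J = I, I `&` J = J | I `&` J = set0] ].

Definition carleson {R : realType} (D S : set (set R)) (L : R) : Prop :=
  forall J, D J ->
    (\esum_(I in [set I | S I /\ I `<=` J]) leb I <= L%:E * leb J)%E.

Definition has_infinite_increasing_chain {R : realType} (S : set (set R)) :=
  exists I : nat -> set R, forall k, S (I k) /\ I k `<` I k.+1.

Definition avg {R : realType} (f : R -> R) (I : set R) : R :=
  (len I)^-1 * \int[leb]_(x in I) f x.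

(* Average of a nonnegative function, [+oo] if it is not integrable on I. *)
Definition eavg {R : realType} (f : R -> R) (I : set R) : \bar R :=
  ((len I)^-1%:E * \int[leb]_(x in I) (f x)%:E)%E.

Definition midpoint {R : realType} (I : set R) : R := (inf I + sup I) / 2.

(* The midpoint is put in the right half; this only matters on a null set. *)
Definition right_half {R : realType} (I : set R) : set R :=
  I `&` [set x | midpoint I <= x].
Definition left_half {R : realType} (I : set R) : set R :=
  I `&` [set x | x < midpoint I].

Definition haar {R : realType} (I : set R) (x : R) : R :=
  (Num.sqrt (len I))^-1 * (\1_(right_half I) x - \1_(left_half I) x).

Definition pairing {R : realType} (f g : R -> R) : R :=
  \int[leb]_x (f x * g x).

Definition weight {R : realType} (w : R -> R) : Prop :=
  locally_integrable [set: R] w /\ {ae (@lebesgue_measure R), forall x, 0 < w x}.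

Definition conjugate_exponent {R : realType} (p : R) : R := p / (p - 1).

Definition dual_weight {R : realType} (p : R) (w : R -> R) : R -> R :=
  fun x => w x `^ (1 - conjugate_exponent p).

(* Extended-real averages: the condition includes the local integrability of
   the dual weight. *)
Definition Ap {R : realType} (D : set (set R)) (p : R) (w : R -> R) : Prop :=
  (ereal_sup [set eavg w I * eavg (dual_weight p w) I `^ (p - 1) | I in D]
     < +oo)%E.

(* The norm of L^p of the measure w dx, written as a Lebesgue integral. *)
Definition Lpw_norm {R : realType} (p : R) (w f : R -> R) : \bar R :=
  ((\int[leb]_x (`|f x| `^ p * w x)%:E) `^ p^-1)%E.

Definition in_Lpw {R : realType} (p : R) (w f : R -> R) : Prop :=
  measurable_fun [set: R] f /\ (Lpw_norm p w f < +oo)%E.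

Definition BMO_norm {R : realType} (D : set (set R)) (b : R -> R) : \bar R :=
  ereal_sup [set eavg (fun x => `|b x - avg b I|) I | I in D].

Definition in_BMO {R : realType} (D : set (set R)) (b : R -> R) : Prop :=
  locally_integrable [set: R] b /\ (BMO_norm D b < +oo)%E.

(* [sums_to p w E u g]: the series of the functions u I, for I in E, converges
   unconditionally to g in L^p(w), that is, along the net of finite
   subcollections of E. *)
Definition sums_to {R : realType} (p : R) (w : R -> R) (E : set (set R))
    (u : set R -> R -> R) (g : R -> R) : Prop :=
  forall eps : R, 0 < eps ->
    exists F0 : set (set R), [/\ finite_set F0, F0 `<=` E &
      forall F : set (set R), finite_set F -> F0 `<=` F -> F `<=` E ->
        (Lpw_norm p w (fun x => ((\sum_(I \in F) u I x) - g x)%R) < eps%:E)%E].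

(* An operator is given by its graph: T f g means that the series defining the
   operator at f converges to g, which is thus determined up to a.e. equality. *)
Definition sparse_op {R : realType} (p : R) (w : R -> R) (S : set (set R))
    (f g : R -> R) : Prop :=
  sums_to p w S (fun I x => avg f I * \1_I x) g.

Definition paraproduct {R : realType} (p : R) (w : R -> R) (D : set (set R))
    (b f g : R -> R) : Prop :=
  sums_to p w D (fun I x => pairing b (haar I) * avg f I * haar I x) g.

Definition adjoint_paraproduct {R : realType} (p : R) (w : R -> R)
    (D : set (set R)) (b f g : R -> R) : Prop :=
  sums_to p w D
    (fun I x => pairing b (haar I) * pairing f (haar I) * (\1_I x / len I)) g.

Definition martingale_transform {R : realType} (p : R) (w : R -> R)
    (D : set (set R)) (tau : set R -> R) (f g : R -> R) : Prop :=
  sums_to p w D (fun J x => tau J * pairing f (haar J) * haar J x) g.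

(* The least constant C such that T is defined on all of L^p(w), with values in
   L^p(w), and satisfies |T f| <= C |f|; it is [+oo] if there is none. *)
Definition opnorm {R : realType} (p : R) (w : R -> R)
    (T : (R -> R) -> (R -> R) -> Prop) : \bar R :=
  ereal_inf [set C%:E | C in [set C : R | 0 <= C /\
    forall f, in_Lpw p w f ->
      exists g, [/\ in_Lpw p w g, T f g &
                 (Lpw_norm p w g <= C%:E * Lpw_norm p w f)%E] ] ].

Definition sup_norm {R : realType} (D : set (set R)) (tau : set R -> R)
    : \bar R :=
  ereal_sup [set `|tau J|%:E | J in D].

Definition sparse_sup {R : realType} (D : set (set R)) (p L : R) (w : R -> R)
    : \bar R :=
  ereal_sup [set opnorm p w (sparse_op p w S) | S in
    [set S | [/\ S `<=` D, carleson D S L &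
                 ~ has_infinite_increasing_chain S] ] ].

Definition paraproduct_sup {R : realType} (D : set (set R)) (p : R)
    (w : R -> R) : \bar R :=
  ereal_sup
    [set (opnorm p w (paraproduct p w D b) * (fine (BMO_norm D b))^-1%:E)%E
    | b in [set b | in_BMO D b /\ BMO_norm D b <> 0%E] ].

Definition adjoint_paraproduct_sup {R : realType} (D : set (set R)) (p : R)
    (w : R -> R) : \bar R :=
  ereal_sup
    [set (opnorm p w (adjoint_paraproduct p w D b)
          * (fine (BMO_norm D b))^-1%:E)%E
    | b in [set b | in_BMO D b /\ BMO_norm D b <> 0%E] ].

Definition martingale_sup {R : realType} (D : set (set R)) (p : R)
    (w : R -> R) : \bar R :=
  ereal_sup
    [set (opnorm p w (martingale_transform p w D tau)
          * (fine (sup_norm D tau))^-1%:E)%E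
    | tau in [set tau | (sup_norm D tau < +oo)%E /\ sup_norm D tau <> 0%E] ].

Definition haar_sup {R : realType} (D : set (set R)) (p : R) (w : R -> R)
    : \bar R :=
  (paraproduct_sup D p w + adjoint_paraproduct_sup D p w
   + martingale_sup D p w)%E.

(* Main.v *)
Require Import Defs.
From HB Require Import structures.
From mathcomp Require Import all_boot all_order all_algebra.
From mathcomp Require Import all_classical all_reals all_analysis measurable_realfun.
From mathcomp Require Import ring lra.

Set Implicit Arguments.
Unset Strict Implicit.
Unset Printing Implicit Defensive.

Import Order.TTheory GRing.Theory Num.Theory.
Import numFieldNormedType.Exports.

Local Open Scope classical_set_scope.
Local Open Scope ring_scope.

(** In both directions only finite signed sums have to be bounded: if they are,
    the series that defines the operator converges unconditionally in L^p(w), by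
    Khintchine's inequality and dominated convergence
    ([unconditional_convergence], [opnorm_le_signed]).

    Sparse operators are bounded by Haar operators through an identity. For a
    finite sparse family s let b be its multiplicity, the sum of the 1_I for I
    in s, and let tau_J be the total length of the members strictly inside J
    divided by |J|. Then the sparse operator of s is the sum of the paraproduct
    of b, its adjoint and the martingale transform of tau. Indeed, let I be a
    member of s and consider, for its ancestors J, the product of the averages
    of 1_I and f over J. By the product rule for martingale differences, each
    strict ancestor contributes the terms of the three operators
    ([product_term_step]); these telescope to <f>_I 1_I, with a remainder that
    the A_p condition makes small ([Ap_average_le], [sparse_sum_le]). The
    Carleson condition bounds the norm of b in BMO by 2 * L
    ([BMO_norm_multiplicity]) and tau by L, so C = 5 * L works.

    Haar operators are bounded by sparse operators through duality. A signed
    finite sum u of the terms of a Haar operator at f is paired with g = u |u| ^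
    (p - 2) w ([duality_norm_le]). The pairing is at most a constant times the
    sparse form, the sum of <|f|>_K <|g|>_K |K| over the intervals K at which
    the average of |f| or |g| has grown by the factor A = 2 * L / (L - 1) since
    the last such interval; this choice of A makes their Carleson constant A /
    (A - 2) equal to L ([sum_stops_le], [carleson_roots]). Between them a
    Bellman function argument controls the form ([sum_tree_le],
    [martingale_form_le], [paraproduct_form_le]); for the paraproducts it uses
    that the Haar coefficients of a BMO function are Carleson, which is the
    John-Nirenberg inequality ([carleson_half_diff]). Hölder's inequality for
    the sparse operator at |f| against |g| concludes. *)

(** * Stopping intervals and bilinear forms on a binary tree *)

Lemma ler_double (R : realFieldType) (A x : R) : 2 < A -> 0 <= x ->
  (2 * x <= 2 * A * x) * (x <= A * x).
Proof. by move=> A2 x0; split; nra. Qed.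

Lemma div_halves_le2 (R : realFieldType) (x y z : R) :
  x = (y + z) / 2 -> 0 <= x -> y / x + z / x <= 2.
Proof.
move=> xE; rewrite le_eqVlt => /predU1P[<-|x0]; first by rewrite invr0; lra.
by rewrite -mulrDl ler_pdivrMr //; lra.
Qed.

Lemma sqr_div_le (R : realFieldType) (A x X y : R) :
  `|x| <= X -> X <= 2 * A * y -> 0 <= y -> x ^+ 2 / y <= 4 * A ^+ 2 * y.
Proof.
move=> xX Xy; rewrite le_eqVlt => /predU1P[<-|y0]; first by rewrite invr0 !mulr0.
rewrite ler_pdivrMr // -real_normK ?num_real //.
have : `|x| ^+ 2 <= (2 * A * y) ^+ 2.
  by rewrite lerXn2r ?nnegrE // ?(le_trans xX) // (le_trans _ Xy) ?(le_trans _ xX).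
by lra.
Qed.

Lemma weighted_amgm (R : realFieldType) (x y a b : R) : 0 < a -> 0 < b ->
  `|x| * `|y| <= (b * (x ^+ 2 / a) + a * (y ^+ 2 / b)) / 2.
Proof.
move=> a0 b0; rewrite -(real_normK (num_real x)) -(real_normK (num_real y)).
set X := `|x|; set Y := `|y|; rewrite -subr_ge0.
have -> : (b * (X ^+ 2 / a) + a * (Y ^+ 2 / b)) / 2 - X * Y =
    (b * X - a * Y) ^+ 2 / (2 * a * b).
  by field; rewrite !gt_eqF.
by rewrite divr_ge0 ?sqr_ge0 // !mulr_ge0 // ltW.
Qed.

Section BinaryTree.
Variables (R : realFieldType) (T : eqType) (lch rch : T -> T) (P : T -> Prop).
Variable mu : T -> R.
Hypothesis Pl : forall I, P I -> P (lch I).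
Hypothesis Pr : forall I, P I -> P (rch I).
Hypothesis mu_ge0 : forall I, P I -> 0 <= mu I.
Hypothesis mu_lch : forall I, P I -> mu (lch I) = mu I / 2.
Hypothesis mu_rch : forall I, P I -> mu (rch I) = mu I / 2.

Fixpoint tree (n : nat) (I : T) : seq T :=
  if n is m.+1 then I :: tree m (lch I) ++ tree m (rch I) else [::].

Definition averaging (F : T -> R) :=
  forall I, P I -> F I = (F (lch I) + F (rch I)) / 2.

Definition half_diff (f : T -> R) (I : T) : R := (f (rch I) - f (lch I)) / 2.

Lemma averaging_rch (f : T -> R) I : averaging f -> P I ->
  f (rch I) = f I + half_diff f I.
Proof. by move=> fa PI; rewrite (fa _ PI) /half_diff; lra. Qed.

Lemma averaging_lch (f : T -> R) I : averaging f -> P I ->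
  f (lch I) = f I - half_diff f I.
Proof. by move=> fa PI; rewrite (fa _ PI) /half_diff; lra. Qed.

Lemma averaging_lch_le (F : T -> R) I : averaging F ->
  (forall J, P J -> 0 <= F J) -> P I -> F (lch I) <= 2 * F I.
Proof.
by move=> Fa F0 PI; rewrite (Fa _ PI); have := F0 _ (Pr PI); lra.
Qed.

Lemma averaging_rch_le (F : T -> R) I : averaging F ->
  (forall J, P J -> 0 <= F J) -> P I -> F (rch I) <= 2 * F I.
Proof.
by move=> Fa F0 PI; rewrite (Fa _ PI); have := F0 _ (Pl PI); lra.
Qed.

Lemma half_diff_eq0 (g G : T -> R) I : averaging G ->
  (forall J, P J -> `|g J| <= G J) -> P I -> G I <= 0 -> half_diff g I = 0.
Proof.
move=> Ga gG PI GI; have : G (lch I) + G (rch I) <= 0 by have := Ga _ PI; lra.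
have := gG _ (Pl PI); have := gG _ (Pr PI); rewrite /half_diff.
have := normr_ge0 (g (lch I)); have := normr_ge0 (g (rch I)).
have := ler_norm (g (lch I)); have := ler_norm (g (rch I)).
have := ler_norm (- g (lch I)); have := ler_norm (- g (rch I)).
rewrite !normrN; lra.
Qed.

Section Stopping.
Variables (F G : T -> R) (A : R).
Hypothesis Fa : averaging F.
Hypothesis Ga : averaging G.
Hypothesis F0 : forall I, P I -> 0 <= F I.
Hypothesis G0 : forall I, P I -> 0 <= G I.
Hypothesis A2 : 2 < A.

(** The principal intervals of F and G: a and b are the values of F and G at the
    last one above I, and I is the next one as soon as F or G has grown by a
    factor A.  Started with a = b = 0, the top interval stops unless F and G vanish
    on it.  Halving at most doubles an average, so the intervals in between
    satisfy [below_stop]. *)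
Fixpoint stops (n : nat) (I : T) (a b : R) : seq T :=
  if n is m.+1 then
    if (A * a < F I) || (A * b < G I) then
      I :: stops m (lch I) (F I) (G I) ++ stops m (rch I) (F I) (G I)
    else stops m (lch I) a b ++ stops m (rch I) a b
  else [::].

Definition below_stop (I : T) (a b : R) :=
  [/\ 0 <= a, 0 <= b, F I <= 2 * A * a & G I <= 2 * A * b].

Lemma below_stop_self I : P I -> below_stop (lch I) (F I) (G I) /\
  below_stop (rch I) (F I) (G I).
Proof.
have A2' := A2.
move=> PI; have f0 := F0 PI; have g0 := G0 PI.
have fA : 2 * F I <= 2 * A * F I by rewrite ler_double.
have gA : 2 * G I <= 2 * A * G I by rewrite ler_double.
split; split=> //.
- exact: le_trans (averaging_lch_le Fa F0 PI) fA.
- exact: le_trans (averaging_lch_le Ga G0 PI) gA.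
- exact: le_trans (averaging_rch_le Fa F0 PI) fA.
- exact: le_trans (averaging_rch_le Ga G0 PI) gA.
Qed.

Lemma below_stop_children I a b : P I -> 0 <= a -> 0 <= b ->
  F I <= A * a -> G I <= A * b -> below_stop (lch I) a b /\ below_stop (rch I) a b.
Proof.
have A2' := A2.
move=> PI a0 b0 fa gb.
have fA : 2 * F I <= 2 * A * a by lra.
have gA : 2 * G I <= 2 * A * b by lra.
split; split=> //.
- exact: le_trans (averaging_lch_le Fa F0 PI) fA.
- exact: le_trans (averaging_lch_le Ga G0 PI) gA.
- exact: le_trans (averaging_rch_le Fa F0 PI) fA.
- exact: le_trans (averaging_rch_le Ga G0 PI) gA.
Qed.

(** The quantity mu I * (F I / a + G I / b) is additive over the two halves of I.
    At a stopping interval it is at least A * mu I, and A = (A - 2) + 2: this pays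
    for mu I itself and for the value 2 * mu I of the same quantity after a and b
    have been replaced by F I and G I. *)
Lemma sum_stops_lt n I a b : P I -> below_stop I a b ->
  \sum_(K <- stops n I a b) mu K <= (A - 2)^-1 * mu I * (F I / a + G I / b).
Proof.
have A2' := A2.
have k0 : 0 < (A - 2)^-1 by rewrite invr_gt0 subr_gt0.
elim: n I a b => [|n IH] I a b PI [a0 b0 fa gb] /=.
  rewrite big_nil mulr_ge0 ?mulr_ge0 ?mu_ge0 ?(ltW k0)//.
  by rewrite addr_ge0 // divr_ge0 ?F0 ?G0.
case: ifPn => [st|]; last first.
  rewrite negb_or -!leNgt => /andP[st1 st2].
  have [bl br] := below_stop_children PI a0 b0 st1 st2.
  rewrite big_cat /=.
  apply: le_trans (lerD (IH _ _ _ (Pl PI) bl) (IH _ _ _ (Pr PI) br)) _.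
  rewrite mu_lch // mu_rch // (Fa PI) (Ga PI).
  by lra.
have [bl br] := below_stop_self PI.
rewrite big_cons big_cat /=.
apply: le_trans (lerD (lexx _) (lerD (IH _ _ _ (Pl PI) bl) (IH _ _ _ (Pr PI) br))) _.
rewrite mu_lch // mu_rch //.
have leAB : A <= F I / a + G I / b.
  case/orP: st => st.
  - have a1 : 0 < a.
      rewrite lt_def a0 andbT; apply/eqP => aE.
      by move: st fa; rewrite aE !mulr0; lra.
    have : A <= F I / a by rewrite ler_pdivlMr // ltW.
    have : 0 <= G I / b by rewrite divr_ge0 ?G0.
    by lra.
  - have b1 : 0 < b.
      rewrite lt_def b0 andbT; apply/eqP => bE.
      by move: st gb; rewrite bE !mulr0; lra.
    have : A <= G I / b by rewrite ler_pdivlMr // ltW.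
    have : 0 <= F I / a by rewrite divr_ge0 ?F0.
    by lra.
have s1 := div_halves_le2 (Fa PI) (F0 PI).
have s2 := div_halves_le2 (Ga PI) (G0 PI).
have m0 := mu_ge0 PI.
have km0 : 0 <= (A - 2)^-1 * mu I by rewrite mulr_ge0 // ltW.
apply: (@le_trans _ _ (mu I + (A - 2)^-1 * mu I * 2)).
  set k := (A - 2)^-1 * mu I in km0 *; rewrite lerD2l !mulrA -/k.
  nra.
apply: le_trans (ler_wpM2l km0 leAB).
rewrite -[X in X + _](@mulfK _ (A - 2)) ?subr_eq0 ?gt_eqF //.
by set k := (A - 2)^-1; lra.
Qed.

Lemma sum_stops_le n I a b : P I ->
  \sum_(K <- stops n I a b) mu K <= A / (A - 2) * mu I.
Proof.
have A2' := A2.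
have k0 : 0 < (A - 2)^-1 by rewrite invr_gt0 subr_gt0.
elim: n I a b => [|n IH] I a b PI /=.
  by rewrite big_nil mulr_ge0 ?mu_ge0 ?divr_ge0 //; lra.
case: ifPn => _; last first.
  rewrite big_cat /=.
  apply: le_trans (lerD (IH _ _ _ (Pl PI)) (IH _ _ _ (Pr PI))) _.
  rewrite mu_lch // mu_rch //.
  by set k := (A - 2)^-1; lra.
have [bl br] := below_stop_self PI.
rewrite big_cons big_cat /=.
apply: le_trans (lerD (lexx _) (lerD (sum_stops_lt n (Pl PI) bl) (sum_stops_lt n (Pr PI) br))) _.
rewrite mu_lch // mu_rch //.
have s1 := div_halves_le2 (Fa PI) (F0 PI).
have s2 := div_halves_le2 (Ga PI) (G0 PI).
have m0 := mu_ge0 PI.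
have km0 : 0 <= (A - 2)^-1 * mu I by rewrite mulr_ge0 // ltW.
apply: (@le_trans _ _ (mu I + (A - 2)^-1 * mu I * 2)).
  set k := (A - 2)^-1 * mu I in km0 *; rewrite lerD2l !mulrA -/k.
  nra.
rewrite -[X in X + _](@mulfK _ (A - 2)) ?subr_eq0 ?gt_eqF //.
by set k := (A - 2)^-1; lra.
Qed.

(** The function V n I a b is a budget for the sum of c over n generations below
    I as long as no interval stops.  It is replenished at each stopping interval
    K, at the cost C * F K * G K * mu K, so the whole sum of c is at most C times
    the sparse form of F and G over the stopping intervals. *)
Section Domination.
Variables (c : T -> R) (V : nat -> T -> R -> R -> R) (C : R).
Hypothesis V_ge0 : forall n I a b, P I -> below_stop I a b -> 0 <= V n I a b.
Hypothesis V_le : forall n I, P I -> V n I (F I) (G I) <= C * (F I * G I * mu I).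
Hypothesis V_step : forall n I a b, P I -> 0 <= a -> 0 <= b ->
  F I <= A * a -> G I <= A * b ->
  c I + (V n (lch I) a b + V n (rch I) a b) <= V n.+1 I a b.

Lemma sum_tree_le_below n I a b : P I -> below_stop I a b ->
  \sum_(J <- tree n I) c J <=
  C * (\sum_(K <- stops n I a b) F K * G K * mu K) + V n I a b.
Proof.
have A2' := A2.
elim: n I a b => [|n IH] I a b PI bs /=.
  by rewrite !big_nil mulr0 add0r V_ge0.
case: ifPn => [st|].
  have [bl br] := below_stop_self PI.
  have Vs : c I + (V n (lch I) (F I) (G I) + V n (rch I) (F I) (G I)) <=
     V n.+1 I (F I) (G I).
    apply: V_step; rewrite ?ler_double ?F0 ?G0 //.
  have := V_le n.+1 PI.
  have := V_ge0 n.+1 PI bs.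
  have := IH _ _ _ (Pl PI) bl; have := IH _ _ _ (Pr PI) br.
  rewrite !big_cons !big_cat /= !mulrDr; lra.
rewrite negb_or -!leNgt => /andP[st1 st2].
case: (bs) => a0 b0 _ _.
have [bl br] := below_stop_children PI a0 b0 st1 st2.
have := V_step n PI a0 b0 st1 st2.
have := IH _ _ _ (Pl PI) bl; have := IH _ _ _ (Pr PI) br.
rewrite !big_cons !big_cat /= !mulrDr; lra.
Qed.

Lemma sum_tree_le n I : P I ->
  \sum_(J <- tree n I) c J <= C * (\sum_(K <- stops n I 0 0) F K * G K * mu K).
Proof.
have A2' := A2.
move=> PI; case: n => [|n] /=; first by rewrite !big_nil mulr0.
rewrite !mulr0.
have [bl br] := below_stop_self PI.
have Vs : c I + (V n (lch I) (F I) (G I) + V n (rch I) (F I) (G I)) <=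
   V n.+1 I (F I) (G I).
  apply: V_step; rewrite ?ler_double ?F0 ?G0 //.
have := V_le n.+1 PI.
have := sum_tree_le_below n (Pl PI) bl; have := sum_tree_le_below n (Pr PI) br.
case: ifPn => [st|].
  rewrite !big_cons !big_cat /= !mulrDr; lra.
rewrite negb_or -!leNgt => /andP[st1 st2].
move: Vs; have -> : F I = 0 by apply/eqP; rewrite eq_le st1 F0.
have -> : G I = 0 by apply/eqP; rewrite eq_le st2 G0.
rewrite !big_cons !big_cat /= !mulrDr; lra.
Qed.

End Domination.

Lemma mem_stops n I a b K : K \in stops n I a b -> K \in tree n I.
Proof.
elim: n I a b => [|n IH] I a b //=.
case: ifPn => _; rewrite ?inE !mem_cat.
  by case/predU1P => [->|/orP[] /IH ->]; rewrite ?eqxx ?orbT.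
by case/orP => /IH ->; rewrite ?orbT.
Qed.

End Stopping.

Lemma stopsC (F G : T -> R) (A : R) n I a b :
  stops F G A n I a b = stops G F A n I b a.
Proof. by elim: n I a b => [|n IH] I a b //=; rewrite orbC !IH. Qed.

Section HaarForms.
Variables (F G f g : T -> R) (A : R).
Hypothesis Fa : averaging F.
Hypothesis Ga : averaging G.
Hypothesis fa : averaging f.
Hypothesis ga : averaging g.
Hypothesis fF : forall I, P I -> `|f I| <= F I.
Hypothesis gG : forall I, P I -> `|g I| <= G I.
Hypothesis A2 : 2 < A.

Let F0 I : P I -> 0 <= F I.
Proof. by move=> PI; apply: le_trans (fF PI). Qed.
Let G0 I : P I -> 0 <= G I.
Proof. by move=> PI; apply: le_trans (gG PI). Qed.

(** From I to its halves, the sum of mu I * f I ^ 2 grows by mu I times the square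
    of the half difference of f, and between stopping intervals f I ^ 2 / a is at
    most 4 * A ^ 2 * a.  The budget is what is still missing to this bound, for f
    with the factor b and for g with the factor a; the arithmetic-geometric
    inequality bounds the product of the half differences by the two gains. *)
Lemma martingale_form_le n I : P I ->
  \sum_(J <- tree n I) mu J * (`|half_diff f J| * `|half_diff g J|) <=
  4 * A ^+ 2 * (\sum_(K <- stops F G A n I 0 0) F K * G K * mu K).
Proof.
have A2' := A2.
pose V (n : nat) I (a b : R) := mu I *
  (8 * A ^+ 2 * (a * b) - b * (f I ^+ 2 / a) - a * (g I ^+ 2 / b)) / 2.
move: I; apply: (@sum_tree_le F G A Fa Ga F0 G0 A2 _ V).
- move=> m I a b PI [a0 b0 Fl Gl].
  have s1 := sqr_div_le (fF PI) Fl a0; have s2 := sqr_div_le (gG PI) Gl b0.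
  have m0 := mu_ge0 PI.
  rewrite /V divr_ge0 //.
  have : 0 <= mu I * (b * (4 * A ^+ 2 * a - f I ^+ 2 / a)) by rewrite !mulr_ge0 ?subr_ge0.
  have : 0 <= mu I * (a * (4 * A ^+ 2 * b - g I ^+ 2 / b)) by rewrite !mulr_ge0 ?subr_ge0.
  set u := _ / a; set v := _ / b; lra.
- move=> m I PI; rewrite /V.
  have m0 := mu_ge0 PI.
  have := F0 PI; have := G0 PI => g0 f0.
  have s1 : 0 <= f I ^+ 2 / F I by rewrite divr_ge0 // sqr_ge0.
  have s2 : 0 <= g I ^+ 2 / G I by rewrite divr_ge0 // sqr_ge0.
  move: s1 s2; set u := _ / F I; set v := _ / G I => s1 s2.
  have : 0 <= mu I * (G I * u) by rewrite mulr_ge0 // mulr_ge0.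
  have : 0 <= mu I * (F I * v) by rewrite mulr_ge0 // mulr_ge0.
  lra.
- move=> m I a b PI a0 b0 Fl Gl; rewrite /V mu_lch // mu_rch //.
  rewrite (averaging_rch fa PI) (averaging_rch ga PI) (averaging_lch fa PI)
    (averaging_lch ga PI).
  set x := half_diff f I; set y := half_diff g I.
  have key : `|x| * `|y| <= (b * (x ^+ 2 / a) + a * (y ^+ 2 / b)) / 2.
    move: a0; rewrite le_eqVlt => /predU1P[aE|a0].
      have -> : x = 0 by apply: (half_diff_eq0 Fa fF PI); rewrite (le_trans Fl) // -aE mulr0.
      by rewrite -aE normr0; lra.
    move: b0; rewrite le_eqVlt => /predU1P[bE|b0].
      have -> : y = 0 by apply: (half_diff_eq0 Ga gG PI); rewrite (le_trans Gl) // -bE mulr0.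
      by rewrite -bE normr0; lra.
    exact: weighted_amgm.
  have m0 := mu_ge0 PI.
  move: (ler_wpM2l m0 key).
  set u := a^-1; set v := b^-1; lra.
Qed.

(** Here z is at most A * a between stopping intervals, and only g has a
    martingale gain.  The other half of the budget is the Carleson mass
    mu K * beta K ^ 2 that remains below I. *)
Lemma paraproduct_form_le (beta : T -> R) (z : T -> R) (N K0 : R) n I :
  0 < N -> 0 <= K0 -> P I ->
  (forall J, P J -> `|z J| <= F J) ->
  (forall n J, P J -> \sum_(K <- tree n J) mu K * beta K ^+ 2 <= K0 * N ^+ 2 * mu J) ->
  \sum_(J <- tree n I) mu J * (`|beta J| * `|z J| * `|half_diff g J|) <=
  A / 2 * (K0 + 4 * A ^+ 2) * N *
    (\sum_(K <- stops F G A n I 0 0) F K * G K * mu K).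
Proof.
have A2' := A2.
move=> N0 K00 PI0 zF Hb.
pose M n I := \sum_(K <- tree n I) mu K * beta K ^+ 2.
have M0 m I' : P I' -> 0 <= M m I'.
  rewrite /M; elim: m I' => [|m IH] I' PI; first by rewrite big_nil.
  rewrite /= big_cons big_cat /= !addr_ge0 ?IH //.
    by rewrite mulr_ge0 ?sqr_ge0 ?mu_ge0.
    exact: Pl.
  exact: Pr.
pose V (n : nat) I (a b : R) := A * a / 2 *
  (b * (M n I / N) + N * (mu I * (4 * A ^+ 2 * b - g I ^+ 2 / b))).
move: I PI0; apply: (@sum_tree_le F G A Fa Ga F0 G0 A2 _ V).
- move=> m I a b PI [a0 b0 Fl Gl].
  have s2 := sqr_div_le (gG PI) Gl b0.
  have m0 := mu_ge0 PI.
  rewrite /V mulr_ge0 //; first by rewrite divr_ge0 // mulr_ge0 //; lra.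
  have N0' := ltW N0; rewrite addr_ge0 // mulr_ge0 //.
    by rewrite mulr_ge0 ?M0 // invr_ge0.
  by rewrite mulr_ge0 // subr_ge0.
- move=> m I PI; rewrite /V.
  have m0 := mu_ge0 PI.
  have := F0 PI; have := G0 PI => g0 f0.
  have s2 : 0 <= g I ^+ 2 / G I by rewrite divr_ge0 // sqr_ge0.
  have MN : M m I / N <= K0 * N * mu I.
    by rewrite ler_pdivrMr //; apply: le_trans (Hb m _ PI) _; rewrite le_eqVlt; apply/orP; left; apply/eqP; ring.
  have -> : A / 2 * (K0 + 4 * A ^+ 2) * N * (F I * G I * mu I) =
    A * F I / 2 * (G I * (K0 * N * mu I) + N * (mu I * (4 * A ^+ 2 * G I))) by ring.
  apply: ler_wpM2l; first by rewrite divr_ge0 // mulr_ge0 //; lra.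
  apply: lerD; first exact: ler_wpM2l.
  by apply: ler_wpM2l; [exact: ltW|apply: ler_wpM2l => //; lra].
- move=> m I a b PI a0 b0 Fl Gl; rewrite /V mu_lch // mu_rch //.
  rewrite (averaging_rch ga PI) (averaging_lch ga PI).
  set y := half_diff g I.
  have ME : M m.+1 I = mu I * beta I ^+ 2 + (M m (lch I) + M m (rch I)).
    by rewrite /M /= big_cons big_cat.
  rewrite ME.
  have m0 := mu_ge0 PI.
  have zA : `|z I| <= A * a by apply: le_trans (zF _ PI) Fl.
  have key : `|beta I| * `|y| <= (b * (beta I ^+ 2 / N) + N * (y ^+ 2 / b)) / 2.
    move: b0; rewrite le_eqVlt => /predU1P[bE|b0].
      have -> : y = 0 by apply: (half_diff_eq0 Ga gG PI); rewrite (le_trans Gl) // -bE mulr0.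
      by rewrite -bE normr0; lra.
    exact: weighted_amgm.
  have : mu I * (`|beta I| * `|z I| * `|y|) <=
     A * a * (mu I * ((b * (beta I ^+ 2 / N) + N * (y ^+ 2 / b)) / 2)).
    rewrite [X in _ <= X]mulrCA; apply: ler_wpM2l => //.
    have -> : `|beta I| * `|z I| * `|y| = `|z I| * (`|beta I| * `|y|) by ring.
    by apply: ler_pM => //; rewrite mulr_ge0.
  set u := N^-1; set v := b^-1; lra.
Qed.

End HaarForms.

(** The discrete John-Nirenberg inequality.  With c the average on the top
    interval, and H c J standing for the average of |b - c| over J, the descent stops
    where H c J exceeds 2 * N.  Above these intervals the squares of the half
    differences are the increments of the mean of (b J - c) ^ 2, which is at most
    16 * N ^ 2; the stopping intervals have total length at most half of mu I, and the sum below them is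
    bounded by the induction hypothesis. *)
Lemma carleson_half_diff (b : T -> R) (H : R -> T -> R) (N : R) n I :
  averaging b -> (forall c, averaging (H c)) ->
  (forall c J, P J -> `|b J - c| <= H c J) ->
  (forall J, P J -> H (b J) J <= N) -> 0 <= N -> P I ->
  \sum_(J <- tree n I) mu J * half_diff b J ^+ 2 <= 32 * N ^+ 2 * mu I.
Proof.
move=> ba Ha bH HN N0.
pose M n I := \sum_(J <- tree n I) mu J * half_diff b J ^+ 2.
rewrite -/(M n I); elim/ltn_ind: n I => n IHn I PI.
have ME m J : M m.+1 J = mu J * half_diff b J ^+ 2 + (M m (lch J) + M m (rch J)).
  by rewrite /M /= big_cons big_cat.
have H0 c J : P J -> 0 <= H c J by move=> PJ; apply: le_trans (bH _ _ PJ).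
set c := b I.
(* The term 16 * N * mu J * H c J pays for the bound 32 * N ^ 2 * mu J at a
   stopping interval. *)
have inner m J : (m < n)%N -> P J -> H c J <= 4 * N ->
    M m J <= mu J * (16 * N ^+ 2 - (b J - c) ^+ 2) + 16 * N * mu J * H c J.
  elim: m J => [|m IH] J mn PJ HJ.
    rewrite {1}/M /= big_nil.
    have m0 := mu_ge0 PJ; have h0 := H0 c _ PJ.
    rewrite addr_ge0 ?mulr_ge0 // subr_ge0 -real_normK ?num_real //.
    have : `|b J - c| <= 4 * N by apply: le_trans HJ; exact: bH.
    have := normr_ge0 (b J - c); nra.
  have [HJ2|HJ2] := lerP (H c J) (2 * N).
    have hl := averaging_lch_le (Ha c) (H0 c) PJ.
    have hr := averaging_rch_le (Ha c) (H0 c) PJ.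
    have il := IH _ (ltnW mn) (Pl PJ) ltac:(lra).
    have ir := IH _ (ltnW mn) (Pr PJ) ltac:(lra).
    rewrite ME; apply: le_trans (lerD (lexx _) (lerD il ir)) _.
    rewrite mu_lch // mu_rch // (averaging_rch ba PJ) (averaging_lch ba PJ) (Ha c _ PJ).
    by set x := half_diff b J; lra.
  apply: le_trans (IHn _ mn _ PJ) _.
  have m0 := mu_ge0 PJ.
  have : (b J - c) ^+ 2 <= 16 * N ^+ 2.
    rewrite -real_normK ?num_real //.
    have : `|b J - c| <= 4 * N by apply: le_trans HJ; exact: bH.
    have := normr_ge0 (b J - c); nra.
  have : 2 * N * (16 * N * mu J) <= H c J * (16 * N * mu J).
    by apply: ler_wpM2r; [rewrite !mulr_ge0|exact: ltW].
  set s := _ ^+ 2 => e1 e2.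
  have : 0 <= mu J * (16 * N ^+ 2 - s) by rewrite mulr_ge0 // subr_ge0.
  lra.
case: n IHn inner => [|n] IHn inner.
  by rewrite /M /= big_nil !mulr_ge0 ?mu_ge0 ?sqr_ge0.
have HI : H c I <= N by exact: HN.
have m0 := mu_ge0 PI.
have hl := averaging_lch_le (Ha c) (H0 c) PI.
have hr := averaging_rch_le (Ha c) (H0 c) PI.
have il := inner n (lch I) (ltnSn _) (Pl PI) ltac:(lra).
have ir := inner n (rch I) (ltnSn _) (Pr PI) ltac:(lra).
rewrite ME; apply: le_trans (lerD (lexx _) (lerD il ir)) _.
rewrite mu_lch // mu_rch // (averaging_rch ba PI) (averaging_lch ba PI) /c.
have : 16 * N * mu I * H c I <= 16 * N * mu I * N.
  by apply: ler_wpM2l => //; rewrite !mulr_ge0.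
rewrite (Ha c _ PI) /c.
set x := half_diff b I; lra.
Qed.

End BinaryTree.

(** * Khintchine inequality *)

Section Khintchine.
Variable R : realType.
Implicit Types (y : nat -> R) (s : R).

(** The mean of phi (s + e_0 y_0 + ... + e_(n-1) y_(n-1)) over all choices of the
    signs e_k. *)
Fixpoint sign_average n y (phi : R -> R) s : R :=
  if n is m.+1 then
    (sign_average m y phi (s + y m) + sign_average m y phi (s - y m)) / 2
  else phi s.

Lemma sign_average_le n y phi psi s : (forall x, phi x <= psi x) ->
  sign_average n y phi s <= sign_average n y psi s.
Proof.
move=> le; elim: n s => [|n IH] s //=.
by rewrite ler_pM2r ?invr_gt0 // lerD.
Qed.

Lemma sign_average_ge0 n y phi s : (forall x, 0 <= phi x) ->
  0 <= sign_average n y phi s.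
Proof. by move=> p0; elim: n s => [|n IH] s //=; rewrite divr_ge0 ?addr_ge0. Qed.

Lemma sign_average_sqr n y s :
  sign_average n y (fun x => x ^+ 2) s = s ^+ 2 + \sum_(k < n) y k ^+ 2.
Proof.
elim: n s => [|n IH] s /=; first by rewrite big_ord0 addr0.
by rewrite !IH big_ord_recr /=; field.
Qed.

Lemma sign_average_pow4 n y s :
  sign_average n y (fun x => x ^+ 4) s <=
  s ^+ 4 + 6 * s ^+ 2 * (\sum_(k < n) y k ^+ 2) + 3 * (\sum_(k < n) y k ^+ 2) ^+ 2.
Proof.
elim: n s => [|n IH] s /=; first by rewrite big_ord0 expr0n /= !mulr0 !addr0.
have := IH (s + y n); have := IH (s - y n).
rewrite big_ord_recr /=; set S := \sum_(k < n) _.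
have : 0 <= (y n) ^+ 4 by rewrite -[4%N]/(2 * 2)%N exprM sqr_ge0.
lra.
Qed.

Lemma sign_averageM n y (a b : R) s :
  sign_average n y (fun x => a * x ^+ 2 - b * x ^+ 4) s =
  a * sign_average n y (fun x => x ^+ 2) s - b * sign_average n y (fun x => x ^+ 4) s.
Proof. by elim: n s => [|n IH] s //=; rewrite !IH; field. Qed.

Lemma sign_averageZ n y phi (a : R) s :
  sign_average n y (fun x => a * phi x) s = a * sign_average n y phi s.
Proof. by elim: n s => [|n IH] s //=; rewrite !IH; field. Qed.

(** Let t be the l^2 norm of y.  The random sum x has second moment t ^ 2 and fourth
    moment at most 3 * t ^ 4, so that t ^ 2 * x ^ 2 - x ^ 4 / 4 has mean at least
    t ^ 4 / 4; and this polynomial is at most t ^ 3 * |x|. *)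
Lemma khintchine1 n y :
  Num.sqrt (\sum_(k < n) y k ^+ 2) / 4 <= sign_average n y (fun x => `|x|) 0.
Proof.
set Q := \sum_(k < n) _.
have Q0 : 0 <= Q by apply: sumr_ge0 => i _; exact: sqr_ge0.
set t := Num.sqrt Q.
have tQ : t ^+ 2 = Q by rewrite sqr_sqrtr.
have [t0|t0] := eqVneq t 0.
  by rewrite t0 mul0r sign_average_ge0.
have {}t0 : 0 < t by rewrite lt_def t0 sqrtr_ge0.
have := @sign_average_le n y (fun x => t ^+ 2 * x ^+ 2 - 4^-1 * x ^+ 4)
  (fun x => t ^+ 3 * `|x|) 0.
rewrite sign_averageM // sign_averageZ sign_average_sqr expr0n /= add0r -/Q -tQ.
have := sign_average_pow4 n y 0; rewrite -/Q -tQ !expr0n /= mulr0 mul0r !add0r.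
set X := sign_average _ _ _ _; set Z := sign_average _ _ _ _ => h4 h.
have key : t ^+ 3 * (t / 4) <= t ^+ 3 * Z.
  apply: le_trans (h _); last first.
    move=> x; rewrite -[4%N]/(2 * 2)%N exprM -(real_normK (num_real x)) -exprM.
    have u0 := normr_ge0 x; set u := `|x| in u0 *.
    (* u ^ 3 - 4 * t ^ 2 * u + 4 * t ^ 3 is nonnegative for u >= 0, since it
       exceeds (u - a) ^ 2 * (u + 2 * a) for this value of a. *)
    pose a := 7 / 6 * t.
    have : 0 <= u * ((u - a) ^+ 2 * (u + 2 * a)).
      by rewrite mulr_ge0 // mulr_ge0 ?sqr_ge0 // /a; lra.
    have : 0 <= u ^+ 2 * t ^+ 2 by rewrite mulr_ge0 ?sqr_ge0.
    have : 0 <= u * t ^+ 3 by rewrite mulr_ge0 // exprn_ge0 // ltW.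
    by rewrite /a; lra.
  lra.
by rewrite ler_pM2l ?exprn_gt0 // in key.
Qed.

End Khintchine.

(** * The spaces L^p of a measure *)

Section LpSpace.
Context {d : measure_display} {T : measurableType d} {R : realType}.
Variables (mu : {measure set T -> \bar R}) (p : R).
Hypothesis p1 : 1 <= p.

Local Notation "'N f" := (Lnorm mu p%:E (EFin \o f)) (at level 10, f at next level).

Let p0 : 0 < p. Proof. by rewrite (lt_le_trans _ p1). Qed.

Lemma poweR_LnormE (f : T -> R) :
  (('N f) `^ p = \int[mu]_x (`|f x| `^ p)%:E)%E.
Proof.
by rewrite poweR_Lnorm ?gt_eqF //; exact: eq_integral.
Qed.

Lemma lee_poweR2 (r : R) (x y : \bar R) : 0 <= r -> (0 <= x)%E -> (x <= y)%E ->
  (x `^ r <= y `^ r)%E.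
Proof.
move=> r0 x0 xy; apply: gt0_ler_poweR => //; rewrite in_itv /= leey andbT //.
exact: le_trans xy.
Qed.

Lemma poweRK (r : \bar R) : (0 <= r)%E -> ((r `^ p) `^ p^-1 = r)%E.
Proof. by move=> r0; rewrite -poweRrM divff ?gt_eqF // poweRe1. Qed.

Lemma Lnorm_leE (f : T -> R) (M : R) : 0 <= M ->
  ('N f <= M%:E)%E = (\int[mu]_x (`|f x| `^ p)%:E <= (M `^ p)%:E)%E.
Proof.
move=> M0; rewrite -poweR_LnormE -poweR_EFin.
apply/idP/idP => h; first by rewrite lee_poweR2 ?Lnorm_ge0 // ltW.
rewrite -[leLHS]poweRK ?Lnorm_ge0 // -[leRHS]poweRK ?lee_fin //.
by rewrite lee_poweR2 ?poweR_ge0 // invr_ge0 ltW.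
Qed.

Lemma measurable_normpow (f : T -> R) : measurable_fun setT f ->
  measurable_fun setT (fun x => (`|f x| `^ p)%:E).
Proof.
move=> mf; apply/measurable_EFinP.
apply: (@measurableT_comp _ _ _ _ _ _ (@powR R ^~ p)); first exact: measurable_powR.
exact: measurableT_comp.
Qed.

Lemma Lnorm_le_ae (f g : T -> R) : measurable_fun setT f -> measurable_fun setT g ->
  {ae mu, forall x, `|f x| <= `|g x|} -> ('N f <= 'N g)%E.
Proof.
move=> mf mg fg.
have [->|gfin] := eqVneq ('N g) +oo%E; first by rewrite leey.
have gf : 'N g \is a fin_num by rewrite ge0_fin_numE ?Lnorm_ge0 // ltey.
rewrite -(fineK gf) Lnorm_leE ?fine_ge0 ?Lnorm_ge0 // -poweR_EFin fineK // poweR_LnormE.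
apply: ae_ge0_le_integral => //; try exact: measurable_normpow.
by apply: filterS fg => x fg _; rewrite lee_fin ge0_ler_powR ?nnegrE // ltW.
Qed.

Lemma Lnorm_eq_ae (f g : T -> R) : measurable_fun setT f -> measurable_fun setT g ->
  {ae mu, forall x, f x = g x} -> 'N f = 'N g.
Proof.
move=> mf mg fg; apply/eqP; rewrite eq_le !Lnorm_le_ae //.
  by apply: filterS fg => x ->.
by apply: filterS fg => x ->.
Qed.

Lemma LnormN (f : T -> R) : 'N (fun x => - f x) = 'N f.
Proof. by rewrite -[RHS]oppe_Lnorm. Qed.

Lemma Lnorm_scale (f : T -> R) (a : R) : measurable_fun setT f ->
  ('N (fun x => a * f x)%R = `|a|%:E * 'N f)%E.
Proof.
move=> mf; rewrite unlock.
have -> : (\int[mu]_x (`|(EFin \o (fun x => a * f x)%R) x| `^ p) =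
    \int[mu]_x ((`|a| `^ p)%:E * (`|f x| `^ p)%:E))%E.
  by apply: eq_integral => x _; rewrite /= normrM powRM // EFinM.
rewrite ge0_integralZl //; last exact: measurable_normpow.
rewrite poweRM ?lee_fin ?powR_ge0 //; last first.
  by apply: integral_ge0 => x _; rewrite lee_fin powR_ge0.
congr (_ * _)%E.
by rewrite poweR_EFin -powRrM divff ?gt_eqF // powRr1.
Qed.

Lemma LnormD (f g : T -> R) : measurable_fun setT f -> measurable_fun setT g ->
  ('N (fun x => f x + g x)%R <= 'N f + 'N g)%E.
Proof. by move=> mf mg; exact: minkowski_EFin. Qed.

Lemma LnormB (f g : T -> R) : measurable_fun setT f -> measurable_fun setT g ->
  ('N (fun x => f x - g x)%R <= 'N f + 'N g)%E.
Proof.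
move=> mf mg; rewrite -(LnormN g); apply: LnormD => //.
exact: measurableT_comp.
Qed.

Lemma Lnorm_sum_le (I : Type) (s : seq I) (f : I -> T -> R) :
  (forall i, measurable_fun setT (f i)) ->
  ('N (fun x => \sum_(i <- s) f i x)%R <= \sum_(i <- s) 'N (f i))%E.
Proof.
move=> mf; elim: s => [|i s IH].
  rewrite big_nil; under [X in Lnorm _ _ X]eq_fun do rewrite /= big_nil.
  by rewrite -[X in (_ <= X)%E](@Lnorm0 _ _ _ mu p%:E) // eqe gt_eqF.
rewrite big_cons; under [X in Lnorm _ _ X]eq_fun do rewrite /= big_cons.
apply: le_trans (leeD2l _ IH).
apply: LnormD => //; exact: measurable_sum.
Qed.

Lemma Lnorm_fatou (f : nat -> T -> R) (g : T -> R) (M : R) :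
  (forall n, measurable_fun setT (f n)) -> measurable_fun setT g -> 0 <= M ->
  {ae mu, forall x, f ^~ x @ \oo --> g x} ->
  (\forall n \near \oo, ('N (f n) <= M%:E)%E) -> ('N g <= M%:E)%E.
Proof.
move=> mf mg M0 fg fM; rewrite Lnorm_leE //.
have := @fatou _ _ _ mu setT measurableT (fun n x => (`|f n x| `^ p)%:E).
move=> /(_ (fun n => measurable_normpow (mf n))).
move=> /(_ (fun n x _ => powR_ge0 _ _)) h.
have cpow (u : nat -> R) (l : R) : u @ \oo --> l ->
    (fun n => (`|u n| `^ p)%:E) @ \oo --> (`|l| `^ p)%:E.
  move=> ul; apply: cvg_EFin; first exact: nearW.
  have cn : (fun n => `|u n|) @ \oo --> `|l| by exact: cvg_norm.
  have [l0|l0] := eqVneq l 0.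
    rewrite l0 normr0 powR0 ?gt_eqF //.
    apply/cvgr0Pnorm_lt => e e0.
    have e1 : 0 < e `^ p^-1 by rewrite powR_gt0.
    move: cn; rewrite l0 normr0 => /cvgr0Pnorm_lt /(_ _ e1).
    apply: filterS => n /=; rewrite normr_id => un.
    rewrite ger0_norm ?powR_ge0 //.
    rewrite -[ltRHS](@powRr1 _ e) ?ltW // -(@mulVf _ p) ?gt_eqF // powRrM.
    by rewrite gt0_ltr_powR // ?nnegrE ?powR_ge0.
  have c : {for `|l|, continuous (@powR R ^~ p)}.
    apply: differentiable_continuous; apply/derivable1_diffP.
    by apply: derivable_powR; rewrite in_itv /= andbT normr_gt0.
  exact: (cvg_comp _ _ cn c).
apply: le_trans (_ : \int[mu]_x limn_einf (fun n => (`|f n x| `^ p)%:E) <= _)%E.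
  apply: ae_ge0_le_integral => //.
  - exact: measurable_normpow.
  - move=> x _; rewrite limn_einf_lim; apply: lime_ge; first exact: is_cvg_einfs.
    apply: nearW => n; apply: le_ereal_inf_tmp => _ [k _ <-].
    by rewrite lee_fin powR_ge0.
  - have -> : (fun x => limn_einf (fun n => (`|f n x| `^ p)%:E)) =
      (fun x => - limn_esup (fun n => - (`|f n x| `^ p)%:E))%E.
      apply/funext => x; rewrite -limn_einfN; congr limn_einf.
      by apply/funext => n /=; rewrite opprK.
    apply: measurableT_comp => //; apply: measurable_fun_limn_esup => n.
    by apply: measurableT_comp => //; exact: measurable_normpow.
  - apply: filterS fg => x fx _.
    have c := cpow _ _ fx.
    by rewrite is_cvg_limn_einfE ?(cvg_lim _ c) //; exact: (cvgP _ c).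
apply: le_trans h _.
rewrite limn_einf_lim; apply: lime_le; first exact: is_cvg_einfs.
apply: filterS fM => n; rewrite Lnorm_leE // => fM.
apply: ge_ereal_inf; exists (\int[mu]_x (`|f n x| `^ p)%:E)%E => //.
by exists n => //=.
Qed.
End LpSpace.

(** * Unconditional convergence in L^p *)

Section LpConvergence.
Context {d : measure_display} {T : measurableType d} {R : realType}.
Variables (mu : {measure set T -> \bar R}) (p : R).
Hypothesis p1 : 1 <= p.

Local Notation "'N f" := (Lnorm mu p%:E (EFin \o f)) (at level 10, f at next level).

Let p0 : 0 < p. Proof. by rewrite (lt_le_trans _ p1). Qed.

(** Monotone convergence: the limit of the p-th powers of a nondecreasing sequence
    that is bounded in L^p is integrable.  It serves as a majorant. *)
Lemma monotone_Lnorm_dominated (H : nat -> T -> R) (M : R) :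
  (forall n, measurable_fun setT (H n)) -> (forall n x, 0 <= H n x) ->
  (forall n x, H n x <= H n.+1 x) -> 0 <= M -> (forall n, ('N (H n) <= M%:E)%E) ->
  exists2 G : T -> \bar R, mu.-integrable setT G &
    forall n x, ((H n x `^ p)%:E <= G x)%E.
Proof.
move=> mH H0 HS M0 HM.
pose g n x := (`|H n x| `^ p)%:E.
have mg n : measurable_fun setT (g n) by exact: measurable_normpow.
have g0 n x : setT x -> (0 <= g n x)%E by move=> _; rewrite lee_fin powR_ge0.
have gS x : setT x -> {homo g^~ x : n m / (n <= m)%N >-> (n <= m)%E}.
  move=> _; apply: homo_leq => [//||n].
  - by move=> ? ? ?; exact: le_trans.
  - by rewrite lee_fin ge0_ler_powR ?nnegrE ?(ltW p0) // !ger0_norm.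
have gc x : cvgn (g^~ x) by apply: ereal_nondecreasing_is_cvgn; exact: gS.
exists (fun x => limn (g^~ x)); last first.
  move=> n x; rewrite -[X in (X `^ p)]ger0_norm //.
  have := ereal_nondecreasing_cvgn (gS x I) => h.
  apply: lime_ge; first exact: gc.
  by near=> m; apply: gS => //; near: m; exact: nbhs_infty_ge.
apply/integrableP; split.
  apply: (@emeasurable_fun_cvg _ _ _ _ g) => // x _; exact: gc.
under eq_integral => x _.
  rewrite gee0_abs; last by apply: lime_ge => //; apply: nearW => n; exact: g0.
  over.
rewrite /= monotone_convergence //.
apply: le_lt_trans (ltry (M `^ p)).
apply: lime_le.
  apply: ereal_nondecreasing_is_cvgn => n m nm.
  apply: ge0_le_integral => //; first by move=> x; exact: g0.
  by move=> x _; exact: gS.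
by apply: nearW => n; rewrite -Lnorm_leE.
Unshelve. all: by end_near. Qed.

(** The sums of the |s n.+1 - s n| are bounded in L^p, hence finite almost
    everywhere, so that s converges there; Fatou gives the rate. *)
Lemma riesz_fischer (s : nat -> T -> R) :
  (forall n, measurable_fun setT (s n)) ->
  (forall n, ('N (fun x => s n.+1 x - s n x)%R <= (2^-1 ^+ n)%:E)%E) ->
  exists2 g : T -> R, measurable_fun setT g &
    forall n, ('N (fun x => s n x - g x)%R <= (2 * 2^-1 ^+ n)%:E)%E.
Proof.
move=> ms sN.
pose D k x := s k.+1 x - s k x.
have mD k : measurable_fun setT (D k) by exact: measurable_funB.
pose H n x := \sum_(0 <= k < n) `|D k x|.
have mH n : measurable_fun setT (H n).
  by apply: measurable_sum => k; exact: measurableT_comp.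
have tel m n : (m <= n)%N -> ('N (fun x => s n x - s m x)%R <= (2 * 2^-1 ^+ m - 2 * 2^-1 ^+ n)%:E)%E.
  move=> mn; rewrite -(subnK mn); elim: (n - m)%N => [|k IH].
    rewrite add0n; have -> : (fun x => s m x - s m x) = (cst 0) by apply/funext => x; rewrite subrr.
    by rewrite [X in (X <= _)%E](@Lnorm0 _ _ _ mu p%:E) ?subrr // eqe gt_eqF.
  have -> : (fun x => s (k.+1 + m)%N x - s m x) =
      (fun x => D (k + m)%N x + (s (k + m)%N x - s m x)).
    by apply/funext => x; rewrite /D addSn addrA subrK.
  apply: le_trans (LnormD _ _ _ _) _ => //; first exact: measurable_funB.
  apply: le_trans (leeD (sN _) IH) _.
  by rewrite -EFinD lee_fin addSn exprS; lra.
have HN n : ('N (H n) <= 2%:E)%E.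
  apply: le_trans (Lnorm_sum_le _ _ _ _) _ => //.
    by move=> k; exact: measurableT_comp.
  apply: (@le_trans _ _ (\sum_(0 <= k < n) (2^-1 ^+ k : R)%:E)%E).
    apply: lee_sum => k _; rewrite [X in (X <= _)%E](@Lnorm_abse _ _ _ mu (EFin \o D k)).
    exact: sN.
  rewrite sumEFin lee_fin.
  suff -> : \sum_(0 <= k < n) 2^-1 ^+ k = 2 - 2 * 2^-1 ^+ n :> R.
    by rewrite lerBlDr lerDl mulr_ge0 // exprn_ge0.
  elim: n => [|n IH]; first by rewrite big_geq // expr0; lra.
  by rewrite big_nat_recr //= IH exprS; lra.
have [G iG HG] := monotone_Lnorm_dominated mH
  (fun n x => sumr_ge0 _ (fun k _ => normr_ge0 _))
  (fun n x => ltac:(by rewrite /H big_nat_recr //= lerDl)) (ler0n _ 2) HN.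
pose A := [set x | G x \is a fin_num].
have mA : measurable A.
  by have := emeasurable_fin_num measurableT (measurable_int mu iG); rewrite setTI.
pose s' n x := s n x * \1_A x.
have cs x : A x -> cvgn (fun n => s n x).
  move=> Ax.
  have Gx : G x = (fine (G x))%:E by rewrite fineK.
  have cH : cvgn (series (fun k => `|D k x|)).
    apply: nondecreasing_is_cvgn.
      by apply: nondecreasing_series => k _ _; exact: normr_ge0.
    exists (fine (G x) `^ p^-1) => _ [n _ <-].
    have := HG n x; rewrite Gx lee_fin => h.
    rewrite -[leLHS](@powRr1 _ (H n x)) ?sumr_ge0 // -(@mulfV _ p) ?gt_eqF // powRrM.
    rewrite ge0_ler_powR ?nnegrE ?invr_ge0 ?powR_ge0 ?(ltW p0) //.
    by rewrite (le_trans _ h) ?powR_ge0.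
  have cD : cvgn (series (fun k => D k x)) by exact: normed_cvg.
  have -> : (fun n => s n x) = (fun n => s 0%N x + series (fun k => D k x) n).
    apply/funext => n; rewrite /series /D /=; elim: n => [|n IH].
      by rewrite big_geq // addr0.
    by rewrite big_nat_recr //= addrA -IH addrC subrK.
  by apply: is_cvgD => //; exact: is_cvg_cst.
have cs' x : cvgn (fun n => s' n x).
  rewrite /s'; have [Ax|Ax] := pselect (A x).
    by apply: is_cvgM; [exact: cs|exact: is_cvg_cst].
  by rewrite indicE memNset //; under eq_fun do rewrite mulr0; exact: is_cvg_cst.
pose g x := limn (fun n => s' n x).
have mg : measurable_fun setT g.
  apply: (@measurable_fun_cvg _ _ _ _ s') => [m|x _]; last exact: cs'.
  by apply: measurable_funM => //; exact: measurable_indic.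
exists g => // n.
apply: (@Lnorm_fatou _ _ _ mu p p1 (fun m x => s n x - s m x)).
- by move=> m; exact: measurable_funB.
- exact: measurable_funB.
- by rewrite mulr_ge0 // exprn_ge0.
- have := integrable_ae measurableT iG.
  apply: filterS => x /(_ I) Ax.
  apply: cvgB; first exact: cvg_cst.
  have -> : (fun m => s m x) = (fun m => s' m x).
    by apply/funext => m; rewrite /s' indicE mem_set // mulr1.
  exact: cs'.
- near=> m.
  have nm : (n <= m)%N by near: m; exact: nbhs_infty_ge.
  have -> : (fun x => s n x - s m x) = (fun x => - (s m x - s n x)).
    by apply/funext => x; rewrite opprB.
  rewrite LnormN; apply: le_trans (tel _ _ nm) _.
  by rewrite lee_fin lerBlDr lerDl mulr_ge0 // exprn_ge0.
Unshelve. all: by end_near. Qed.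

(** Convexity of the p-th power, which moves it inside [sign_average]. *)
Lemma powR_half_le (a b : R) : 0 <= a -> 0 <= b ->
  ((a + b) / 2) `^ p <= (a `^ p + b `^ p) / 2.
Proof.
move=> a0 b0; rewrite [_ / 2]mulrC [X in _ <= X]mulrC !mulrDr.
rewrite {2 4}(_ : 2^-1 = 1 - 2^-1); last by rewrite {2}(splitr 1) div1r addrK.
by apply: (convex_powR p1 (Itv01 _ _)) => //=;
  rewrite ?inE/= ?in_itv/= ?andbT // ?invr_ge0// invf_le1 ?ler1n.
Qed.

Lemma sign_average_powR n (y : nat -> R) s :
  sign_average n y (fun t => `|t|) s `^ p <= sign_average n y (fun t => `|t| `^ p) s.
Proof.
elim: n s => [|n IH] s //=.
apply: le_trans (powR_half_le _ _) _; rewrite ?sign_average_ge0 //.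
by rewrite ler_pM2r ?invr_gt0 // lerD.
Qed.

Lemma measurable_sign_average n (y : nat -> T -> R) (s : T -> R) (phi : R -> R) :
  measurable_fun setT phi -> (forall k, measurable_fun setT (y k)) ->
  measurable_fun setT s ->
  measurable_fun setT (fun x => sign_average n (y ^~ x) phi (s x)).
Proof.
move=> mphi my; elim: n s => [|n IH] s ms /=; first exact: measurableT_comp.
apply: measurable_funM => //; apply: measurable_funD; apply: IH.
  exact: measurable_funD.
exact: measurable_funB.
Qed.

Lemma integral_sign_average_le n (y : nat -> T -> R) (s : T -> R) (M : R) :
  (forall k, measurable_fun setT (y k)) -> measurable_fun setT s -> 0 <= M ->
  (forall e : nat -> bool,
    ('N (fun x => s x + \sum_(k < n) (-1) ^+ e k * y k x)%R <= M%:E)%E) ->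
  (\int[mu]_x (sign_average n (y ^~ x) (fun t => `|t| `^ p) (s x))%:E <= (M `^ p)%:E)%E.
Proof.
move=> my ms M0.
have mphi : measurable_fun setT (fun t : R => `|t| `^ p).
  apply: (@measurableT_comp _ _ _ _ _ _ (@powR R ^~ p)); first exact: measurable_powR.
  exact: normr_measurable.
elim: n s ms => [|n IH] s ms sN /=.
  rewrite -Lnorm_leE //; have := sN (fun=> false).
  by under [X in Lnorm _ _ X]eq_fun do rewrite /= big_ord0 addr0.
have h1 := IH (fun x => s x + y n x) (measurable_funD ms (my n)).
have h2 := IH (fun x => s x - y n x) (measurable_funB ms (my n)).
have {}h1 : (\int[mu]_x (sign_average n (y ^~ x) (fun t => `|t| `^ p) (s x + y n x)%R)%:E <= (M `^ p)%:E)%E.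
  apply: h1 => e; have := sN (fun k => if k == n then false else e k).
  under [X in Lnorm _ _ X]eq_fun => x do rewrite /= big_ord_recr /= eqxx mul1r.
  apply: le_trans; rewrite le_eqVlt; apply/orP; left; apply/eqP; congr Lnorm.
  apply/funext => x /=; congr EFin; rewrite -addrA; congr (_ + _); rewrite addrC; congr (_ + _).
  by apply: eq_bigr => i _; rewrite ltn_eqF.
have {}h2 : (\int[mu]_x (sign_average n (y ^~ x) (fun t => `|t| `^ p) (s x - y n x)%R)%:E <= (M `^ p)%:E)%E.
  apply: h2 => e; have := sN (fun k => if k == n then true else e k).
  under [X in Lnorm _ _ X]eq_fun => x do rewrite /= big_ord_recr /= eqxx mulN1r.
  apply: le_trans; rewrite le_eqVlt; apply/orP; left; apply/eqP; congr Lnorm.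
  apply/funext => x /=; congr EFin; rewrite -addrA; congr (_ + _); rewrite addrC; congr (_ + _).
  by apply: eq_bigr => i _; rewrite ltn_eqF.
have pos (z : R) m x : (0 <= (sign_average m (y ^~ x) (fun t => `|t| `^ p) z)%:E)%E.
  by rewrite lee_fin sign_average_ge0 // => t; exact: powR_ge0.
under eq_integral do rewrite mulrC EFinM EFinD.
rewrite ge0_integralZl //; last 2 first.
- apply: emeasurable_funD; apply/measurable_EFinP.
    by apply: measurable_sign_average => //; exact: measurable_funD.
  by apply: measurable_sign_average => //; exact: measurable_funB.
- by move=> x _; rewrite adde_ge0.
rewrite ge0_integralD //; last 2 first.
- apply/measurable_EFinP.
  by apply: measurable_sign_average => //; exact: measurable_funD.
- apply/measurable_EFinP.
  by apply: measurable_sign_average => //; exact: measurable_funB.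
apply: (@le_trans _ _ ((2^-1)%:E * ((M `^ p)%:E + (M `^ p)%:E))%E).
  by apply: lee_wpmul2l => //; exact: leeD.
by rewrite -EFinD -EFinM lee_fin; lra.
Qed.

Lemma Lnorm_square_function_le n (y : nat -> T -> R) (M : R) :
  (forall k, measurable_fun setT (y k)) -> 0 <= M ->
  (forall e : nat -> bool,
    ('N (fun x => \sum_(k < n) (-1) ^+ e k * y k x)%R <= M%:E)%E) ->
  ('N (fun x => Num.sqrt (\sum_(k < n) y k x ^+ 2) / 4)%R <= M%:E)%E.
Proof.
move=> my M0 sN; rewrite Lnorm_leE //.
apply: le_trans (@integral_sign_average_le n y (cst 0) M my _ M0 _) => //; last first.
  by move=> e; under [X in Lnorm _ _ X]eq_fun do rewrite /= add0r; exact: sN.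
apply: ge0_le_integral => //.
- apply: measurable_normpow; apply: measurable_funM => //.
  apply: (measurableT_comp (continuous_measurable_fun (@sqrt_continuous R))); apply: measurable_sum => k.
  exact: measurable_funX.
- apply/measurable_EFinP; apply: measurable_sign_average => //.
  apply: (@measurableT_comp _ _ _ _ _ _ (@powR R ^~ p)); first exact: measurable_powR.
  exact: normr_measurable.
- move=> x _; rewrite lee_fin; apply: le_trans (sign_average_powR _ _ _).
  have q0 : 0 <= Num.sqrt (\sum_(k < n) y k x ^+ 2) / 4 by rewrite divr_ge0 // sqrtr_ge0.
  rewrite ger0_norm // ge0_ler_powR ?nnegrE ?(ltW p0) ?sign_average_ge0 //.
  exact: khintchine1.
Qed.

(** By Khintchine the square functions of the partial sums are bounded in L^p by
    4 * M.  So the sum of the y k ^ 2 is finite almost everywhere, which makes y k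
    tend to 0 there, and all |y k| have a common majorant in L^p; by dominated
    convergence y k tends to 0 in L^p. *)
Lemma bounded_signs_small (y : nat -> T -> R) (M eps : R) :
  (forall k, measurable_fun setT (y k)) -> 0 <= M -> 0 < eps ->
  (forall n (e : nat -> bool),
    ('N (fun x => \sum_(k < n) (-1) ^+ e k * y k x)%R <= M%:E)%E) ->
  exists k, ('N (y k) < eps%:E)%E.
Proof.
move=> my M0 e0 sN; apply: contrapT => /forallNP no.
pose Q n x := Num.sqrt (\sum_(k < n) y k x ^+ 2) / 4.
have mQ n : measurable_fun setT (Q n).
  apply: measurable_funM => //.
  apply: (measurableT_comp (continuous_measurable_fun (@sqrt_continuous R))); apply: measurable_sum => k.
  exact: measurable_funX.
have QS n x : Q n x <= Q n.+1 x.
  by rewrite /Q ler_pM2r ?invr_gt0 // ler_wsqrtr // big_ord_recr /= lerDl sqr_ge0.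
have [G iG QG] := monotone_Lnorm_dominated mQ
  (fun n x => divr_ge0 (sqrtr_ge0 _) (ler0n _ 4)) QS M0
  (fun n => Lnorm_square_function_le my M0 (sN n)).
have yQ k x : `|y k x| <= 4 * Q k.+1 x.
  rewrite /Q mulrC divfK // -sqrtr_sqr ler_wsqrtr //.
  by rewrite big_ord_recr /= lerDr sumr_ge0 // => i _; exact: sqr_ge0.
pose f k x := (`|y k x| `^ p)%:E.
have fG k x : (`|f k x| <= (4 `^ p)%:E * G x)%E.
  rewrite gee0_abs ?lee_fin ?powR_ge0 //.
  apply: (@le_trans _ _ ((4 * Q k.+1 x) `^ p)%:E).
    by rewrite lee_fin ge0_ler_powR ?nnegrE ?(ltW p0) // (le_trans _ (yQ k x)).
  rewrite powRM ?EFinM //; last by rewrite divr_ge0 // sqrtr_ge0.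
  by apply: lee_wpmul2l => //; rewrite lee_fin powR_ge0.
have cf : {ae mu, forall x, setT x -> f ^~ x @ \oo --> (cst 0 x : \bar R)}.
  have := integrable_ae measurableT iG.
  apply: filterS => x /(_ I) Gx _.
  have GE : G x = (fine (G x))%:E by rewrite fineK.
  have cS : cvgn (series (fun k => y k x ^+ 2)).
    apply: nondecreasing_is_cvgn.
      by apply: nondecreasing_series => k _ _; exact: sqr_ge0.
    exists ((4 * fine (G x) `^ p^-1) ^+ 2) => _ [n _ <-].
    have := QG n x; rewrite GE lee_fin => h.
    have Q0 : 0 <= Q n x by rewrite divr_ge0 // sqrtr_ge0.
    have : Q n x <= fine (G x) `^ p^-1.
      rewrite -[leLHS](@powRr1 _ (Q n x)) // -(@mulfV _ p) ?gt_eqF // powRrM.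
      rewrite ge0_ler_powR ?nnegrE ?invr_ge0 ?powR_ge0 ?(ltW p0) //.
      by rewrite (le_trans _ h) ?powR_ge0.
    rewrite /Q ler_pdivrMr // mulrC => h2.
    rewrite /series /= big_mkord -[leLHS](@sqr_sqrtr R) ?sumr_ge0 // => [|i _]; last exact: sqr_ge0.
    by rewrite lerXn2r ?nnegrE ?sqrtr_ge0 // mulr_ge0 // powR_ge0.
  have := cvg_series_cvg_0 cS => c0.
  rewrite /f /=; apply: cvg_EFin; first exact: nearW.
  apply/cvgr0Pnorm_lt => e e1.
  have e2 : 0 < (e `^ p^-1) ^+ 2 by rewrite exprn_gt0 // powR_gt0.
  move/cvgr0Pnorm_lt: c0 => /(_ _ e2); apply: filterS => n /=.
  rewrite normrX ltr_pXn2r ?nnegrE ?powR_ge0 // => un.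
  rewrite ger0_norm ?powR_ge0 //.
  rewrite -[ltRHS](@powRr1 _ e) ?ltW // -(@mulVf _ p) ?gt_eqF // powRrM.
  by rewrite gt0_ltr_powR // ?nnegrE ?powR_ge0.
have [//| | |_ _ /=] := @dominated_convergence _ _ _ mu setT measurableT f (cst 0)
  (fun x => (4 `^ p)%:E * G x)%E (fun k => measurable_normpow p (my k)) _ cf _ _.
- exact: integrableZl.
- by apply: aeW => x n _; exact: fG.
rewrite integral0 => c.
have : (((eps `^ p)%:E : \bar R) <= limn (fun n => \int[mu]_x f n x))%E.
  apply: lime_ge; first exact: cvgP c.
  apply: nearW => n.
  rewrite (_ : \int[mu]_x f n x = 'N (y n) `^ p)%E; last by rewrite poweR_LnormE.
  rewrite -poweR_EFin.
  apply: lee_poweR2; rewrite ?(ltW p0) ?lee_fin ?(ltW e0) //.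
  by rewrite leNgt; apply/negP; exact: no.
by rewrite (cvg_lim _ c) // lee_fin leNgt powR_gt0.
Qed.

Section Unconditional.
Variables (K : eqType) (X : K -> T -> R) (E : K -> Prop) (M : R).
Hypothesis mX : forall k, measurable_fun setT (X k).
Hypothesis M0 : 0 <= M.

Definition finite_subfamily (s : seq K) := uniq s /\ forall k, k \in s -> E k.

Hypothesis signed_sums_le : forall s (e : K -> bool), finite_subfamily s ->
  ('N (fun x => \sum_(k <- s) (-1) ^+ e k * X k x)%R <= M%:E)%E.

Let mS s : measurable_fun setT (fun x => \sum_(k <- s) X k x).
Proof. exact: measurable_sum. Qed.

(** Otherwise there are infinitely many disjoint finite blocks whose sums have norm
    at least eps, although all their signed sums are bounded. *)
Lemma small_tails (eps : R) : 0 < eps ->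
  exists2 s0, finite_subfamily s0 & forall s, finite_subfamily s ->
    (forall k, k \in s -> k \notin s0) ->
    ('N (fun x => \sum_(k <- s) X k x)%R < eps%:E)%E.
Proof.
move=> e0; apply: contrapT => no.
have nxtP s0 : exists s, finite_subfamily s0 -> [/\ finite_subfamily s,
    forall k, k \in s -> k \notin s0 &
    ~ ('N (fun x => \sum_(k <- s) X k x)%R < eps%:E)%E].
  apply: contrapT => /forallNP no'; apply: no; exists s0.
    by apply: contrapT => ns0; apply: (no' [::]).
  move=> s fs ds; apply: contrapT => ns.
  by apply: (no' s).
have [nxt nP] := choice nxtP.
pose acc := fix acc n := if n is m.+1 then acc m ++ nxt (acc m) else [::].
have accP n : finite_subfamily (acc n).
  elim: n => [|n IH]; first by split.
  have [[us Es] ds _] := nP _ IH; case: IH => ua Ea; split => /=.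
    rewrite cat_uniq ua us andbT /=.
    by apply/hasPn => k ks; exact: ds.
  by move=> k; rewrite mem_cat => /orP[/Ea|/Es].
pose y n x := \sum_(k <- nxt (acc n)) X k x.
have [|n e|n] := @bounded_signs_small y M eps _ M0 e0.
- by move=> n; exact: mS.
- have [e' ee'] : exists e' : K -> bool, forall x,
      \sum_(k < n) (-1) ^+ e k * y k x = \sum_(k <- acc n) (-1) ^+ e' k * X k x.
    elim: n => [|n [e' IH]].
      by exists (fun=> false) => x; rewrite big_ord0 big_nil.
    have [_ ds _] := nP _ (accP n).
    exists (fun k => if k \in nxt (acc n) then e n else e' k) => x.
    rewrite big_ord_recr /= IH big_cat /=; congr (_ + _).
      rewrite !big_seq; apply: eq_bigr => k kacc.
      by case: ifPn => // /ds; rewrite kacc.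
    rewrite /y mulr_sumr !big_seq; apply: eq_bigr => k ->.
    by [].
  under [X in Lnorm _ _ X]eq_fun do rewrite /= ee'.
  exact: signed_sums_le.
- by have [_ _] := nP _ (accP n).
Qed.

Lemma big_subfamily (s0 s : seq K) (f : K -> R) : uniq s0 -> uniq s ->
  {subset s0 <= s} ->
  \sum_(k <- s) f k = \sum_(k <- s0) f k + \sum_(k <- [seq k <- s | k \notin s0]) f k.
Proof.
move=> us0 us s0s; rewrite -big_cat; apply: perm_big; apply: uniq_perm => //.
  rewrite cat_uniq us0 filter_uniq // andbT /=.
  by apply/hasPn => k; rewrite mem_filter => /andP[].
move=> k; rewrite mem_cat mem_filter.
by case: (boolP (k \in s0)) => [/s0s ->|].
Qed.

(** The partial sums over an increasing sequence of finite families that leave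
    tails of norm less than 2 ^ -n converge by [riesz_fischer], and every larger
    family stays close to them. *)
Lemma unconditional_convergence :
  exists g : T -> R, [/\ measurable_fun setT g, ('N g <= M%:E)%E &
    forall eps : R, 0 < eps -> exists2 s0, finite_subfamily s0 &
      forall s, finite_subfamily s -> {subset s0 <= s} ->
      ('N (fun x => \sum_(k <- s) X k x - g x)%R < eps%:E)%E].
Proof.
have tP n : exists s0, finite_subfamily s0 /\ forall s, finite_subfamily s ->
    (forall k, k \in s -> k \notin s0) ->
    ('N (fun x => \sum_(k <- s) X k x)%R < (2^-1 ^+ n)%:E)%E.
  have [|s0 f0 h0] := @small_tails (2^-1 ^+ n); first by rewrite exprn_gt0.
  by exists s0.
have [t {}tP] := choice tP.
pose h := fix h n := if n is m.+1 then undup (h m ++ t m.+1) else t 0%N.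
have hP n : finite_subfamily (h n).
  case: n => [|n] /=; first by have [] := tP 0%N.
  split; first exact: undup_uniq.
  move=> k; rewrite mem_undup; elim: n => [|n IH] /=; rewrite mem_cat => /orP[].
  - by have [[_ +] _] := tP 0%N; apply.
  - by have [[_ +] _] := tP 1%N; apply.
  - by rewrite mem_undup => /IH.
  - by have [[_ +] _] := tP n.+2; apply.
have th n : {subset t n <= h n}.
  by case: n => [|n] k kt //=; rewrite mem_undup mem_cat kt orbT.
have hS n : {subset h n <= h n.+1}.
  by move=> k kt /=; rewrite mem_undup mem_cat kt.
have tail n s : finite_subfamily s -> {subset h n <= s} ->
    ('N (fun x => \sum_(k <- [seq k <- s | k \notin h n]) X k x)%R < (2^-1 ^+ n)%:E)%E.
  move=> [us Es] hs; have [_ tn] := tP n; apply: tn; first split.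
  - exact: filter_uniq.
  - by move=> k; rewrite mem_filter => /andP[_ /Es].
  - move=> k; rewrite mem_filter => /andP[kh _].
    by apply: contra kh => /th.
have split n s : finite_subfamily s -> {subset h n <= s} -> forall x,
    \sum_(k <- s) X k x = \sum_(k <- h n) X k x +
      \sum_(k <- [seq k <- s | k \notin h n]) X k x.
  by move=> [us _] hs x; apply: big_subfamily => //; have [] := hP n.
have [//||g mg gP] := @riesz_fischer (fun n x => \sum_(k <- h n) X k x).
  move=> n; apply: ltW; apply: le_lt_trans (tail n _ (hP n.+1) (hS n)).
  rewrite le_eqVlt; apply/orP; left; apply/eqP; congr Lnorm.
  by apply/funext => x /=; rewrite (split n _ (hP n.+1) (hS n)) addrAC subrr add0r.
have mh n : measurable_fun setT (fun x => \sum_(k <- h n) X k x) by exact: mS.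
have small (eps : R) : 0 < eps -> exists n, 3 * 2^-1 ^+ n < eps :> R.
  move=> e0.
  have /cvgr0Pnorm_lt /(_ (eps / 3)) : (fun n => (2^-1 : R) ^+ n) @ \oo --> 0.
    by apply: cvg_expr; rewrite ger0_norm ?invr_ge0 // invf_lt1 // ltr1n.
  rewrite divr_gt0 // => /(_ isT)[n _ /(_ n (leqnn n)) /=].
  rewrite ger0_norm ?exprn_ge0 ?invr_ge0 // ltr_pdivlMr // mulrC => lt.
  by exists n.
exists g; split=> //.
- apply/lee_addgt0Pr => e e0.
  have [n ne] := small _ e0.
  have -> : g = (fun x => \sum_(k <- h n) X k x - (\sum_(k <- h n) X k x - g x)).
    by apply/funext => x; rewrite opprB addrC subrK.
  apply: le_trans (LnormB _ _ _ _) _ => //; first exact: measurable_funB.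
  apply: leeD.
    have := signed_sums_le (fun=> false) (hP n).
    by under [X in Lnorm _ _ X]eq_fun do under eq_bigr do rewrite mul1r.
  apply: le_trans (gP n) _; rewrite lee_fin; apply: le_trans (ltW ne).
  by rewrite ler_wpM2r ?exprn_ge0 ?invr_ge0 // ler_nat.
- move=> e e0; have [n ne] := small _ e0.
  exists (h n) => // s fs hs.
  have -> : (fun x => \sum_(k <- s) X k x - g x) =
     (fun x => \sum_(k <- [seq k <- s | k \notin h n]) X k x + (\sum_(k <- h n) X k x - g x)).
    by apply/funext => x; rewrite (split n _ fs hs) addrA [X in X - _]addrC.
  apply: le_lt_trans (LnormD _ _ _ _) _ => //; first exact: measurable_funB.
  apply: (@lt_le_trans _ _ ((2^-1 ^+ n)%:E + (2 * 2^-1 ^+ n)%:E)%E).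
    apply: lte_leD; [|exact: tail|exact: gP].
    by rewrite ge0_fin_numE ?Lnorm_ge0 // (le_lt_trans (gP n)) ?ltry.
  by rewrite -EFinD lee_fin; apply: le_trans (ltW ne); lra.
Qed.

End Unconditional.

End LpConvergence.

(** * Weighted norms and operators defined by series *)

Lemma finite_set_uniq_seq (K : choiceType) (F : set K) : finite_set F ->
  exists2 s : seq K, uniq s & F = [set` s].
Proof.
move=> /finite_seqP[s ->]; exists (undup s); first exact: undup_uniq.
by apply/seteqP; split => k /=; rewrite mem_undup.
Qed.

Lemma LnormE d (T : measurableType d) (R : realType)
    (mu : {measure set T -> \bar R}) (r : R) (f : T -> R) :
  ('N[mu]_r%:E[EFin \o f] = (\int[mu]_x (`|f x| `^ r)%:E) `^ r^-1)%E.
Proof.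
by rewrite unlock; congr (_ `^ _)%E; apply: eq_integral => x _; rewrite /= poweR_EFin.
Qed.

(* Inference does not reach this filter through the structure of measurable type
   carried by the domain of the Lebesgue measure. *)
#[global] Instance ae_lebesgue_filter (R : realType) :
  Filter (nbhs (almost_everywhere (@lebesgue_measure R))).
Proof. exact: (ae_filter_ringOfSetsType (@lebesgue_measure R)). Qed.

Lemma measurable_big_seq d (T : measurableType d) (R : realType) (K : eqType)
    (t : seq K) (x : K -> T -> R) :
  (forall J, J \in t -> measurable_fun setT (x J)) ->
  measurable_fun setT (fun y => \sum_(J <- t) x J y).
Proof.
elim: t => [|J t IH] mx.
  by under eq_fun do rewrite big_nil; exact: measurable_cst.
under eq_fun do rewrite big_cons.
apply: measurable_funD; first by apply: mx; exact: mem_head.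
by apply: IH => k kt; apply: mx; rewrite inE kt orbT.
Qed.

Section WeightedNorm.
Variables (R : realType) (p : R) (w : R -> R).
Hypothesis hp : 1 < p.
Hypothesis hw : weight w.
Implicit Types f g a u : R -> R.

Local Notation leb := (@lebesgue_measure R).
Local Notation q := (conjugate_exponent p).
Local Notation root := (fun x => w x `^ p^-1).

Let p0 : 0 < p. Proof. exact: lt_trans hp. Qed.
Let p1 : 1 <= p. Proof. exact: ltW. Qed.
Let pN0 : p != 0. Proof. by rewrite gt_eqF. Qed.
Let pB0 : 0 < p - 1. Proof. by rewrite subr_gt0. Qed.

Lemma conjugate_exponent_gt0 : 0 < q.
Proof. by rewrite /conjugate_exponent divr_gt0. Qed.

Lemma conjugate_exponentP : p^-1 + q^-1 = 1.
Proof. by rewrite /conjugate_exponent; field; rewrite pN0 gt_eqF. Qed.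

Lemma measurable_weight : measurable_fun setT w.
Proof. by case: hw => -[]. Qed.

Lemma weight_gt0 : {ae leb, forall x, 0 < w x}.
Proof. by case: hw. Qed.

Lemma measurable_powR_fun (f : R -> R) (r : R) :
  measurable_fun setT f -> measurable_fun setT (fun x => f x `^ r).
Proof.
by move=> mf; apply: (@measurableT_comp _ _ _ _ _ _ (@powR R ^~ r)) => //;
  exact: measurable_powR.
Qed.

Lemma measurable_root : measurable_fun setT root.
Proof. exact: measurable_powR_fun measurable_weight. Qed.

Lemma root_powR x : 0 < w x -> root x `^ p = w x.
Proof. by move=> w0; rewrite -powRrM mulVf // powRr1 // ltW. Qed.

(** Multiplication by w ^ (1/p) is an isometry from L^p(w) to the unweighted L^p. *)
Lemma Lpw_normE (f : R -> R) : measurable_fun setT f ->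
  Lpw_norm p w f = ('N[leb]_p%:E[EFin \o (fun x => f x * root x)%R])%E.
Proof.
move=> mf; rewrite /Lpw_norm LnormE; congr (_ `^ _)%E.
apply: ae_eq_integral => //.
- apply/measurable_EFinP; apply: measurable_funM; last exact: measurable_weight.
  by apply: measurable_powR_fun; exact: measurableT_comp.
- apply: measurable_normpow; apply: measurable_funM => //; exact: measurable_root.
- apply: filterS weight_gt0 => x w0 _ /=.
  by rewrite normrM powRM // [`|_ `^ _|]ger0_norm ?powR_ge0 // root_powR.
Qed.

Lemma Lpw_norm_ge0 f : (0 <= Lpw_norm p w f)%E.
Proof. exact: poweR_ge0. Qed.

Lemma measurable_mul_root f : measurable_fun setT f ->
  measurable_fun setT (fun x => f x * root x).
Proof. by move=> mf; apply: measurable_funM => //; exact: measurable_root. Qed.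

Lemma Lpw_norm_fin f : in_Lpw p w f -> Lpw_norm p w f \is a fin_num.
Proof. by case=> _ f1; rewrite ge0_fin_numE // Lpw_norm_ge0. Qed.

Lemma Lpw_norm_le_ae f g : measurable_fun setT f -> measurable_fun setT g ->
  {ae leb, forall x, `|f x| <= `|g x|} -> (Lpw_norm p w f <= Lpw_norm p w g)%E.
Proof.
move=> mf mg fg; rewrite !Lpw_normE //.
apply: Lnorm_le_ae => //; try exact: measurable_mul_root.
by apply: filterS fg => x fg; rewrite !normrM ler_wpM2r.
Qed.

Lemma Lpw_norm_eq_ae f g : measurable_fun setT f -> measurable_fun setT g ->
  {ae leb, forall x, f x = g x} -> Lpw_norm p w f = Lpw_norm p w g.
Proof.
move=> mf mg fg; apply/eqP; rewrite eq_le !Lpw_norm_le_ae //.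
  by apply: filterS fg => x ->.
by apply: filterS fg => x ->.
Qed.

Lemma Lpw_norm_abs f : Lpw_norm p w (fun x => `|f x|) = Lpw_norm p w f.
Proof. by rewrite /Lpw_norm; under eq_integral do rewrite normr_id. Qed.

Lemma Lpw_norm0 : Lpw_norm p w (cst 0) = 0%E.
Proof.
rewrite Lpw_normE //; under [X in Lnorm _ _ X]eq_fun do rewrite /= mul0r.
by rewrite [LHS](@Lnorm0 _ _ _ leb p%:E).
Qed.

Lemma Lpw_normD f g : measurable_fun setT f -> measurable_fun setT g ->
  (Lpw_norm p w (fun x => f x + g x)%R <= Lpw_norm p w f + Lpw_norm p w g)%E.
Proof.
move=> mf mg; rewrite !Lpw_normE //; last exact: measurable_funD.
under [X in Lnorm _ _ X]eq_fun do rewrite /= mulrDl.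
apply: LnormD => //; exact: measurable_mul_root.
Qed.

Lemma Lpw_normZ f (a : R) : measurable_fun setT f ->
  (Lpw_norm p w (fun x => a * f x)%R = `|a|%:E * Lpw_norm p w f)%E.
Proof.
move=> mf; rewrite !Lpw_normE //; last exact: measurable_funM.
under [X in Lnorm _ _ X]eq_fun do rewrite /= -mulrA.
by rewrite Lnorm_scale //; exact: measurable_mul_root.
Qed.

Lemma Lpw_norm_sum_le (K : eqType) (t : seq K) (x : K -> R -> R) :
  (forall J, J \in t -> measurable_fun setT (x J)) ->
  (Lpw_norm p w (fun y => \sum_(J <- t) x J y)%R <= \sum_(J <- t) Lpw_norm p w (x J))%E.
Proof.
elim: t => [|J t IH] mx.
  rewrite big_nil; under [X in Lpw_norm _ _ X]eq_fun do rewrite big_nil.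
  by rewrite Lpw_norm0.
have mx' k : k \in t -> measurable_fun setT (x k).
  by move=> kt; apply: mx; rewrite inE kt orbT.
rewrite big_cons; under [X in Lpw_norm _ _ X]eq_fun do rewrite big_cons.
apply: le_trans (leeD2l _ (IH mx')); apply: Lpw_normD => //.
  by apply: mx; exact: mem_head.
exact: measurable_big_seq.
Qed.

(** Hölder for the factors f * w ^ (1/p) and w ^ (-1/p): the dual weight is the q-th
    power of the latter. *)
Lemma holder_Lpw_dual f (I : set R) : measurable_fun setT f -> measurable I ->
  (\int[leb]_(x in I) `|f x|%:E <=
   Lpw_norm p w f * (\int[leb]_(x in I) (dual_weight p w x)%:E) `^ q^-1)%E.
Proof.
move=> mf mI.
pose g x := w x `^ (- p^-1) * \1_I x.
have mg : measurable_fun setT g.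
  apply: measurable_funM; last exact: measurable_indic.
  exact: measurable_powR_fun measurable_weight.
have := hoelder leb (measurable_mul_root mf) mg p0 conjugate_exponent_gt0 conjugate_exponentP.
rewrite Lnorm1 -Lpw_normE //.
have -> : (\int[leb]_x `|(EFin \o (fun x => f x * root x) \* g)%R x| =
    \int[leb]_(x in I) `|f x|%:E)%E.
  rewrite [RHS]integral_mkcond; apply: ae_eq_integral => //.
  - apply: measurableT_comp => //; apply/measurable_EFinP.
    by apply: measurable_funM => //; exact: measurable_mul_root.
  - apply/(measurable_restrictT _ mI); apply/measurable_EFinP.
    by apply: measurable_funS (measurableT_comp _ mf).
  - apply: filterS weight_gt0 => x w0 _ /=.
    rewrite /g /= patchE indicE; case: (x \in I); last by rewrite !mulr0 normr0.
    rewrite mulr1 -mulrA -powRD; last by rewrite (gt_eqF w0) implybT.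
    by rewrite subrr powRr0 mulr1.
move=> h; apply: le_trans h _; apply: lee_pmul => //; [exact: Lpw_norm_ge0|exact: Lnorm_ge0|].
rewrite LnormE; apply: lee_poweR2; first by rewrite invr_ge0 ltW // conjugate_exponent_gt0.
  by apply: integral_ge0 => x _; rewrite lee_fin powR_ge0.
rewrite [leRHS]integral_mkcond le_eqVlt; apply/orP; left; apply/eqP.
apply: eq_integral => x _ /=; rewrite /g /= patchE indicE /dual_weight.
case: (x \in I); last by rewrite mulr0 normr0 powR0 // gt_eqF // conjugate_exponent_gt0.
rewrite mulr1 ger0_norm ?powR_ge0 // -powRrM; congr ((_ `^ _)%:E).
by rewrite /conjugate_exponent; field; rewrite pN0 gt_eqF.
Qed.

(** Hölder for the factors a * w ^ (1/p) and (|u| * w ^ (1/p)) ^ (p - 1), whose norm in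
    the conjugate exponent is the (p - 1)-th power of the norm of u. *)
Lemma holder_Lpw_pow a u : measurable_fun setT a -> measurable_fun setT u ->
  (\int[leb]_x (`|a x| * (`|u x| `^ (p - 1) * w x))%:E <=
   Lpw_norm p w a * Lpw_norm p w u `^ (p - 1))%E.
Proof.
move=> ma mu.
pose g x := (`|u x| * root x) `^ (p - 1).
have mg : measurable_fun setT g.
  apply: measurable_powR_fun; apply: measurable_mul_root.
  exact: measurableT_comp.
have := hoelder leb (measurable_mul_root ma) mg p0 conjugate_exponent_gt0 conjugate_exponentP.
rewrite Lnorm1 -Lpw_normE //.
have -> : (\int[leb]_x `|(EFin \o (fun x => a x * root x) \* g)%R x| =
    \int[leb]_x (`|a x| * (`|u x| `^ (p - 1) * w x))%:E)%E.
  apply: ae_eq_integral => //.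
  - apply: measurableT_comp => //; apply/measurable_EFinP.
    by apply: measurable_funM => //; exact: measurable_mul_root.
  - apply/measurable_EFinP; apply: measurable_funM; first exact: measurableT_comp.
    apply: measurable_funM; last exact: measurable_weight.
    by apply: measurable_powR_fun; exact: measurableT_comp.
  - apply: filterS weight_gt0 => x w0 _ /=.
    rewrite /g /= !normrM [`|root x|]ger0_norm ?powR_ge0 // [`|_ `^ (p - 1)|]ger0_norm ?powR_ge0 //.
    rewrite powRM ?powR_ge0 // -mulrA (mulrCA (root x)).
    by rewrite mulr_powRB1 ?powR_ge0 // root_powR.
move=> h; apply: le_trans h _; apply: lee_pmul => //; [exact: Lpw_norm_ge0|exact: Lnorm_ge0|].
rewrite Lpw_normE // !LnormE -poweRrM.
have -> : p^-1 * (p - 1) = q^-1 by rewrite /conjugate_exponent; field; rewrite pN0 gt_eqF.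
apply: lee_poweR2; first by rewrite invr_ge0 ltW // conjugate_exponent_gt0.
  by apply: integral_ge0 => x _; rewrite lee_fin powR_ge0.
rewrite le_eqVlt; apply/orP; left; apply/eqP.
apply: eq_integral => x _ /=; rewrite /g.
have -> : `|u x * root x| = `|u x| * root x by rewrite normrM (ger0_norm (powR_ge0 _ _)).
rewrite [`|_ `^ (p - 1)|]ger0_norm ?powR_ge0 // -powRrM; congr ((_ `^ _)%:E).
by rewrite /conjugate_exponent; field; rewrite gt_eqF.
Qed.

Lemma opnorm_ge0 T : (0 <= opnorm p w T)%E.
Proof. by apply: le_ereal_inf_tmp => _ [C [C0 _] <-]; rewrite lee_fin. Qed.

Lemma opnorm_approx T (M d : R) f : (opnorm p w T <= M%:E)%E -> 0 < d ->
  in_Lpw p w f ->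
  exists g, [/\ in_Lpw p w g, T f g & (Lpw_norm p w g <= (M + d)%:E * Lpw_norm p w f)%E].
Proof.
move=> TM d0 fL.
have : (opnorm p w T < (M + d)%:E)%E by apply: le_lt_trans TM _; rewrite lte_fin ltrDl.
move=> /ereal_inf_lt[_ [C [C0 HC] <-]]; rewrite lte_fin => CM.
have [g [gL Tg gN]] := HC f fL; exists g; split => //.
apply: le_trans gN _; apply: lee_wpmul2r; first exact: Lpw_norm_ge0.
by rewrite lee_fin ltW.
Qed.

(** Bounds for all finite signed sums are enough: by [unconditional_convergence] they
    imply that the series defining the operator converges. *)
Lemma opnorm_le_signed (E : set (set R)) (u : (R -> R) -> set R -> R -> R) (C : R) :
  0 <= C ->
  (forall f I, in_Lpw p w f -> E I -> measurable_fun setT (u f I)) ->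
  (forall f s (e : set R -> bool), in_Lpw p w f -> uniq s ->
     (forall I, I \in s -> E I) ->
     (Lpw_norm p w (fun x => \sum_(I <- s) (-1) ^+ e I * u f I x)%R <=
      C%:E * Lpw_norm p w f)%E) ->
  (opnorm p w (fun f g => sums_to p w E (u f) g) <= C%:E)%E.
Proof.
move=> C0 mu_ uC; apply: ereal_inf_lbound; exists C => //; split => // f fL.
have ff := Lpw_norm_fin fL.
pose M := C * fine (Lpw_norm p w f).
have ME : (C%:E * Lpw_norm p w f = M%:E)%E by rewrite -(fineK ff) -EFinM.
have M0 : 0 <= M by rewrite mulr_ge0 // fine_ge0 // Lpw_norm_ge0.
(* Terms outside E are replaced by 0, which makes all of them measurable. *)
pose X I x := if `[< E I >] then u f I x * root x else 0.
have mX I : measurable_fun setT (X I).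
  rewrite /X; case: asboolP => EI; last exact: measurable_cst.
  by apply: measurable_mul_root; exact: mu_.
have mus s : (forall I, I \in s -> E I) -> measurable_fun setT (fun x => \sum_(I <- s) u f I x).
  by move=> sE; apply: measurable_big_seq => I /sE EI; exact: mu_.
have [|G [mG GM Gc]] := @unconditional_convergence _ _ _ leb p p1 _ X E M mX M0; last first.
- pose g x := G x * w x `^ (- p^-1).
  have mg : measurable_fun setT g.
    apply: measurable_funM => //; exact: measurable_powR_fun measurable_weight.
  have gE : {ae leb, forall x, g x * root x = G x}.
    apply: filterS weight_gt0 => x w0.
    rewrite /g -mulrA -powRD; last by rewrite (gt_eqF w0) implybT.
    by rewrite addNr powRr0 mulr1.
  have gN : Lpw_norm p w g = ('N[leb]_p%:E[EFin \o G])%E.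
    by rewrite Lpw_normE //; apply: Lnorm_eq_ae => //; exact: measurable_mul_root.
  exists g; split.
  + by split => //; rewrite gN (le_lt_trans GM) ?ltry.
  + move=> eps e0; have [s0 [us0 Es0] h0] := Gc _ e0.
    exists [set` s0]; split => //.
    move=> _ /finite_set_uniq_seq[s us ->] s0s sE.
    have fs : finite_subfamily E s by split.
    have {h0} := h0 s fs s0s; apply: le_lt_trans.
    under [X in Lpw_norm _ _ X]eq_fun do rewrite -fsbig_seq //=.
    have ms := mus _ sE.
    rewrite Lpw_normE; last exact: measurable_funB.
    apply: Lnorm_le_ae => //.
    * by apply: measurable_mul_root; exact: measurable_funB.
    * by apply: measurable_funB => //; exact: measurable_sum.
    * apply: filterS gE => x gE; rewrite mulrBl gE mulr_suml.
      rewrite le_eqVlt; apply/orP; left; apply/eqP; congr `|_ - _|.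
      rewrite !big_seq; apply: eq_bigr => I Is.
      by rewrite /X; case: asboolP => //; move/sE: Is.
  + by rewrite gN ME.
- move=> s e [us Es]; rewrite -ME; apply: le_trans (uC f s e fL us Es).
  have ms : measurable_fun setT (fun x => \sum_(I <- s) (-1) ^+ e I * u f I x).
    apply: measurable_big_seq => I /Es EI; apply: measurable_funM.
      exact: measurable_cst.
    exact: mu_.
  rewrite Lpw_normE //; apply: Lnorm_le_ae => //.
  + apply: measurable_sum => I; apply: measurable_funM; first exact: measurable_cst.
    exact: mX.
  + exact: measurable_mul_root.
  + apply: aeW => x; rewrite mulr_suml le_eqVlt; apply/orP; left; apply/eqP; congr `|_|.
    rewrite !big_seq; apply: eq_bigr => I Is.
    by rewrite /X -mulrA; case: asboolP => //; move/Es: Is.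
Qed.

End WeightedNorm.

(** * Geometry of the dyadic grid *)

Section IntervalMeasure.
Variable R : realType.
Local Notation leb := (@lebesgue_measure R).
Implicit Types I J : set R.

Lemma interval_dist_le_measure I x y : is_interval I -> I x -> I y ->
  ((y - x)%:E <= leb I)%E.
Proof.
move=> iI Ix Iy; have [xy|yx] := ltP x y; last first.
  by apply: le_trans (measure_ge0 _ _); rewrite lee_fin subr_le0.
have -> : (y - x)%:E = leb `[x, y]%classic.
  by rewrite lebesgue_measure_itv /= lte_fin xy -EFinD.
apply: le_measure; rewrite ?inE //; first exact: is_interval_measurable.
by move=> z /=; rewrite in_itv /= => xzy; exact: iI xzy.
Qed.

Lemma interval_has_sup_inf I (l : R) : is_interval I -> leb I = l%:E -> I !=set0 ->
  [/\ has_sup I, has_inf I & sup I - inf I = l].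
Proof.
move=> iI lI [x0 Ix0].
have dist x y : I x -> I y -> y - x <= l.
  by move=> Ix Iy; rewrite -lee_fin -lI; exact: interval_dist_le_measure.
have hs : has_sup I.
  split; first by exists x0.
  by exists (x0 + l) => y Iy; rewrite -lerBlDl; exact: dist.
have hi : has_inf I.
  split; first by exists x0.
  by exists (x0 - l) => y Iy; rewrite lerBlDl -lerBlDr; exact: dist.
split => //; apply/eqP; rewrite eq_le; apply/andP; split.
  rewrite lerBlDr; apply: ge_sup; first by exists x0.
  move=> y Iy; rewrite -lerBlDl; apply: lb_le_inf; first by exists x0.
  by move=> x Ix; rewrite lerBlDr -lerBlDl; exact: dist.
have si : inf I <= sup I.
  by apply: le_trans (sup_upper_bound hs Ix0); apply: ge_inf => //; case: hi.
rewrite -lee_fin -lI.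
have -> : (sup I - inf I)%:E = leb `[inf I, sup I]%classic.
  rewrite lebesgue_measure_itv /= lte_fin -EFinD; case: ltP => // le.
  have -> : sup I = inf I by apply/eqP; rewrite eq_le le si.
  by rewrite subrr.
apply: le_measure; rewrite ?inE //; first exact: is_interval_measurable.
move=> z Iz /=; rewrite in_itv /=.
by rewrite (sup_upper_bound hs Iz) andbT; apply: ge_inf => //; case: hi.
Qed.

Lemma disjoint_intervals_ordered I J x0 y0 : is_interval I -> is_interval J ->
  I `&` J = set0 -> I x0 -> J y0 -> x0 < y0 ->
  forall x y, I x -> J y -> x < y.
Proof.
move=> iI iJ dis Ix0 Jy0 xy0 x y Ix Jy; rewrite ltNge; apply/negP => yx.
have no z : I z -> J z -> False by move=> Iz Jz; have : (I `&` J) z by []; rewrite dis.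
have [x0y|yx0] := leP x0 y.
  by apply: (no y) => //; apply: (iI x0 x) => //; rewrite x0y.
by apply: (no x0) => //; apply: (iJ y y0) => //; rewrite (ltW yx0) (ltW xy0).
Qed.

Lemma ae_neq (c : R) : {ae leb, forall x, x != c}.
Proof.
exists [set c]; split => //; first exact: lebesgue_measure_set1.
by move=> x /=; case: eqVneq.
Qed.

End IntervalMeasure.

Section Grid.
Variables (R : realType) (D : set (set R)).
Hypothesis hD : dyadic_grid D.
Local Notation leb := (@lebesgue_measure R).
Implicit Types (I J K : set R) (f g : R -> R).

Lemma dyadic_interval I : D I -> is_interval I.
Proof. by case: hD => h _ _ /h[]. Qed.

Lemma dyadic_measurable I : D I -> measurable (I : set (measurableTypeR R)).
Proof. by move=> /dyadic_interval; exact: is_interval_measurable. Qed.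

Lemma dyadic_level I : D I -> exists k : int, len I = 2 ^ k.
Proof. by case: hD => h _ _ /h[_ [k kE]]; exists k; rewrite /len kE. Qed.

Lemma dyadic_lebE I : D I -> leb I = (len I)%:E.
Proof. by case: hD => h _ _ /h[_ [k kE]]; rewrite /len kE. Qed.

Lemma dyadic_len_gt0 I : D I -> 0 < len I.
Proof. by move=> /dyadic_level[k ->]; rewrite exprz_gt0. Qed.

Lemma dyadic_cover (k : int) x : exists I, [/\ D I, len I = 2 ^ k & I x].
Proof.
case: hD => _ /(_ k)[+ _ _] _ => /seteqP[_ /(_ x Logic.I)[I [DI kE] Ix]].
by exists I; split => //; rewrite /len kE.
Qed.

Lemma dyadic_nonempty I : D I -> exists x, I x.
Proof.
move=> DI; case: hD => h /[swap] _ hp; case: (h _ DI) => _ [k kE].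
by case: (hp k) => _ _ /(_ I (conj DI kE)).
Qed.

Lemma dyadic_same_len I J x : D I -> D J -> len I = len J -> I x -> J x -> I = J.
Proof.
move=> DI DJ IJ Ix Jx; case: hD => h hp _; case: (h _ DI) => _ [k kE].
case: (hp k) => _ triv _; apply: triv => //; last by exists x.
by split=> //; rewrite dyadic_lebE // -IJ -dyadic_lebE.
Qed.

Lemma dyadic_nested I J x : D I -> D J -> len I <= len J -> I x -> J x -> I `<=` J.
Proof.
move=> DI DJ IJ Ix Jx; case: hD => _ _ /(_ I J DI DJ)[IE|JE|E].
- by rewrite -IE => y [].
- have JI : J `<=` I by rewrite -JE => y [].
  have : len J <= len I.
    rewrite -lee_fin -!dyadic_lebE //.
    by apply: le_measure; rewrite ?inE //; exact: dyadic_measurable.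
  move=> le; have lE : len I = len J by apply/eqP; rewrite eq_le IJ le.
  by rewrite (dyadic_same_len DI DJ lE Ix Jx).
- by have : (I `&` J) x by []; rewrite E.
Qed.

Lemma dyadic_len_lt I J : D I -> D J -> len I < len J -> len I <= len J / 2.
Proof.
move=> /dyadic_level[a ->] /dyadic_level[b ->].
rewrite ltr_eXz2l ?ltr1n // => ab.
have -> : (2 : R) ^ b / 2 = 2 ^ (b - 1).
  by rewrite expfzDr ?pnatr_eq0 // exprN1.
by rewrite ler_eXz2l ?ltr1n // lerBrDr lezD1.
Qed.

Lemma dyadic_sub_len I J : D I -> D J -> I `<=` J -> len I <= len J.
Proof.
move=> DI DJ IJ; rewrite -lee_fin -!dyadic_lebE //.
by apply: le_measure; rewrite ?inE //; exact: dyadic_measurable.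
Qed.

Definition halves I (P : set R * set R) : Prop :=
  [/\ D P.1 /\ D P.2, len P.1 = len I / 2 /\ len P.2 = len I / 2,
      I = P.1 `|` P.2, P.1 `&` P.2 = set0 &
      forall x y, P.1 x -> P.2 y -> x < y].

(** Two distinct grid intervals of half the length of I that meet I are contained in
    it and have the total length of I, which leaves no room for a third one. *)
Lemma dyadic_halves I : D I -> exists P, halves I P.
Proof.
move=> DI; have [k kE] := dyadic_level DI.
have sub K x : D K -> len K = 2 ^ (k - 1) -> I x -> K x -> K `<=` I.
  move=> DK KE Ix Kx; apply: (dyadic_nested DK DI _ Kx Ix).
  by rewrite KE kE ler_eXz2l ?ltr1n // lerBlDr lerDl.
have half : (2 : R) ^ (k - 1) = len I / 2 by rewrite kE expfzDr ?pnatr_eq0 // exprN1.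
have i0 := dyadic_len_gt0 DI.
have [x Ix] := dyadic_nonempty DI.
have [K [DK KE Kx]] := dyadic_cover (k - 1) x.
have KI := sub _ _ DK KE Ix Kx.
have [y [Iy Ky]] : exists y, I y /\ ~ K y.
  apply: contrapT => /forallNP no.
  have IK : I `<=` K by move=> z Iz; apply: contrapT => Kz; apply: (no z).
  by have := dyadic_sub_len DI DK IK; rewrite KE half; lra.
have [K' [DK' KE' Ky']] := dyadic_cover (k - 1) y.
have KI' := sub _ _ DK' KE' Iy Ky'.
have dis : K `&` K' = set0.
  apply/seteqP; split => // z [Kz Kz']; apply: Ky.
  by rewrite (dyadic_same_len DK DK' _ Kz Kz') // KE KE'.
have lU : leb (K `|` K') = (len I)%:E.
  rewrite measureU //=; try exact: dyadic_measurable.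
  by rewrite !dyadic_lebE // KE KE' half -EFinD; congr (_%:E); lra.
have IE : I = K `|` K'.
  apply/seteqP; split => [z Iz|z [/KI|/KI'] //].
  apply: contrapT => /not_orP[Kz Kz'].
  have [J [DJ JE Jz]] := dyadic_cover (k - 1) z.
  have JI := sub _ _ DJ JE Iz Jz.
  have disJ : (K `|` K') `&` J = set0.
    apply/seteqP; split => // t [[Kt|Kt] Jt].
      by apply: Kz; rewrite (dyadic_same_len DK DJ _ Kt Jt) // KE JE.
    by apply: Kz'; rewrite (dyadic_same_len DK' DJ _ Kt Jt) // KE' JE.
  have mK := dyadic_measurable DK; have mK' := dyadic_measurable DK'.
  have mJ := dyadic_measurable DJ.
  have mU : measurable (K `|` K') by exact: measurableU.
  have : (leb ((K `|` K') `|` J) <= leb I)%E.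
    apply: le_measure; rewrite ?inE //; [exact: measurableU|exact: dyadic_measurable|].
    by move=> t [[/KI|/KI']|/JI].
  rewrite measureU //= lU !dyadic_lebE // JE half -EFinD lee_fin; lra.
have iK := dyadic_interval DK; have iK' := dyadic_interval DK'.
have [xy|xy|xy] := ltgtP x y.
- exists (K, K'); split => //=; rewrite ?KE ?KE' ?half //.
  exact: (disjoint_intervals_ordered iK iK' dis Kx Ky' xy).
- exists (K', K); split => //=; rewrite ?KE ?KE' ?half //.
  + by rewrite setUC.
  + by rewrite setIC.
  + apply: (disjoint_intervals_ordered iK' iK _ Ky' Kx xy).
    by rewrite setIC.
- by move: Ky; rewrite -xy.
Qed.

(** The grid intervals in the two halves of I.  They can differ from [left_half] and
    [right_half] at the midpoint, so that these need not belong to the grid. *)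
Definition lch I : set R := (xget (set0, set0) (halves I)).1.
Definition rch I : set R := (xget (set0, set0) (halves I)).2.

Lemma children_halves I : D I -> halves I (lch I, rch I).
Proof.
move=> /dyadic_halves h; have := xgetPex (set0, set0) h.
by rewrite /lch /rch; case: (xget _ _).
Qed.

Lemma dyadic_lch I : D I -> D (lch I).
Proof. by move=> /children_halves[[]]. Qed.

Lemma dyadic_rch I : D I -> D (rch I).
Proof. by move=> /children_halves[[]]. Qed.

Lemma len_lch I : D I -> len (lch I) = len I / 2.
Proof. by move=> /children_halves[_ []]. Qed.

Lemma len_rch I : D I -> len (rch I) = len I / 2.
Proof. by move=> /children_halves[_ []]. Qed.

Lemma childrenU I : D I -> I = lch I `|` rch I.
Proof. by move=> /children_halves[]. Qed.

Lemma childrenI I : D I -> lch I `&` rch I = set0.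
Proof. by move=> /children_halves[]. Qed.

Lemma lch_sub I : D I -> lch I `<=` I.
Proof. by move=> /childrenU {2}->; exact: subsetUl. Qed.

Lemma rch_sub I : D I -> rch I `<=` I.
Proof. by move=> /childrenU {2}->; exact: subsetUr. Qed.

Lemma indic_children I x : D I -> \1_I x = \1_(lch I) x + \1_(rch I) x :> R.
Proof.
move=> DI; rewrite {1}(childrenU DI) !indicE in_setU.
case: (boolP (x \in lch I)) => xl; case: (boolP (x \in rch I)) => xr; rewrite ?addr0 ?add0r //.
have : (lch I `&` rch I) x by split; exact: set_mem.
by rewrite childrenI.
Qed.

Lemma haar_children I x : D I -> x != midpoint I ->
  haar I x = (Num.sqrt (len I))^-1 * (\1_(rch I) x - \1_(lch I) x).
Proof.
move=> DI xm; rewrite /haar; congr (_ * _).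
have [[DL DR] [lL lR] IE dis ord] := children_halves DI; rewrite /= in DL DR lL lR IE dis ord.
have bounds K : D K -> [/\ has_sup K, has_inf K & sup K - inf K = len K].
  move=> DK; apply: interval_has_sup_inf; [exact: dyadic_interval|exact: dyadic_lebE|].
  by have [z Kz] := dyadic_nonempty DK; exists z.
have [sI iI eI] := bounds _ DI.
have [sL iL eL] := bounds _ DL.
have [sR iR eR] := bounds _ DR.
have infL : inf I <= inf (lch I).
  apply: lb_le_inf; first by case: iL.
  by move=> z Lz; apply: ge_inf; [case: iI|exact: lch_sub].
have supR : sup (rch I) <= sup I.
  apply: ge_sup; first by case: sR.
  by move=> z Rz; apply: sup_upper_bound => //; exact: rch_sub.
have Rm y : rch I y -> midpoint I <= y.
  move=> Ry; have : sup (lch I) <= y.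
    apply: ge_sup; first by case: sL.
    by move=> z Lz; apply: ltW; exact: ord.
  rewrite /midpoint; lra.
have Lm y : lch I y -> y <= midpoint I.
  move=> Ly; have : y <= inf (rch I).
    apply: lb_le_inf; first by case: iR.
    by move=> z Rz; apply: ltW; exact: ord.
  rewrite /midpoint; lra.
have rE : (x \in right_half I) = (x \in rch I).
  apply/idP/idP; rewrite !inE; last by move=> Rx; split; [exact: rch_sub|exact: Rm].
  move=> [Ix /= mx]; move: Ix; rewrite {1}IE => -[Lx|//].
  by move: xm; rewrite eq_le mx (Lm _ Lx).
have lE : (x \in left_half I) = (x \in lch I).
  apply/idP/idP; rewrite !inE.
    move=> [Ix /= mx]; move: Ix; rewrite {1}IE => -[//|Rx].
    by have := Rm _ Rx; rewrite leNgt mx.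
  by move=> Lx; split; [exact: lch_sub|rewrite /= lt_neqAle xm Lm].
by rewrite !indicE rE lE.
Qed.

Lemma haar_children_ae I : D I -> {ae leb, forall x,
  haar I x = (Num.sqrt (len I))^-1 * (\1_(rch I) x - \1_(lch I) x)}.
Proof. by move=> DI; apply: filterS (ae_neq (midpoint I)) => x; exact: haar_children. Qed.

Lemma measurable_haar I : D I -> measurable_fun setT (haar I).
Proof.
move=> DI; have mI := dyadic_measurable DI.
have mr : measurable [set x | midpoint I <= x].
  have -> : [set x | midpoint I <= x] = `[midpoint I, +oo[%classic.
    by apply/seteqP; split => x /=; rewrite in_itv /= andbT.
  exact: measurable_itv.
have ml : measurable [set x | x < midpoint I].
  have -> : [set x | x < midpoint I] = `]-oo, midpoint I[%classic.
    by apply/seteqP; split => x /=; rewrite in_itv.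
  exact: measurable_itv.
apply: measurable_funM => //; apply: measurable_funB; apply: measurable_indic;
  exact: measurableI.
Qed.

Lemma haar_out I x : ~ I x -> haar I x = 0.
Proof.
by move=> Ix; rewrite /haar !indicE !memNset ?subrr ?mulr0 // => -[].
Qed.

Lemma haar_bounded I x : `|haar I x| <= (Num.sqrt (len I))^-1.
Proof.
rewrite /haar normrM ger0_norm ?invr_ge0 ?sqrtr_ge0 //.
rewrite ler_piMr ?invr_ge0 ?sqrtr_ge0 // !indicE.
have : ~~ ((x \in right_half I) && (x \in left_half I)).
  by apply/negP => /andP[]; rewrite !inE => -[_ /= h1] [_ /=]; rewrite ltNge h1.
by case: (x \in right_half I); case: (x \in left_half I) => //= _;
  rewrite ?subr0 ?sub0r ?normrN ?normr1 ?normr0.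
Qed.

End Grid.

(** * Averages over the grid *)

Section GridAverages.
Variables (R : realType) (D : set (set R)).
Hypothesis hD : dyadic_grid D.
Local Notation leb := (@lebesgue_measure R).
Local Notation lc := (lch D).
Local Notation rc := (rch D).
Implicit Types (I J K : set R) (f g : R -> R).

Definition grid_integrable f :=
  measurable_fun setT f /\ forall I, D I -> leb.-integrable I (EFin \o f).

Lemma grid_integrable_norm f : grid_integrable f -> grid_integrable (fun x => `|f x|).
Proof.
move=> [mf fi]; split; first exact: measurableT_comp.
by move=> I DI; exact: integrable_norm (fi _ DI).
Qed.

Lemma grid_integrableB f g : grid_integrable f -> grid_integrable g ->
  grid_integrable (fun x => f x - g x).
Proof.
move=> [mf fi] [mg gi]; split; first exact: measurable_funB.
move=> I DI; have mI := dyadic_measurable hD DI.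
by have := integrableB mI (fi _ DI) (gi _ DI); apply: eq_integrable.
Qed.

Lemma grid_integrable_cst (c : R) : grid_integrable (cst c).
Proof.
split => // I DI; apply/integrableP; split.
  by apply/measurable_EFinP; exact: measurable_cst.
rewrite [ltLHS](_ : _ = (`|c|%:E * leb I)%E); last first.
  exact: (integral_cst leb (dyadic_measurable hD DI) `|c|%:E).
by rewrite (dyadic_lebE hD DI) -EFinM ltry.
Qed.

Lemma locally_integrable_grid f : locally_integrable setT f -> grid_integrable f.
Proof.
move=> [mf _ fi]; split => // I DI; apply/integrableP; split.
  by apply/measurable_EFinP; exact: measurable_funS mf.
have [x Ix] := dyadic_nonempty hD DI.
have [|sI iI _] := interval_has_sup_inf (dyadic_interval hD DI) (dyadic_lebE hD DI).
  by exists x.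
have /fi : `[inf I, sup I]%classic `<=` [set: R] by [].
move=> /(_ (@segment_compact R (inf I) (sup I))); apply: le_lt_trans.
apply: ge0_subset_integral => //.
- exact: (dyadic_measurable hD).
- apply/measurable_EFinP; apply: measurable_funS (measurableT_comp _ mf) => //.
- move=> y Iy /=; rewrite in_itv /= (sup_upper_bound sI Iy) andbT.
  by apply: ge_inf => //; case: iI.
Qed.

Lemma esum_sub_seq (s : seq (set R)) J : uniq s -> (forall I, I \in s -> D I) ->
  (\esum_(I in [set I | [set` s] I /\ I `<=` J]) leb I =
    (\sum_(I <- s | `[< I `<=` J >]) len I)%:E)%E.
Proof.
move=> us sD; rewrite esum_fset; last 2 first.
- by apply: sub_finite_set (finite_seq s) => K [].
- by move=> K _; exact: measure_ge0.
have -> : [set I | [set` s] I /\ I `<=` J] = [set` [seq K <- s | `[< K `<=` J >]]].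
  apply/seteqP; split => K /=; rewrite mem_filter; first by move=> [-> /asboolP ->].
  by move=> /andP[/asboolP].
rewrite -fsbig_seq ?filter_uniq //= big_filter -sumEFin big_seq_cond [RHS]big_seq_cond.
by apply: eq_bigr => K /andP[/sD DK _]; exact: (dyadic_lebE hD DK).
Qed.

Lemma len_avg f I : D I -> len I * avg f I = \int[leb]_(x in I) f x.
Proof. by move=> DI; rewrite /avg mulrA divff ?mul1r // gt_eqF // (dyadic_len_gt0 hD). Qed.

Lemma Rintegral_children f I : D I -> leb.-integrable I (EFin \o f) ->
  \int[leb]_(x in I) f x = \int[leb]_(x in lc I) f x + \int[leb]_(x in rc I) f x.
Proof.
move=> DI fi; rewrite {1}(childrenU hD DI) Rintegral_setU //.
- exact: (dyadic_measurable hD (dyadic_lch hD DI)).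
- exact: (dyadic_measurable hD (dyadic_rch hD DI)).
- by rewrite -(childrenU hD DI).
- by apply/disj_set2P; rewrite (childrenI hD DI).
Qed.

Lemma avg_averaging f : grid_integrable f -> averaging lc rc D (avg f).
Proof.
move=> [mf fi] I DI; rewrite /avg Rintegral_children ?fi //.
rewrite len_lch // len_rch //; field.
by rewrite gt_eqF // (dyadic_len_gt0 hD).
Qed.

Lemma avg_ge0 f I : D I -> (forall x, 0 <= f x) -> 0 <= avg f I.
Proof.
move=> DI f0; rewrite /avg mulr_ge0 ?invr_ge0 ?(ltW (dyadic_len_gt0 hD DI)) //.
by apply: Rintegral_ge0.
Qed.

Lemma avg_norm_le f I : D I -> grid_integrable f -> `|avg f I| <= avg (fun x => `|f x|) I.
Proof.
move=> DI [mf fi]; rewrite /avg normrM ger0_norm ?invr_ge0 ?(ltW (dyadic_len_gt0 hD DI)) //.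
rewrite ler_pM2l ?invr_gt0 ?(dyadic_len_gt0 hD) //.
by apply: le_normr_Rintegral; [exact: (dyadic_measurable hD)|exact: fi].
Qed.

Lemma avgB f g I : D I -> grid_integrable f -> grid_integrable g ->
  avg (fun x => f x - g x) I = avg f I - avg g I.
Proof.
move=> DI [mf fi] [mg gi]; rewrite /avg RintegralB ?mulrBr //; try exact: (dyadic_measurable hD).
- exact: fi.
- exact: gi.
Qed.

Lemma avg_cst (c : R) I : D I -> avg (cst c) I = c.
Proof.
move=> DI; rewrite /avg Rintegral_cst; last exact: (dyadic_measurable hD).
by rewrite mulrCA mulVf ?mulr1 // gt_eqF // (dyadic_len_gt0 hD).
Qed.

Lemma pairing_haar f I : D I -> grid_integrable f ->
  pairing f (haar I) = Num.sqrt (len I) * half_diff lc rc (avg f) I.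
Proof.
move=> DI [mf fi]; have DL := dyadic_lch hD DI; have DR := dyadic_rch hD DI.
have i0 := dyadic_len_gt0 hD DI.
have s0 : 0 < Num.sqrt (len I) by rewrite sqrtr_gt0.
have intr K : D K -> leb.-integrable setT (EFin \o (f \_ K)).
  move=> DK; have := fi _ DK; rewrite (integrable_mkcond _ (dyadic_measurable hD DK)).
  by rewrite -restrict_EFin.
have -> : pairing f (haar I) =
    \int[leb]_x ((Num.sqrt (len I))^-1 * ((f \_ (rc I)) x - (f \_ (lc I)) x)).
  rewrite /pairing /Rintegral; congr fine; apply: ae_eq_integral => //.
  - apply/measurable_EFinP; apply: measurable_funM => //; exact: (measurable_haar hD DI).
  - apply/measurable_EFinP; apply: measurable_funM => //; apply: measurable_funB.
      by apply/(measurable_restrictT _ (dyadic_measurable hD DR)); exact: measurable_funS mf.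
    by apply/(measurable_restrictT _ (dyadic_measurable hD DL)); exact: measurable_funS mf.
  - apply: filterS (haar_children_ae hD DI) => x hx _ /=.
    rewrite hx mulrCA mulrBr !patchE !indicE.
    by case: (x \in rc I); case: (x \in lc I); rewrite ?mulr1 ?mulr0.
rewrite RintegralZl //; last first.
  have := integrableB measurableT (intr _ DR) (intr _ DL).
  by apply: eq_integrable => // x _ /=.
rewrite RintegralB //; [|exact: intr|exact: intr].
rewrite -!Rintegral_mkcond -!len_avg // len_lch // len_rch // /half_diff.
rewrite -[X in X / 2]sqr_sqrtr ?ltW //; field.
by rewrite gt_eqF.
Qed.

Lemma dyadic_child_sub I J : D I -> D J -> J `<=` I -> J != I ->
  J `<=` lc I \/ J `<=` rc I.
Proof.
move=> DI DJ JI nJI; have [x Jx] := dyadic_nonempty hD DJ.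
have lt : len J < len I.
  rewrite lt_neqAle (dyadic_sub_len hD DJ DI JI) andbT.
  apply: contraNneq nJI => lE; apply/eqP.
  exact: (dyadic_same_len hD DJ DI lE Jx (JI _ Jx)).
have le := dyadic_len_lt hD DJ DI lt.
have := JI _ Jx; rewrite {1}(childrenU hD DI) => -[Lx|Rx]; [left|right].
  by apply: (dyadic_nested hD DJ (dyadic_lch hD DI) _ Jx Lx); rewrite len_lch.
by apply: (dyadic_nested hD DJ (dyadic_rch hD DI) _ Jx Rx); rewrite len_rch.
Qed.

Lemma mem_tree_dyadic n I K : D I -> K \in tree lc rc n I -> D K /\ K `<=` I.
Proof.
elim: n I => [|n IH] I DI //=; rewrite inE mem_cat => /predU1P[->|]; first by split.
case/orP => [/(IH _ (dyadic_lch hD DI))|/(IH _ (dyadic_rch hD DI))] [DK KI]; split => //.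
  exact: subset_trans KI (lch_sub hD DI).
exact: subset_trans KI (rch_sub hD DI).
Qed.

Lemma dyadic_mem_tree n I J : D I -> D J -> J `<=` I -> len I <= len J * 2 ^+ n ->
  J \in tree lc rc n.+1 I.
Proof.
have treeS m K : tree lc rc m.+1 K = K :: tree lc rc m (lc K) ++ tree lc rc m (rc K) by [].
elim: n I => [|n IH] I DI DJ JI le; rewrite treeS inE.
  have [x Jx] := dyadic_nonempty hD DJ.
  have lE : len J = len I.
    by apply/eqP; rewrite eq_le (dyadic_sub_len hD DJ DI JI) /= -[leRHS]mulr1.
  by rewrite (dyadic_same_len hD DJ DI lE Jx (JI _ Jx)) eqxx.
have [//|nJI] := eqVneq J I; rewrite orFb mem_cat.
have {}le : len I / 2 <= len J * 2 ^+ n by move: le; rewrite exprS; lra.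
have [s|s] := dyadic_child_sub DI DJ JI nJI; apply/orP; [left|right]; apply: IH => //.
- exact: dyadic_lch.
- by rewrite len_lch.
- exact: dyadic_rch.
- by rewrite len_rch.
Qed.

Lemma uniq_stops (F G : set R -> R) (A : R) n I a b : D I -> uniq (stops lc rc F G A n I a b).
Proof.
elim: n I a b => [|n IH] I a b DI //=.
have DL := dyadic_lch hD DI; have DR := dyadic_rch hD DI.
have cross a1 b1 a2 b2 :
    uniq (stops lc rc F G A n (lc I) a1 b1 ++ stops lc rc F G A n (rc I) a2 b2).
  rewrite cat_uniq !IH // andbT /=; apply/hasPn => K Kr; apply/negP => Kl.
  have [DK Ksub] := mem_tree_dyadic DR (mem_stops Kr).
  have [_ Ksub'] := mem_tree_dyadic DL (mem_stops Kl).
  have [x Kx] := dyadic_nonempty hD DK.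
  have : (lc I `&` rc I) x by split; [exact: Ksub'|exact: Ksub].
  by rewrite (childrenI hD DI).
case: ifPn => _; last exact: cross.
rewrite /= cross andbT mem_cat; apply/negP => /orP[] /mem_stops/mem_tree_dyadic [//|_] sub.
- have := dyadic_sub_len hD DI DL sub; rewrite len_lch //.
  by have := dyadic_len_gt0 hD DI; lra.
- have := dyadic_sub_len hD DI DR sub; rewrite len_rch //.
  by have := dyadic_len_gt0 hD DI; lra.
Qed.

(** If I is contained in J this is [sum_stops_le]; otherwise I itself does not count
    and the length of the intersection with J is additive over the halves of I. *)
Lemma sum_stops_sub_le (F G : set R -> R) (A : R) n I J a b : averaging lc rc D F -> averaging lc rc D G ->
  (forall K, D K -> 0 <= F K) -> (forall K, D K -> 0 <= G K) -> 2 < A ->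
  D I -> measurable J ->
  \sum_(K <- stops lc rc F G A n I a b | `[< K `<=` J >]) len K <=
    A / (A - 2) * len (I `&` J).
Proof.
move=> Fa Ga F0 G0 A2 DI0 mJ.
have lam0 : 0 <= A / (A - 2) by rewrite divr_ge0 //; lra.
elim: n I a b DI0 => [|n IH] I a b DI.
  by rewrite /= big_nil mulr_ge0 // /len fine_ge0.
have [IJ|nIJ] := pselect (I `<=` J).
  have -> : I `&` J = I by apply/setIidPl.
  apply: le_trans (_ : \sum_(K <- stops lc rc F G A n.+1 I a b) len K <= _).
    rewrite [leRHS](bigID (fun K => `[< K `<=` J >])) lerDl big_seq_cond sumr_ge0 //.
    move=> K /andP[/mem_stops/mem_tree_dyadic[//|DK _] _].
    exact: ltW (dyadic_len_gt0 hD DK).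
  apply: (@sum_stops_le _ _ lc rc D len _ _ _ _ _ F G A) => //.
  - exact: dyadic_lch.
  - exact: dyadic_rch.
  - by move=> K DK; rewrite ltW // (dyadic_len_gt0 hD).
  - by move=> K DK; rewrite len_lch.
  - by move=> K DK; rewrite len_rch.
have DL := dyadic_lch hD DI; have DR := dyadic_rch hD DI.
have mL := dyadic_measurable hD DL; have mR := dyadic_measurable hD DR.
have lE : len (I `&` J) = len (lc I `&` J) + len (rc I `&` J).
  have fin K : D K -> leb (K `&` J) \is a fin_num.
    move=> DK; rewrite ge0_fin_numE //; apply: le_lt_trans (ltry (len K)).
    rewrite -(dyadic_lebE hD DK); apply: le_measure; rewrite ?inE //.
    - by apply: measurableI => //; exact: (dyadic_measurable hD DK).
    - exact: (dyadic_measurable hD DK).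
  rewrite /len -fineD ?fin // -measureU //.
  - by rewrite -setIUl -(childrenU hD DI).
  - exact: measurableI.
  - exact: measurableI.
  - by rewrite setIACA (childrenI hD DI) set0I.
have both a1 b1 a2 b2 : \sum_(K <- stops lc rc F G A n (lc I) a1 b1 ++
      stops lc rc F G A n (rc I) a2 b2 | `[< K `<=` J >]) len K <=
    A / (A - 2) * len (I `&` J).
  by rewrite lE mulrDr big_cat /=; apply: lerD; exact: IH.
rewrite [stops _ _ _ _ _ _ _ _ _]/=; case: ifPn => _; last exact: both.
by rewrite big_cons asboolF //; exact: both.
Qed.

End GridAverages.

(** * Weights *)

Section Weights.
Variables (R : realType) (p : R) (D : set (set R)) (w : R -> R).
Hypothesis hp : 1 < p.
Hypothesis hD : dyadic_grid D.
Hypothesis hw : weight w.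
Hypothesis hA : Ap D p w.
Local Notation leb := (@lebesgue_measure R).
Local Notation lc := (lch D).
Local Notation rc := (rch D).
Local Notation sigma := (dual_weight p w).
Local Notation q := (conjugate_exponent p).
Implicit Types (I J K : set R) (f g u : R -> R).

Let p0 : 0 < p. Proof. exact: lt_trans hp. Qed.
Let pB0 : 0 < p - 1. Proof. by rewrite subr_gt0. Qed.

Lemma weight_grid_integrable : grid_integrable D w.
Proof. by case: hw => wl _; exact: locally_integrable_grid. Qed.

Lemma integral_weight_gt0 I : D I -> (0 < \int[leb]_(x in I) (w x)%:E)%E.
Proof.
move=> DI; have [mw wi] := weight_grid_integrable.
have mI := dyadic_measurable hD DI.
have mwI : measurable_fun (I : set (measurableTypeR R)) (EFin \o w).
  exact: (measurable_int _ (wi _ DI)).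
have wE : (\int[leb]_(x in I) (w x)%:E = \int[leb]_(x in I) `|(EFin \o w) x|)%E.
  apply: ae_eq_integral => //; first exact: measurableT_comp.
  by apply: filterS (weight_gt0 hw) => x w0 _ /=; rewrite ger0_norm // ltW.
rewrite lt_neqAle {2}wE integral_ge0 ?andbT => [|x _]; last exact: abse_ge0.
apply/eqP => /esym; rewrite wE => /(ae_eq_integral_abs leb mI mwI) w0.
have : {ae leb, forall x, I x -> False}.
  apply: filterS2 w0 (weight_gt0 hw) => x wx0 wx Ix.
  by have := wx0 Ix => /= -[] wE0; rewrite wE0 ltxx in wx.
move=> [N [mN N0 IN]].
have : (leb I <= leb N)%E.
  apply: le_measure; rewrite ?inE //.
  by move=> x Ix; apply: IN => /= /(_ Ix).
by rewrite N0 (dyadic_lebE hD DI) lee_fin leNgt (dyadic_len_gt0 hD DI).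
Qed.

Lemma eavg_gt0 I : D I -> (0 < eavg w I)%E.
Proof.
move=> DI; rewrite /eavg mule_gt0 ?integral_weight_gt0 //.
by rewrite lte_fin invr_gt0 (dyadic_len_gt0 hD DI).
Qed.

Lemma Ap_bound : exists2 Q : R, 0 <= Q & forall I, D I ->
  (eavg w I * eavg sigma I `^ (p - 1) <= Q%:E)%E.
Proof.
have [I0 [DI0 _ _]] := dyadic_cover hD 0 0.
move: hA; rewrite /Ap; set s := ereal_sup _ => sy.
have sI I : D I -> (eavg w I * eavg sigma I `^ (p - 1) <= s)%E.
  by move=> DI; apply: ereal_sup_ubound; exists I.
have s0 : (0 <= s)%E.
  apply: le_trans (sI _ DI0); rewrite mule_ge0 ?poweR_ge0 //.
  exact/ltW/eavg_gt0.
have sf : s \is a fin_num by rewrite ge0_fin_numE.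
exists (fine s); first by rewrite fine_ge0.
by move=> I DI; rewrite fineK //; exact: sI.
Qed.

(** The average of w is positive, so an infinite average of the dual weight would
    make the A_p product infinite. *)
Lemma integral_sigma_lty I : D I -> (\int[leb]_(x in I) (sigma x)%:E < +oo)%E.
Proof.
move=> DI; have [Q Q0 QI] := Ap_bound.
have w0 := eavg_gt0 DI.
have i0 := dyadic_len_gt0 hD DI.
have : (eavg sigma I < +oo)%E.
  apply: (@lty_poweRy _ _ (p - 1)); first by rewrite gt_eqF.
  rewrite ltey; apply/eqP => sy; have := QI _ DI; rewrite sy gt0_muley //.
rewrite /eavg !ltey; apply: contra => /eqP ->.
by rewrite gt0_muley // lte_fin invr_gt0.
Qed.

(** Hölder against the dual weight, which is integrable on I. *)
Lemma Lpw_grid_integrable f : in_Lpw p w f -> grid_integrable D f.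
Proof.
move=> [mf fN]; split => // I DI; apply/integrableP; split.
  by apply/measurable_EFinP; exact: measurable_funS mf.
apply: le_lt_trans (holder_Lpw_dual hp hw mf (dyadic_measurable hD DI)) _.
apply: lte_mul_pinfty => //; first exact: Lpw_norm_ge0.
  by rewrite ge0_fin_numE // Lpw_norm_ge0.
by apply: poweR_lty; exact: integral_sigma_lty.
Qed.

Lemma Lpw_norm_indicE J : D J ->
  Lpw_norm p w \1_J = ((\int[leb]_(x in J) (w x)%:E) `^ p^-1)%E.
Proof.
move=> DJ; rewrite /Lpw_norm; congr (_ `^ _)%E; rewrite [RHS]integral_mkcond.
apply: eq_integral => x _; rewrite patchE indicE.
case: (x \in J); first by rewrite normr1 powR1 mul1r.
by rewrite normr0 powR0 ?mul0r // gt_eqF.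
Qed.

Lemma Lpw_norm_indic_lty I : D I -> (Lpw_norm p w (\1_I) < +oo)%E.
Proof.
move=> DI; rewrite (Lpw_norm_indicE DI); apply: poweR_lty.
have [_ wi] := weight_grid_integrable.
by have := integrable_lty (dyadic_measurable hD DI) (wi _ DI).
Qed.

Lemma in_Lpw_norm f : in_Lpw p w f -> in_Lpw p w (fun x => `|f x|).
Proof.
by move=> [mf fN]; split; [exact: measurableT_comp|rewrite Lpw_norm_abs].
Qed.

Lemma measurable_sparse_sum (s : seq (set R)) (c : set R -> R) :
  (forall K, K \in s -> D K) ->
  measurable_fun setT (fun x => \sum_(K <- s) c K * \1_K x).
Proof.
move=> sD; apply: measurable_big_seq => K /sD DK; apply: measurable_funM.
  exact: measurable_cst.
by apply: measurable_indic; exact: (dyadic_measurable hD DK).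
Qed.

(** A finite family has no infinite increasing chain, so it competes in [sparse_sup],
    and the value of its operator at f is, almost everywhere, the finite sum. *)
Lemma sparse_norm_le (s : seq (set R)) (B L : R) f :
  uniq s -> (forall K, K \in s -> D K) -> carleson D [set` s] L ->
  (sparse_sup D p L w <= B%:E)%E -> 0 <= B -> in_Lpw p w f ->
  (Lpw_norm p w (fun x => \sum_(K <- s) avg f K * \1_K x)%R <= B%:E * Lpw_norm p w f)%E.
Proof.
move=> us sD sC sB B0 fL.
have ff := Lpw_norm_fin fL.
set A := fun x => _.
have mA : measurable_fun setT A by exact: measurable_sparse_sum.
have oB : (opnorm p w (sparse_op p w [set` s]) <= B%:E)%E.
  apply: le_trans sB; apply: ereal_sup_ubound; exists [set` s] => //; split => //.
  move=> [I HI].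
  have strict m n : (m < n)%N -> I m `<` I n.
    elim: n => // n IH; rewrite ltnS leq_eqVlt => /predU1P[->|/IH mn].
      by have [] := HI n.
    case: mn => s1 n1; have [_ [s2 n2]] := HI n.
    by split; [exact: subset_trans s1 s2|move=> h; apply: n2; exact: subset_trans h s1].
  have inj : injective I.
    move=> m n; case: (ltngtP m n) => // mn; have := strict _ _ mn => -[_ ns] e;
      by exfalso; apply: ns; rewrite e.
  have : (size (undup (map I (iota 0 (size s).+1))) <= size s)%N.
    apply: uniq_leq_size; first exact: undup_uniq.
    by move=> K; rewrite mem_undup => /mapP[n _ ->]; have [] := HI n.
  by rewrite undup_id ?size_map ?size_iota ?ltnn // map_inj_uniq // iota_uniq.
set phi := fine (Lpw_norm p w f).
have phi0 : 0 <= phi by rewrite fine_ge0 // Lpw_norm_ge0.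
have fE : Lpw_norm p w f = phi%:E by rewrite fineK.
apply/lee_addgt0Pr => e e0.
pose d := e / (phi + 1).
have d0 : 0 < d by rewrite divr_gt0 // ltr_wpDl.
have [g [[mg _] sg gN]] := opnorm_approx oB d0 fL.
have [F0 [_ F0s /(_ [set` s])]] := sg d d0.
move=> /(_ (finite_seq s) F0s (fun _ => id)).
have -> : (fun x => \sum_(I \in [set` s]) (avg f I * \1_I x) - g x) = (fun x => A x - g x).
  by apply/funext => x; rewrite -fsbig_seq.
move=> dN.
have -> : A = (fun x => (A x - g x) + g x) by apply/funext => x; rewrite subrK.
apply: le_trans (Lpw_normD hp hw _ mg) _; first exact: measurable_funB.
apply: le_trans (leeD (ltW dN) gN) _.
rewrite fE -!EFinM -!EFinD lee_fin.
have dE : d * (phi + 1) = e by rewrite /d divfK // gt_eqF // ltr_wpDl.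
by lra.
Qed.

End Weights.

(** * Sparse domination of sums over the grid *)

Section SparseForms.
Variables (R : realType) (D : set (set R)) (L : R).
Hypothesis hD : dyadic_grid D.
Hypothesis hL : 1 < L.
Local Notation leb := (@lebesgue_measure R).
Local Notation lc := (lch D).
Local Notation rc := (rch D).
Implicit Types (I J K : set R) (f g u : R -> R) (s : seq (set R)).

(** The parameter for which the Carleson constant A / (A - 2) of the stopping
    intervals is L. *)
Definition stop_ratio : R := 2 * L / (L - 1).
Local Notation A := stop_ratio.

Lemma stop_ratio_gt2 : 2 < A.
Proof. by have hL' := hL; rewrite /stop_ratio ltr_pdivlMr; lra. Qed.

Lemma stop_ratio_carleson : A / (A - 2) = L.
Proof.
have hL' := hL; rewrite /stop_ratio; field.
by rewrite !gt_eqF //; lra.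
Qed.

Definition sparse_form f g s :=
  \sum_(K <- s) avg (fun x => `|f x|) K * avg (fun x => `|g x|) K * len K.

Lemma dyadic_depth s : (forall J, J \in s -> D J) ->
  exists N n : nat, forall J, J \in s -> len J <= 2 ^+ N /\ 2 ^+ N <= len J * 2 ^+ n.
Proof.
have one J : D J -> exists m : nat, len J <= 2 ^+ m /\ 1 <= len J * 2 ^+ m.
  move=> /(dyadic_level hD)[k ->].
  case: k => m.
    exists m; split; first by rewrite -exprnP.
    by rewrite -exprnP -exprD exprn_ege1 // ler1n.
  exists m.+1; rewrite NegzE -exprnN mulVf ?expf_neq0 ?pnatr_eq0 //; split => //.
  apply: (@le_trans _ _ 1); last by rewrite exprn_ege1 // ler1n.
  by rewrite invf_le1 ?exprn_gt0 // exprn_ege1 // ler1n.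
elim: s => [|J s IH] sD; first by exists 0%N, 0%N.
have [|N [n Nn]] := IH; first by move=> K Ks; apply: sD; rewrite inE Ks orbT.
have DJ : D J by apply: sD; rewrite inE eqxx.
have [m [m1 m2]] := one _ DJ.
have ge1 k : 1 <= (2 : R) ^+ k by rewrite exprn_ege1 // ler1n.
have ge0 k : 0 <= (2 : R) ^+ k by rewrite exprn_ge0.
exists (N + m)%N, (n + m + (N + m))%N => K; rewrite inE !exprD => /predU1P[->|Ks].
  split; first by rewrite (le_trans m1) // ler_peMl.
  have -> : len J * (2 ^+ n * 2 ^+ m * (2 ^+ N * 2 ^+ m)) =
    2 ^+ N * 2 ^+ m * (len J * 2 ^+ m * 2 ^+ n) by ring.
  by rewrite ler_peMr ?mulr_ge0 // mulr_ege1.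
have [k1 k2] := Nn _ Ks.
split; first by rewrite (le_trans k1) // ler_peMr.
rewrite -!mulrA mulrA; apply: ler_pM => //.
by rewrite ler_peMr // mulr_ege1.
Qed.

Lemma ler_sum_subset (s t : seq (set R)) (c : set R -> R) : uniq s ->
  {subset s <= t} -> (forall J, J \in t -> 0 <= c J) ->
  \sum_(J <- s) c J <= \sum_(J <- t) c J.
Proof.
move=> us st c0.
apply: (@le_trans _ _ (\sum_(J <- undup t) c J)).
  rewrite (@big_subfamily R _ s (undup t)) ?undup_uniq //; last first.
    by move=> J /st; rewrite mem_undup.
  rewrite lerDl big_seq sumr_ge0 // => J; rewrite mem_filter mem_undup => /andP[_ Jt].
  exact: c0.
elim: t c0 {us st} => [|J t IH] c0 //=.
have ih : \sum_(J <- undup t) c J <= \sum_(J <- t) c J.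
  by apply: IH => K Kt; apply: c0; rewrite inE Kt orbT.
case: ifPn => _; rewrite !big_cons ?lerD2l //.
by rewrite (le_trans ih) // lerDr c0 // inE eqxx.
Qed.

(** The roots have a common length, hence are disjoint, so that the Carleson bounds
    of the families below them add up with the same constant. *)
Lemma carleson_roots (F G : set R -> R) n (rs : seq (set R)) (l : R) :
  averaging lc rc D F -> averaging lc rc D G ->
  (forall K, D K -> 0 <= F K) -> (forall K, D K -> 0 <= G K) ->
  uniq rs -> (forall r, r \in rs -> D r /\ len r = l) ->
  let S := flatten [seq stops lc rc F G A n r 0 0 | r <- rs] in
  [/\ uniq S, forall K, K \in S -> D K & carleson D [set` S] L].
Proof.
move=> Fa Ga F0 G0 urs rsD S.
have A2 := stop_ratio_gt2.
have SD K : K \in S -> exists2 r, r \in rs & K \in tree lc rc n r.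
  by move=> /flattenP[t /mapP[r rrs ->]] /mem_stops Kr; exists r.
have SD' K : K \in S -> D K.
  move=> /SD[r /rsD[Dr _]] /(mem_tree_dyadic hD Dr)[] //.
have uS : uniq S.
  rewrite /S; elim: rs urs rsD {S SD SD'} => [|r rs IH] //= /andP[nr urs] rsD.
  have [Dr lr] := rsD r (mem_head _ _).
  rewrite cat_uniq (uniq_stops hD) //= IH //; last first.
    by move=> r' r'rs; apply: rsD; rewrite inE r'rs orbT.
  rewrite andbT; apply/hasPn => K /flattenP[t /mapP[r' r'rs ->]] /mem_stops Kr'.
  apply/negP => /mem_stops Kr.
  have [Dr' lr'] : D r' /\ len r' = l by apply: rsD; rewrite inE r'rs orbT.
  have [DK Ksub] := mem_tree_dyadic hD Dr Kr.
  have [_ Ksub'] := mem_tree_dyadic hD Dr' Kr'.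
  have [x Kx] := dyadic_nonempty hD DK.
  have e := dyadic_same_len hD Dr Dr' (etrans lr (esym lr')) (Ksub _ Kx) (Ksub' _ Kx).
  by move: nr; rewrite e r'rs.
split => // J DJ.
have mJ := dyadic_measurable hD DJ.
rewrite (esum_sub_seq hD) // (dyadic_lebE hD DJ) -EFinM lee_fin /S.
have step (t : seq (set R)) : (forall r, r \in t -> D r) ->
   \sum_(K <- flatten [seq stops lc rc F G A n r 0 0 | r <- t] | `[< K `<=` J >]) len K
   <= L * \sum_(r <- t) len (r `&` J).
  elim: t => [|r t IH] tD; first by rewrite /= !big_nil mulr0.
  rewrite /= big_cat big_cons mulrDr /=; apply: lerD.
    rewrite -stop_ratio_carleson; apply: (sum_stops_sub_le hD) => //.
    by apply: tD; exact: mem_head.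
  by apply: IH => r' r't; apply: tD; rewrite inE r't orbT.
apply: le_trans (step _ _) _; first by move=> r /rsD[].
rewrite ler_pM2l; last by have hL' := hL; lra.
have mrJ r : D r -> measurable ((r `&` J) : set (measurableTypeR R)).
  by move=> Dr; apply: measurableI => //; exact: (dyadic_measurable hD Dr).
have fin r : D r -> leb (r `&` J) \is a fin_num.
  move=> Dr; rewrite ge0_fin_numE //; apply: le_lt_trans (ltry (len J)).
  rewrite -(dyadic_lebE hD DJ); apply: le_measure; rewrite ?inE //.
  exact: mrJ.
pose U (t : seq (set R)) : set R := \big[setU/set0]_(r <- t) (r `&` J).
have UJ t : U t `<=` J.
  rewrite /U; elim: t => [|r t IH]; first by rewrite big_nil.
  by rewrite big_cons => x [[]|/IH].
suff H t : uniq t -> (forall r, r \in t -> D r /\ len r = l) ->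
    measurable (U t : set (measurableTypeR R)) /\
    (\sum_(r <- t) len (r `&` J))%:E = leb (U t).
  have [mU e] := H _ urs rsD.
  rewrite -lee_fin e -(dyadic_lebE hD DJ).
  by apply: le_measure; rewrite ?inE.
elim: t => [|r t IH]; first by rewrite /U !big_nil measure0.
rewrite cons_uniq => /andP[nr ut] tD.
have tD' r' : r' \in t -> D r' /\ len r' = l by move=> r't; apply: tD; rewrite inE r't orbT.
have [Dr lr] := tD r (mem_head _ _).
have [mU e] := IH ut tD'.
have UE : U (r :: t) = (r `&` J) `|` U t by rewrite /U big_cons.
rewrite UE; split; first by apply: measurableU => //; exact: mrJ.
rewrite measureU //=; last 2 first.
- exact: mrJ.
- apply/seteqP; split => // x [[rx Jx]]; rewrite /U => Ux; exfalso.
  have [r' r't r'x] : exists2 r', r' \in t & r' x.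
    elim: t {IH ut tD nr mU e UE} tD' Ux => [|r1 t IH] tD'; first by rewrite big_nil.
    rewrite big_cons => -[[r1x _]|Ux]; first by exists r1 => //; exact: mem_head.
    have [|r2 r2t r2x] := IH _ Ux; last by exists r2 => //; rewrite inE r2t orbT.
    by move=> r' r't; apply: tD'; rewrite inE r't orbT.
  have [Dr' lr'] := tD' _ r't.
  by move: nr; rewrite (dyadic_same_len hD Dr Dr' (etrans lr (esym lr')) rx r'x) r't.
by rewrite big_cons EFinD e; congr (_ + _)%E; rewrite /len fineK // fin.
Qed.

(** A finite family is contained in finitely many trees of a common depth, with roots
    of a common length. *)
Lemma sparse_form_domination f g (c : set R -> R) (C : R) s :
  grid_integrable D f -> grid_integrable D g -> (forall J, D J -> 0 <= c J) ->
  (forall n r, D r -> \sum_(J <- tree lc rc n r) c J <=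
    C * \sum_(K <- stops lc rc (avg (fun x => `|f x|)) (avg (fun x => `|g x|)) A n r 0 0)
       avg (fun x => `|f x|) K * avg (fun x => `|g x|) K * len K) ->
  uniq s -> (forall J, J \in s -> D J) ->
  exists S, [/\ uniq S, forall K, K \in S -> D K, carleson D [set` S] L &
    \sum_(J <- s) c J <= C * sparse_form f g S].
Proof.
move=> fi gi c0 Hc us sD.
have [N [n Nn]] := dyadic_depth sD.
have rootP J : exists r, D J -> len J <= 2 ^+ N -> [/\ D r, len r = 2 ^+ N & J `<=` r].
  have [[DJ lJ]|no] := pselect (D J /\ len J <= 2 ^+ N); last first.
    by exists set0 => DJ lJ; exfalso; apply: no.
  have [x Jx] := dyadic_nonempty hD DJ.
  have [r [Dr lr rx]] := dyadic_cover hD N%:Z x.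
  exists r => _ _; split => //.
  by apply: (dyadic_nested hD DJ Dr _ Jx rx); rewrite lr -exprnP.
have [root rP] := choice rootP.
pose rs := undup (map root s).
have rsP r : r \in rs -> D r /\ len r = 2 ^+ N.
  rewrite mem_undup => /mapP[J Js ->].
  by have [] := rP J (sD _ Js) (proj1 (Nn _ Js)).
have absi (h : R -> R) : grid_integrable D h -> grid_integrable D (fun x => `|h x|).
  exact: grid_integrable_norm.
have av (h : R -> R) : grid_integrable D h -> averaging lc rc D (avg (fun x => `|h x|)).
  by move=> hi; apply: (avg_averaging hD); exact: absi.
have a0 (h : R -> R) K : D K -> 0 <= avg (fun x => `|h x|) K by move=> DK; exact: (avg_ge0 hD).
have [uS SD SC] := @carleson_roots _ _ n.+1 rs _ (av _ fi) (av _ gi) (a0 f) (a0 g)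
  (undup_uniq _) rsP.
eexists; split; [exact: uS|exact: SD|exact: SC|].
apply: (@le_trans _ _ (\sum_(J <- flatten [seq tree lc rc n.+1 r | r <- rs]) c J)).
  apply: ler_sum_subset => //.
    move=> J Js; have [Dr lr Jr] := rP J (sD _ Js) (proj1 (Nn _ Js)).
    apply/flattenP; exists (tree lc rc n.+1 (root J)).
      by apply: map_f; rewrite mem_undup map_f.
    apply: (dyadic_mem_tree hD) => //; first exact: sD.
    by rewrite lr; exact: (proj2 (Nn _ Js)).
  move=> J /flattenP[t /mapP[r /rsP[Dr _] ->]] /(mem_tree_dyadic hD Dr)[DJ _].
  exact: c0.
rewrite /sparse_form !big_flatten !big_map mulr_sumr !big_seq.
by apply: ler_sum => r /rsP[Dr _]; exact: Hc.
Qed.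

End SparseForms.

(** * Duality *)

Section Duality.
Variables (R : realType) (p : R) (D : set (set R)) (w : R -> R) (L : R).
Hypothesis hp : 1 < p.
Hypothesis hD : dyadic_grid D.
Hypothesis hw : weight w.
Hypothesis hA : Ap D p w.
Local Notation leb := (@lebesgue_measure R).
Implicit Types (I J K : set R) (f g u : R -> R) (s t : seq (set R)).

Let p0 : 0 < p. Proof. exact: lt_trans hp. Qed.
Let pB0 : 0 < p - 1. Proof. by rewrite subr_gt0. Qed.

Definition localized (m : set R -> R) (x : set R -> R -> R) := forall J, D J ->
  [/\ 0 <= m J, measurable_fun setT (x J) & forall y, `|x J y| <= m J * \1_J y].

Lemma localized_integrable m x g J : localized m x -> grid_integrable D g -> D J ->
  leb.-integrable setT (EFin \o (fun y => x J y * g y)).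
Proof.
move=> lx gi DJ; have [m0 mx xm] := lx J DJ.
have [mg giJ] := grid_integrable_norm gi.
have iJ := giJ J DJ; have [mg' _] := gi.
have mJ := dyadic_measurable hD DJ.
have : leb.-integrable setT (EFin \o (fun y => m J * ((fun y => `|g y|) \_ J) y)).
  have := iJ; rewrite (integrable_mkcond _ mJ) restrict_EFin => iJ'.
  by have := integrableZl measurableT (m J) iJ'; apply: eq_integrable.
apply: le_integrable => //.
  by apply/measurable_EFinP; exact: measurable_funM.
move=> y _ /=; rewrite lee_fin normrM; apply: le_trans (ler_norm _).
rewrite patchE; have := xm y; rewrite indicE; case: (y \in J) => h.
  by rewrite ler_wpM2r // -[leRHS]mulr1.
by rewrite mulr0 (_ : `|x J y| = 0) ?mul0r //; apply/eqP; rewrite eq_le normr_ge0 andbT -[leRHS](mulr0 (m J)).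
Qed.

Lemma pairing_sum m x g t : localized m x -> grid_integrable D g ->
  (forall J, J \in t -> D J) ->
  leb.-integrable setT (EFin \o (fun y => (\sum_(J <- t) x J y) * g y)) /\
  pairing (fun y => \sum_(J <- t) x J y) g = \sum_(J <- t) pairing (x J) g.
Proof.
move=> lx gi; elim: t => [|J t IH] tD.
  have e : (fun y => (\sum_(J <- [::]) x J y) * g y) = cst 0.
    by apply/funext => y; rewrite big_nil mul0r.
  split; first by rewrite e; exact: integrable0.
  by rewrite /pairing e big_nil /Rintegral integral0.
have [|it et] := IH; first by move=> K Kt; apply: tD; rewrite inE Kt orbT.
have iJ := localized_integrable lx gi (tD _ (mem_head J t)).
have e : (fun y => (\sum_(J <- J :: t) x J y) * g y) =
    (fun y => x J y * g y + (\sum_(J <- t) x J y) * g y).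
  by apply/funext => y; rewrite big_cons mulrDl.
split.
  by rewrite e; have := integrableD measurableT iJ it; apply: eq_integrable.
by rewrite big_cons -et /pairing e RintegralD.
Qed.

Lemma localized_signs m x (e : set R -> bool) : localized m x ->
  localized m (fun J y => (-1) ^+ e J * x J y).
Proof.
move=> lx J DJ; have [m0 mx xm] := lx J DJ; split => //.
  by apply: measurable_funM => //; exact: measurable_cst.
by move=> y; rewrite normrM normrX normrN1 expr1n mul1r.
Qed.

Lemma Lpw_norm_sparse_lty t (c : set R -> R) : (forall J, J \in t -> D J) ->
  (Lpw_norm p w (fun y => \sum_(J <- t) c J * \1_J y)%R < +oo)%E.
Proof.
elim: t => [|J t IH] tD.
  under [X in Lpw_norm _ _ X]eq_fun do rewrite big_nil.
  by rewrite Lpw_norm0 // ltry.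
have DJ := tD J (mem_head _ _).
have tD' K : K \in t -> D K by move=> Kt; apply: tD; rewrite inE Kt orbT.
have mJ : measurable_fun setT (\1_J : R -> R).
  by apply: measurable_indic; exact: (dyadic_measurable hD DJ).
under [X in Lpw_norm _ _ X]eq_fun do rewrite big_cons.
apply: le_lt_trans (Lpw_normD hp hw _ (measurable_sparse_sum hD c tD')) _.
  by apply: measurable_funM => //; exact: measurable_cst.
apply: lte_add_pinfty; last exact: IH.
rewrite Lpw_normZ //; apply: lte_mul_pinfty => //.
exact: (Lpw_norm_indic_lty hp hD hw DJ).
Qed.

(** The norm of a signed sum u is computed by pairing it with g = u |u| ^ (p - 2) w.
    The hypothesis on the pairings of g, and Hölder for the sparse operator applied
    to |f| against |u| ^ (p - 1) w, bound the p-th power of the norm of u by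
    C * B * |f| times its (p - 1)-th power. *)
Lemma duality_norm_le m x s f (e : set R -> bool) (C B : R) :
  localized m x -> uniq s -> (forall J, J \in s -> D J) -> in_Lpw p w f ->
  0 <= C -> 0 <= B -> (sparse_sup D p L w <= B%:E)%E ->
  (forall g, grid_integrable D g -> exists S,
    [/\ uniq S, forall K, K \in S -> D K, carleson D [set` S] L &
      \sum_(J <- s) `|pairing (x J) g| <= C * sparse_form f g S]) ->
  (Lpw_norm p w (fun y => \sum_(J <- s) (-1) ^+ e J * x J y)%R <=
    (C * B)%:E * Lpw_norm p w f)%E.
Proof.
move=> lx us sD fL C0 B0 sB H.
have ff := Lpw_norm_fin fL.
set phi := fine (Lpw_norm p w f).
have phi0 : 0 <= phi by rewrite fine_ge0 // Lpw_norm_ge0.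
have fE : Lpw_norm p w f = phi%:E by rewrite fineK.
have ls := localized_signs e lx.
pose u y := \sum_(J <- s) (-1) ^+ e J * x J y.
have mu : measurable_fun setT u.
  by apply: measurable_big_seq => J /sD DJ; have [] := ls J DJ.
have um y : `|u y| <= \sum_(J <- s) m J * \1_J y.
  apply: le_trans (ler_norm_sum _ _ _) _; rewrite !big_seq.
  by apply: ler_sum => J /sD DJ; have [_ _] := ls J DJ.
pose Mb := \sum_(J <- s) m J.
have Mb0 : 0 <= Mb by rewrite /Mb big_seq sumr_ge0 // => J /sD/lx[].
have uM y : `|u y| <= Mb.
  apply: le_trans (um y) _; rewrite /Mb !big_seq; apply: ler_sum => J /sD DJ.
  by have [m0 _ _] := lx J DJ; rewrite ler_piMr // indicE lern1 leq_b1.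
have ufin : (Lpw_norm p w u < +oo)%E.
  apply: le_lt_trans (Lpw_norm_sparse_lty m sD).
  apply: Lpw_norm_le_ae => //; first exact: (measurable_sparse_sum hD m sD).
  by apply: aeW => y; apply: le_trans (um y) (ler_norm _).
have uf : Lpw_norm p w u \is a fin_num by rewrite ge0_fin_numE // Lpw_norm_ge0.
set U := fine (Lpw_norm p w u).
have U0 : 0 <= U by rewrite fine_ge0 // Lpw_norm_ge0.
have uE : Lpw_norm p w u = U%:E by rewrite fineK.
have mw := measurable_weight hw.
pose g y := u y * `|u y| `^ (p - 1 - 1) * w y.
have gabs y : `|g y| = `|u y| `^ (p - 1) * `|w y|.
  by rewrite /g !normrM [`|_ `^ _|]ger0_norm ?powR_ge0 // mulr_powRB1.
have mg : measurable_fun setT g.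
  apply: measurable_funM => //; apply: measurable_funM => //.
  by apply: measurable_powR_fun; exact: measurableT_comp.
have gi : grid_integrable D g.
  split => // I DI; have [_ wi] := weight_grid_integrable hD hw.
  have mI := dyadic_measurable hD DI.
  have : leb.-integrable I (EFin \o (fun y => Mb `^ (p - 1) * w y)).
    by have := integrableZl mI (Mb `^ (p - 1)) (wi _ DI); apply: eq_integrable.
  apply: le_integrable => //.
    by apply/measurable_EFinP; exact: measurable_funS mg.
  move=> y _ /=; rewrite lee_fin gabs normrM ler_wpM2r // ger0_norm ?powR_ge0 //.
  by rewrite ge0_ler_powR ?nnegrE ?(ltW pB0).
have gi' := grid_integrable_norm gi.
have upE : U `^ p = pairing u g.
  have -> : U `^ p = fine ((Lpw_norm p w u) `^ p)%E by rewrite uE poweR_EFin.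
  rewrite Lpw_normE // poweR_LnormE; last exact: ltW.
  rewrite /pairing /Rintegral; congr fine; apply: ae_eq_integral => //.
  - by apply: measurable_normpow; exact: measurable_mul_root.
  - by apply/measurable_EFinP; exact: measurable_funM.
  - apply: filterS (weight_gt0 hw) => y w0 _ /=; congr EFin.
    rewrite normrM powRM // [`|_ `^ _|]ger0_norm ?powR_ge0 // (root_powR hp w0).
    rewrite /g mulrA; congr (_ * _).
    rewrite mulrA -expr2 -real_normK ?num_real // expr2 -mulrA mulr_powRB1 //.
    by rewrite mulr_powRB1.
have [S [uS SD SC HS]] := H g gi.
have le1 : U `^ p <= C * sparse_form f g S.
  apply: le_trans HS; rewrite upE.
  have [_ ->] := pairing_sum ls gi sD.
  apply: le_trans (ler_norm _) _; apply: le_trans (ler_norm_sum _ _ _) _.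
  rewrite !big_seq; apply: ler_sum => J /sD DJ.
  have [m0 mx xm] := lx J DJ.
  rewrite /pairing.
  have -> : (fun y => (-1) ^+ e J * x J y * g y) = (fun y => (-1) ^+ e J * (x J y * g y)).
    by apply/funext => y; rewrite -mulrA.
  rewrite RintegralZl //; last exact: (localized_integrable lx gi DJ).
  by rewrite normrM normrX normrN1 expr1n mul1r.
pose a K := avg (fun y => `|f y|) K.
have fg := Lpw_grid_integrable hp hD hw hA fL.
have la : localized a (fun K y => a K * \1_K y).
  move=> K DK; have a0 : 0 <= a K by exact: (avg_ge0 hD).
  split => //.
    apply: measurable_funM; first exact: measurable_cst.
    by apply: measurable_indic; exact: (dyadic_measurable hD DK).
  by move=> y; rewrite normrM !ger0_norm // indicE.
pose A y := \sum_(K <- S) a K * \1_K y.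
have mA : measurable_fun setT A by exact: (measurable_sparse_sum hD).
have [iA eA] := pairing_sum la gi' SD.
have sE : sparse_form f g S = pairing A (fun y => `|g y|).
  rewrite eA /sparse_form !big_seq; apply: eq_bigr => K /SD DK.
  rewrite -mulrA [_ * len K]mulrC (len_avg hD) //.
  rewrite /pairing.
  have -> : (fun y => a K * \1_K y * `|g y|) = (fun y => a K * ((fun y => `|g y|) \_ K) y).
    apply/funext => y; rewrite patchE indicE -mulrA; congr (_ * _).
    by case: (y \in K); rewrite ?mul1r ?mul0r.
  rewrite RintegralZl //; first by rewrite -Rintegral_mkcond.
  have [_ /(_ K DK)] := gi'.
  by rewrite (integrable_mkcond _ (dyadic_measurable hD DK)) restrict_EFin.
have AN : (Lpw_norm p w A <= (B * phi)%:E)%E.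
  have := sparse_norm_le hp hD hw uS SD SC sB B0 (in_Lpw_norm fL).
  by rewrite Lpw_norm_abs fE -EFinM.
have le2 : sparse_form f g S <= B * phi * U `^ (p - 1).
  rewrite sE -lee_fin /pairing fineK; last exact: (integrable_fin_num measurableT iA).
  apply: (@le_trans _ _ (Lpw_norm p w A * Lpw_norm p w u `^ (p - 1))%E).
    apply: le_trans (holder_Lpw_pow hp hw mA mu); rewrite le_eqVlt; apply/orP; left; apply/eqP.
    apply: ae_eq_integral => //.
    - exact: (measurable_int _ iA).
    - apply/measurable_EFinP; apply: measurable_funM; first exact: measurableT_comp.
      apply: measurable_funM => //; apply: measurable_powR_fun; exact: measurableT_comp.
    - apply: filterS (weight_gt0 hw) => y w0 _ /=.
      rewrite gabs (ger0_norm (ltW w0)) [`|A y|]ger0_norm //.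
      rewrite /A big_seq sumr_ge0 // => K /SD DK; rewrite mulr_ge0 //.
      exact: (avg_ge0 hD).
  rewrite uE poweR_EFin EFinM; apply: lee_wpmul2r => //.
  by rewrite lee_fin powR_ge0.
rewrite -/u uE fE -EFinM lee_fin.
have [->|Un0] := eqVneq U 0; first by rewrite !mulr_ge0.
have Up : 0 < U by rewrite lt_def Un0.
rewrite -(ler_pM2r (powR_gt0 (p - 1) Up)) mulr_powRB1 //.
apply: le_trans le1 _; rewrite -!mulrA; apply: ler_wpM2l => //.
by rewrite mulrA.
Qed.

End Duality.

(** * Haar operators are controlled by sparse operators *)

Section LowerBound.
Variables (R : realType) (p : R) (D : set (set R)) (w : R -> R) (L : R).
Hypothesis hp : 1 < p.
Hypothesis hL : 1 < L.
Hypothesis hD : dyadic_grid D.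
Hypothesis hw : weight w.
Hypothesis hA : Ap D p w.
Local Notation leb := (@lebesgue_measure R).
Local Notation lc := (lch D).
Local Notation rc := (rch D).
Local Notation A := (stop_ratio L).
Local Notation hd f := (half_diff lc rc (avg f)).
Implicit Types (I J K : set R) (f g u b : R -> R) (s t : seq (set R)).

Let A2 : 2 < A := stop_ratio_gt2 hL.
Let len0 J : D J -> 0 <= len J. Proof. by move=> DJ; rewrite ltW // (dyadic_len_gt0 hD). Qed.
Let Pl := dyadic_lch hD.
Let Pr := dyadic_rch hD.
Let ml := len_lch hD.
Let mr := len_rch hD.

Lemma localized_haar : localized D (fun J => (Num.sqrt (len J))^-1) (@haar R).
Proof.
move=> J DJ; split; first by rewrite invr_ge0 sqrtr_ge0.
  exact: (measurable_haar hD DJ).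
move=> y; have [Jy|Jy] := pselect (J y).
  by rewrite indicE mem_set // mulr1 haar_bounded.
by rewrite haar_out // normr0 mulr_ge0 ?invr_ge0 ?sqrtr_ge0.
Qed.

Lemma localized_scale m x (c : set R -> R) : localized D m x ->
  localized D (fun J => `|c J| * m J) (fun J y => c J * x J y).
Proof.
move=> lx J DJ; have [m0 mx xm] := lx J DJ; split; first by rewrite mulr_ge0.
  by apply: measurable_funM => //; exact: measurable_cst.
by move=> y; rewrite normrM -mulrA ler_wpM2l.
Qed.

Lemma localized_indic : localized D (fun J => (len J)^-1) (fun J y => \1_J y / len J).
Proof.
move=> J DJ; have l0 := len0 DJ; split; first by rewrite invr_ge0.
  apply: measurable_funM; last exact: measurable_cst.
  by apply: measurable_indic; exact: (dyadic_measurable hD DJ).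
by move=> y; rewrite normrM mulrC !ger0_norm ?invr_ge0 // indicE.
Qed.

Lemma pairing_scale m x (a : R) g J : localized D m x -> grid_integrable D g -> D J ->
  pairing (fun y => a * x J y) g = a * pairing (x J) g.
Proof.
move=> lx gi DJ; rewrite /pairing.
have -> : (fun y => a * x J y * g y) = (fun y => a * (x J y * g y)).
  by apply/funext => y; rewrite -mulrA.
by rewrite RintegralZl //; exact: (localized_integrable hD lx gi DJ).
Qed.

Lemma pairingC f g : pairing f g = pairing g f.
Proof. by rewrite /pairing; congr Rintegral; apply/funext => y; rewrite mulrC. Qed.

Lemma pairing_indic g J : D J -> grid_integrable D g ->
  pairing (fun y => \1_J y / len J) g = avg g J.
Proof.
move=> DJ [mg gi]; rewrite /pairing /avg.
have -> : (fun y => \1_J y / len J * g y) = (fun y => (len J)^-1 * ((g \_ J) y)).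
  apply/funext => y; rewrite patchE indicE mulrAC mulrC; congr (_ * _).
  by case: (y \in J); rewrite ?mul1r ?mul0r.
rewrite RintegralZl //; first by rewrite -Rintegral_mkcond.
by have := gi _ DJ; rewrite (integrable_mkcond _ (dyadic_measurable hD DJ)) restrict_EFin.
Qed.

Lemma eavg_avg f J : D J -> grid_integrable D f -> eavg f J = (avg f J)%:E.
Proof.
move=> DJ [mf fi]; rewrite /eavg /avg /Rintegral EFinM fineK //.
exact: (integrable_fin_num (dyadic_measurable hD DJ) (fi _ DJ)).
Qed.

Let absavg f : grid_integrable D f -> averaging lc rc D (avg (fun y => `|f y|)).
Proof. by move=> fi; apply: (avg_averaging hD); exact: grid_integrable_norm. Qed.

Let avgf f : grid_integrable D f -> averaging lc rc D (avg f).
Proof. by move=> fi; apply: (avg_averaging hD). Qed.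

Let avgle f : grid_integrable D f -> forall J, D J -> `|avg f J| <= avg (fun y => `|f y|) J.
Proof. by move=> fi J DJ; exact: (avg_norm_le hD). Qed.

Let sqrt_len J : D J -> Num.sqrt (len J) * Num.sqrt (len J) = len J.
Proof. by move=> DJ; rewrite -expr2 sqr_sqrtr // len0. Qed.

(** The pairing of g with the term of J is the product of tau J, len J and the half
    differences of f and g at J, so [martingale_form_le] provides the sparse form. *)
Lemma martingale_opnorm_le (tau : set R -> R) (T B : R) :
  (forall J, D J -> `|tau J| <= T) -> 0 <= T -> 0 <= B ->
  (sparse_sup D p L w <= B%:E)%E ->
  (opnorm p w (martingale_transform p w D tau) <= (T * (4 * A ^+ 2) * B)%:E)%E.
Proof.
move=> tT T0 B0 sB.
have C0 : 0 <= T * (4 * A ^+ 2) by rewrite mulr_ge0 // mulr_ge0 // sqr_ge0.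
have lx f : localized D _ (fun J y => tau J * pairing f (haar J) * haar J y) :=
  localized_scale (fun J => tau J * pairing f (haar J)) localized_haar.
apply: (opnorm_le_signed hp hw); first by rewrite mulr_ge0.
  by move=> f J fL DJ; have [] := lx f J DJ.
move=> f s e fL us sD; have fi := Lpw_grid_integrable hp hD hw hA fL.
apply: (duality_norm_le hp hD hw hA e (lx f) us sD fL C0 B0 sB) => g gi.
have [S [uS SD SC HS]] := @sparse_form_domination R D L hD hL f g
  (fun J => len J * (`|hd f J| * `|hd g J|)) (4 * A ^+ 2) s fi gi
  (fun J DJ => mulr_ge0 (len0 DJ) (mulr_ge0 (normr_ge0 _) (normr_ge0 _)))
  (fun n r Dr => martingale_form_le Pl Pr len0 ml mr (absavg fi) (absavg gi)
     (avgf fi) (avgf gi) (avgle fi) (avgle gi) A2 n Dr) us sD.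
exists S; split => //; rewrite -mulrA.
apply: le_trans (ler_wpM2l T0 HS); rewrite mulr_sumr !big_seq.
apply: ler_sum => J /sD DJ.
rewrite (pairing_scale _ localized_haar) // [pairing (haar J) g]pairingC.
rewrite !(pairing_haar hD) //.
have -> : tau J * (Num.sqrt (len J) * hd f J) * (Num.sqrt (len J) * hd g J) =
  tau J * (Num.sqrt (len J) * Num.sqrt (len J) * (hd f J * hd g J)) by ring.
rewrite sqrt_len // normrM; apply: ler_pM => //; first exact: tT.
by rewrite normrM (ger0_norm (len0 DJ)) normrM.
Qed.

Lemma BMO_oscillation b J : in_BMO D b -> D J ->
  avg (fun y => `|b y - avg b J|) J <= fine (BMO_norm D b).
Proof.
move=> [bl bB] DJ; have bi := locally_integrable_grid hD bl.
have oi : grid_integrable D (fun y => `|b y - avg b J|).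
  apply: grid_integrable_norm; apply: grid_integrableB => //.
  exact: (grid_integrable_cst hD).
have le : ((avg (fun y => `|b y - avg b J|) J)%:E <= BMO_norm D b)%E.
  rewrite -eavg_avg //; apply: ereal_sup_ubound; by exists J.
have fB : BMO_norm D b \is a fin_num.
  by rewrite ge0_fin_numE //; apply: le_trans le; rewrite lee_fin (avg_ge0 hD).
by rewrite -lee_fin fineK.
Qed.

Lemma BMO_carleson b n J : in_BMO D b -> D J ->
  \sum_(K <- tree lc rc n J) len K * hd b K ^+ 2 <=
  32 * fine (BMO_norm D b) ^+ 2 * len J.
Proof.
move=> bB DJ; have [bl _] := bB; have bi := locally_integrable_grid hD bl.
have oi c : grid_integrable D (fun y => b y - c).
  by apply: grid_integrableB => //; exact: (grid_integrable_cst hD).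
apply: (carleson_half_diff Pl Pr len0 ml mr (H := fun c => avg (fun y => `|b y - c|))) => //.
- exact: avgf.
- by move=> c; exact: absavg.
- move=> c K DK; rewrite -{1}(avg_cst hD c DK) -(avgB hD) //; last exact: (grid_integrable_cst hD).
  exact: (avgle (oi c) DK).
- by move=> K DK; exact: BMO_oscillation.
- apply: le_trans (BMO_oscillation bB DJ).
  by apply: (avg_ge0 hD).
Qed.

(** The constant of [paraproduct_form_le] for a Carleson sequence of constant 32. *)
Definition paraproduct_const : R := A / 2 * (32 + 4 * A ^+ 2).

Lemma paraproduct_const_ge0 : 0 <= paraproduct_const.
Proof.
have A2' := A2; rewrite /paraproduct_const mulr_ge0 //; first by lra.
by rewrite addr_ge0 // mulr_ge0 // sqr_ge0.
Qed.

Lemma paraproduct_opnorm_le b (B : R) :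
  in_BMO D b -> 0 < fine (BMO_norm D b) -> 0 <= B ->
  (sparse_sup D p L w <= B%:E)%E ->
  (opnorm p w (paraproduct p w D b) <=
    (fine (BMO_norm D b) * paraproduct_const * B)%:E)%E.
Proof.
move=> bB; set N := fine _ => N0 B0 sB.
have [bl _] := bB; have bi := locally_integrable_grid hD bl.
have C0 : 0 <= N * paraproduct_const by rewrite mulr_ge0 ?paraproduct_const_ge0 // ltW.
have lx f : localized D _ (fun J y => pairing b (haar J) * avg f J * haar J y) :=
  localized_scale (fun J => pairing b (haar J) * avg f J) localized_haar.
apply: (opnorm_le_signed hp hw); first by rewrite mulr_ge0.
  by move=> f J fL DJ; have [] := lx f J DJ.
move=> f s e fL us sD; have fi := Lpw_grid_integrable hp hD hw hA fL.
apply: (duality_norm_le hp hD hw hA e (lx f) us sD fL C0 B0 sB) => g gi.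
have [S [uS SD SC HS]] := @sparse_form_domination R D L hD hL f g
  (fun J => len J * (`|hd b J| * `|avg f J| * `|hd g J|)) (paraproduct_const * N) s fi gi
  (fun J DJ => mulr_ge0 (len0 DJ) (mulr_ge0 (mulr_ge0 (normr_ge0 _) (normr_ge0 _)) (normr_ge0 _)))
  (fun n r Dr => paraproduct_form_le Pl Pr len0 ml mr (absavg fi) (absavg gi)
     (avgf gi) (avgle fi) (avgle gi) A2 n N0 (ler0n _ 32) Dr (avgle fi)
     (fun n J DJ => BMO_carleson n bB DJ)) us sD.
exists S; split => //; rewrite [N * _]mulrC.
apply: le_trans HS; rewrite !big_seq.
apply: ler_sum => J /sD DJ.
rewrite (pairing_scale _ localized_haar) // [pairing (haar J) g]pairingC.
rewrite !(pairing_haar hD) //.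
have -> : Num.sqrt (len J) * hd b J * avg f J * (Num.sqrt (len J) * hd g J) =
  Num.sqrt (len J) * Num.sqrt (len J) * (hd b J * avg f J * hd g J) by ring.
by rewrite sqrt_len // normrM (ger0_norm (len0 DJ)) !normrM.
Qed.

(** The pairings are those of the paraproduct with f and g exchanged, and the stopping
    intervals are symmetric in f and g. *)
Lemma adjoint_paraproduct_opnorm_le b (B : R) :
  in_BMO D b -> 0 < fine (BMO_norm D b) -> 0 <= B ->
  (sparse_sup D p L w <= B%:E)%E ->
  (opnorm p w (adjoint_paraproduct p w D b) <=
    (fine (BMO_norm D b) * paraproduct_const * B)%:E)%E.
Proof.
move=> bB; set N := fine _ => N0 B0 sB.
have [bl _] := bB; have bi := locally_integrable_grid hD bl.
have C0 : 0 <= N * paraproduct_const by rewrite mulr_ge0 ?paraproduct_const_ge0 // ltW.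
have lx f : localized D _ (fun J y => pairing b (haar J) * pairing f (haar J) * (\1_J y / len J)) :=
  localized_scale (fun J => pairing b (haar J) * pairing f (haar J)) localized_indic.
apply: (opnorm_le_signed hp hw); first by rewrite mulr_ge0.
  by move=> f J fL DJ; have [] := lx f J DJ.
move=> f s e fL us sD; have fi := Lpw_grid_integrable hp hD hw hA fL.
apply: (duality_norm_le hp hD hw hA e (lx f) us sD fL C0 B0 sB) => g gi.
have form n r (Dr : D r) : \sum_(J <- tree lc rc n r) len J * (`|hd b J| * `|avg g J| * `|hd f J|) <=
    paraproduct_const * N * \sum_(K <- stops lc rc (avg (fun y => `|f y|)) (avg (fun y => `|g y|)) A n r 0 0)
       avg (fun y => `|f y|) K * avg (fun y => `|g y|) K * len K.
  have := paraproduct_form_le Pl Pr len0 ml mr (absavg gi) (absavg fi)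
     (avgf fi) (avgle gi) (avgle fi) A2 n N0 (ler0n _ 32) Dr (avgle gi)
     (fun n J DJ => BMO_carleson n bB DJ).
  rewrite stopsC => /le_trans; apply; rewrite le_eqVlt; apply/orP; left; apply/eqP.
  by congr (_ * _); apply: eq_bigr => K _; congr (_ * _); rewrite mulrC.
have [S [uS SD SC HS]] := @sparse_form_domination R D L hD hL f g
  (fun J => len J * (`|hd b J| * `|avg g J| * `|hd f J|)) (paraproduct_const * N) s fi gi
  (fun J DJ => mulr_ge0 (len0 DJ) (mulr_ge0 (mulr_ge0 (normr_ge0 _) (normr_ge0 _)) (normr_ge0 _)))
  form us sD.
exists S; split => //; rewrite [N * _]mulrC.
apply: le_trans HS; rewrite !big_seq.
apply: ler_sum => J /sD DJ.
rewrite (pairing_scale _ localized_indic) // pairing_indic //.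
rewrite !(pairing_haar hD) //.
have -> : Num.sqrt (len J) * hd b J * (Num.sqrt (len J) * hd f J) * avg g J =
  Num.sqrt (len J) * Num.sqrt (len J) * (hd b J * avg g J * hd f J) by ring.
by rewrite sqrt_len // normrM (ger0_norm (len0 DJ)) !normrM.
Qed.

End LowerBound.

(** * The multiplicity function of a sparse family *)

Section Indicators.
Variables (R : realType) (D : set (set R)).
Hypothesis hD : dyadic_grid D.
Local Notation leb := (@lebesgue_measure R).
Local Notation lc := (lch D).
Local Notation rc := (rch D).
Local Notation hd f := (half_diff lc rc (avg f)).
Implicit Types (I J K : set R) (f g u b : R -> R) (s t : seq (set R)).

Lemma grid_integrable_bounded f (M : R) : measurable_fun setT f ->
  (forall y, `|f y| <= M) -> grid_integrable D f.
Proof.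
move=> mf fM; split => // J DJ; have [_ /(_ J DJ)] := grid_integrable_cst hD M.
apply: le_integrable; first exact: (dyadic_measurable hD DJ).
  by apply/measurable_EFinP; exact: measurable_funS mf.
by move=> y _; rewrite lee_fin; apply: le_trans (fM y) (ler_norm _).
Qed.

Lemma grid_integrable_indic I : D I -> grid_integrable D \1_I.
Proof.
move=> DI; apply: (@grid_integrable_bounded _ 1).
  by apply: measurable_indic; exact: (dyadic_measurable hD DI).
by move=> y; rewrite ger0_norm // indicE lern1 leq_b1.
Qed.

Lemma grid_integrableD f g : grid_integrable D f -> grid_integrable D g ->
  grid_integrable D (fun x => f x + g x).
Proof.
move=> [mf fi] [mg gi]; split; first exact: measurable_funD.
move=> I DI; have mI := dyadic_measurable hD DI.
by have := integrableD mI (fi _ DI) (gi _ DI); apply: eq_integrable.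
Qed.

Lemma avgD f g J : D J -> grid_integrable D f -> grid_integrable D g ->
  avg (fun x => f x + g x) J = avg f J + avg g J.
Proof.
move=> DJ [mf fi] [mg gi]; rewrite /avg RintegralD ?mulrDr //.
- exact: (dyadic_measurable hD DJ).
- exact: fi.
- exact: gi.
Qed.

Lemma avg_eq f g J : (forall y, J y -> f y = g y) -> avg f J = avg g J.
Proof.
by move=> fg; rewrite /avg; congr (_ * _); apply: eq_Rintegral => y /set_mem/fg.
Qed.

Lemma avg_le f g J : D J -> grid_integrable D f -> grid_integrable D g ->
  (forall y, J y -> f y <= g y) -> avg f J <= avg g J.
Proof.
move=> DJ [mf fi] [mg gi] fg; rewrite /avg ler_pM2l; last first.
  by rewrite invr_gt0 (dyadic_len_gt0 hD).
apply: le_Rintegral => //; [exact: (dyadic_measurable hD DJ)|exact: fi|exact: gi].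
Qed.

Lemma avg_indic_sub I J : D I -> D J -> I `<=` J -> avg \1_I J = len I / len J.
Proof.
move=> DI DJ IJ; rewrite /avg mulrC; congr (_ / _).
rewrite /Rintegral integral_indic; [|exact: (dyadic_measurable hD DJ)|exact: (dyadic_measurable hD DI)].
by congr fine; congr (leb _); apply/setIidPl.
Qed.

Lemma avg_indic_sup I J : D J -> J `<=` I -> avg \1_I J = 1.
Proof.
move=> DJ JI; rewrite -(avg_cst hD 1 DJ); apply: avg_eq => y /JI Iy.
by rewrite indicE mem_set.
Qed.

Lemma avg_indic_disj I J : D J -> I `&` J = set0 -> avg \1_I J = 0.
Proof.
move=> DJ IJ; rewrite -(avg_cst hD 0 DJ); apply: avg_eq => y Jy.
by rewrite indicE memNset // => Iy; have : (I `&` J) y by []; rewrite IJ.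
Qed.

Definition multiplicity s (y : R) : R := \sum_(I <- s) \1_I y.

Lemma grid_integrable_multiplicity s : (forall I, I \in s -> D I) ->
  grid_integrable D (multiplicity s).
Proof.
elim: s => [|I s IH] sD.
  have -> : multiplicity [::] = cst 0 by apply/funext => y; rewrite /multiplicity big_nil.
  exact: grid_integrable_cst.
have -> : multiplicity (I :: s) = (fun y => \1_I y + multiplicity s y).
  by apply/funext => y; rewrite /multiplicity big_cons.
apply: grid_integrableD; first by apply: grid_integrable_indic; apply: sD; exact: mem_head.
by apply: IH => K Ks; apply: sD; rewrite inE Ks orbT.
Qed.

Lemma avg_multiplicity s J : (forall I, I \in s -> D I) -> D J ->
  avg (multiplicity s) J = \sum_(I <- s) avg \1_I J.
Proof.
move=> + DJ; elim: s => [|I s IH] sD.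
  have -> : multiplicity [::] = cst 0 by apply/funext => y; rewrite /multiplicity big_nil.
  by rewrite (avg_cst hD) // big_nil.
have -> : multiplicity (I :: s) = (fun y => \1_I y + multiplicity s y).
  by apply/funext => y; rewrite /multiplicity big_cons.
have sD' K : K \in s -> D K by move=> Ks; apply: sD; rewrite inE Ks orbT.
rewrite big_cons avgD //.
- by rewrite IH.
- by apply: grid_integrable_indic; apply: sD; exact: mem_head.
- exact: grid_integrable_multiplicity.
Qed.

Lemma half_diff_multiplicity s J : (forall I, I \in s -> D I) -> D J ->
  hd (multiplicity s) J = \sum_(I <- s) hd \1_I J.
Proof.
move=> sD DJ; rewrite /half_diff (avg_multiplicity sD (dyadic_rch hD DJ)).
rewrite (avg_multiplicity sD (dyadic_lch hD DJ)).
by rewrite -sumrB mulr_suml.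
Qed.

Lemma dyadic_cases I J : D I -> D J ->
  [\/ J `<=` I, I `<=` J /\ I != J | I `&` J = set0].
Proof.
move=> DI DJ; case: hD => _ _ /(_ I J DI DJ)[IE|JE|]; last by constructor 3.
- have [->|n] := eqVneq I J; first by constructor 1.
  by constructor 2; split => //; rewrite -IE => y [].
- by constructor 1; rewrite -JE => y [].
Qed.

Lemma half_diff_indic0 I J : D I -> D J -> ~ (I `<=` J /\ I != J) -> hd \1_I J = 0.
Proof.
move=> DI DJ nIJ; have DL := dyadic_lch hD DJ; have DR := dyadic_rch hD DJ.
have lJ := lch_sub hD DJ; have rJ := rch_sub hD DJ; rewrite /half_diff.
have [JI|//|dis] := dyadic_cases DI DJ.
  rewrite !avg_indic_sup ?subrr ?mul0r //; exact: subset_trans JI.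
have sub K : K `<=` J -> I `&` K = set0.
  by move=> KJ; apply/seteqP; split => // y [Iy /KJ Jy]; rewrite -dis.
by rewrite !avg_indic_disj ?subrr ?mul0r ?sub.
Qed.

Lemma half_diff_indic_rch I J : D I -> D J -> I `<=` rc J -> hd \1_I J = len I / len J.
Proof.
move=> DI DJ IJ; have DL := dyadic_lch hD DJ; have DR := dyadic_rch hD DJ.
rewrite /half_diff avg_indic_sub // avg_indic_disj //; last first.
  apply/seteqP; split => // y [/IJ Ry Ly].
  by have : (lc J `&` rc J) y by []; rewrite (childrenI hD DJ).
rewrite (len_rch hD DJ); field; rewrite gt_eqF //; exact: (dyadic_len_gt0 hD).
Qed.

Lemma half_diff_indic_lch I J : D I -> D J -> I `<=` lc J -> hd \1_I J = - (len I / len J).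
Proof.
move=> DI DJ IJ; have DL := dyadic_lch hD DJ; have DR := dyadic_rch hD DJ.
rewrite /half_diff avg_indic_disj //; last first.
  apply/seteqP; split => // y [/IJ Ly Ry].
  by have : (lc J `&` rc J) y by []; rewrite (childrenI hD DJ).
rewrite avg_indic_sub // (len_lch hD DJ); field.
rewrite gt_eqF //; exact: (dyadic_len_gt0 hD).
Qed.

Lemma carleson_sum s (L : R) J : uniq s -> (forall I, I \in s -> D I) ->
  carleson D [set` s] L -> D J ->
  \sum_(I <- s | `[< I `<=` J >]) len I <= L * len J.
Proof.
move=> us sD sC DJ; have := sC J DJ; rewrite (esum_sub_seq hD) //.
by rewrite (dyadic_lebE hD DJ) -EFinM lee_fin.
Qed.

(** On J the multiplicity is the number of members containing J, a constant, plus the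
    multiplicity of the members strictly inside J, whose average is at most L. *)
Lemma BMO_norm_multiplicity s (L : R) : uniq s -> (forall I, I \in s -> D I) ->
  carleson D [set` s] L -> (BMO_norm D (multiplicity s) <= (2 * L)%:E)%E.
Proof.
move=> us sD sC; apply: ge_ereal_sup => _ [J DJ <-].
have bi := grid_integrable_multiplicity sD.
set b := multiplicity s in bi *.
have oi : grid_integrable D (fun y => `|b y - avg b J|).
  by apply: grid_integrable_norm; apply: grid_integrableB => //; exact: (grid_integrable_cst hD).
rewrite (eavg_avg hD) // lee_fin.
pose t := [seq I <- s | `[< I `<=` J /\ I != J >]].
pose c : R := \sum_(I <- s | `[< J `<=` I >]) 1.
have tD I : I \in t -> D I by rewrite mem_filter => /andP[_ /sD].
pose b' := multiplicity t.
have bi' : grid_integrable D b' := grid_integrable_multiplicity tD.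
have bE y : J y -> b y = c + b' y.
  move=> Jy; rewrite /b /b' /multiplicity /t big_filter /c.
  rewrite [X in X + _]big_mkcond [X in _ + X]big_mkcond -big_split /= !big_seq.
  apply: eq_bigr => I /sD DI.
  have [JI|IJ|dis] := dyadic_cases DI DJ.
  - rewrite asboolT // asboolF ?addr0; first by rewrite indicE mem_set //; exact: JI.
    by move=> [IJ]; rewrite (_ : I = J) ?eqxx //; apply/seteqP.
  - rewrite asboolF ?asboolT ?add0r // => JI; case: IJ => IJ.
    by rewrite (_ : I = J) ?eqxx //; apply/seteqP.
  - have nI : ~ I y by move=> Iy; have : (I `&` J) y by []; rewrite dis.
    rewrite asboolF; last by move=> JI; apply: nI; exact: JI.
    by rewrite indicE memNset // add0r; case: ifP.
have b'0 y : 0 <= b' y by apply: sumr_ge0 => I _; rewrite indicE.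
have aE : avg b J = c + avg b' J.
  rewrite -[c in RHS](avg_cst hD c DJ) -avgD //; last exact: (grid_integrable_cst hD).
  exact: avg_eq.
have a'0 : 0 <= avg b' J by exact: (avg_ge0 hD).
have a'L : avg b' J <= L.
  rewrite avg_multiplicity // /t.
  have l0 := dyadic_len_gt0 hD DJ.
  have -> : \sum_(I <- t) avg \1_I J = (\sum_(I <- t) len I) / len J.
    rewrite mulr_suml !big_seq; apply: eq_bigr => I It; have DI := tD _ It.
    move: It; rewrite mem_filter => /andP[/asboolP[IJ _] _].
    by rewrite avg_indic_sub.
  rewrite ler_pdivrMr //; apply: le_trans (carleson_sum us sD sC DJ).
  rewrite big_filter big_mkcond [leRHS]big_mkcond /= !big_seq; apply: ler_sum => I /sD DI.
  have lI := ltW (dyadic_len_gt0 hD DI).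
  case: asboolP => [[IJ _]|_]; first by rewrite asboolT.
  by case: ifP.
apply: (@le_trans _ _ (avg (fun y => b' y + avg b' J) J)); last first.
  have ci := grid_integrable_cst hD (avg b' J).
  by have := avgD DJ bi' ci; rewrite (avg_cst hD) // => ->; lra.
apply: avg_le => //; first by apply: grid_integrableD => //; exact: (grid_integrable_cst hD).
move=> y Jy; rewrite bE // aE opprD addrACA subrr add0r.
by apply: le_trans (ler_normB _ _) _; rewrite !ger0_norm.
Qed.

End Indicators.

(** * Telescoping along the ancestors of an interval *)

Section Telescoping.
Variables (R : realType) (D : set (set R)).
Hypothesis hD : dyadic_grid D.
Local Notation leb := (@lebesgue_measure R).
Local Notation lc := (lch D).
Local Notation rc := (rch D).
Local Notation hd f := (half_diff lc rc (avg f)).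
Implicit Types (I J K : set R) (f g u b : R -> R) (s t : seq (set R)).

Definition parent I : set R :=
  xget set0 [set J | [/\ D J, len J = 2 * len I & I `<=` J]].

Lemma parentP I : D I -> [/\ D (parent I), len (parent I) = 2 * len I & I `<=` parent I].
Proof.
move=> DI; apply: (xgetPex set0 (P := [set J | [/\ D J, len J = 2 * len I & I `<=` J]])).
have [k kE] := dyadic_level hD DI; have [x Ix] := dyadic_nonempty hD DI.
have [J [DJ JE Jx]] := dyadic_cover hD (1 + k) x.
have lJ : len J = 2 * len I by rewrite JE kE expfzDr ?pnatr_eq0.
exists J; split => //; apply: (dyadic_nested hD DI DJ _ Ix Jx).
by rewrite lJ; have := dyadic_len_gt0 hD DI; lra.
Qed.

Definition ancestor I n : set R := iter n parent I.

Lemma ancestorP I n : D I ->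
  [/\ D (ancestor I n), len (ancestor I n) = 2 ^+ n * len I & I `<=` ancestor I n].
Proof.
move=> DI; elim: n => [|n [DA lA sA]]; first by rewrite expr0 mul1r; split.
have [Dp lp sp] := parentP DA; split => //.
- by rewrite lp lA exprS mulrA.
- exact: subset_trans sp.
Qed.

Lemma ancestor_child I n : D I ->
  ancestor I n = lc (ancestor I n.+1) \/ ancestor I n = rc (ancestor I n.+1).
Proof.
move=> DI; have [DA lA _] := ancestorP n DI; have [DB lB _] := ancestorP n.+1 DI.
have [_ lP sP] := parentP DA.
have i0 := dyadic_len_gt0 hD DA.
have ne : ancestor I n != ancestor I n.+1.
  apply/eqP => e; have {}e : parent (ancestor I n) = ancestor I n by [].
  by move: lP; rewrite e; lra.
have [x Ax] := dyadic_nonempty hD DA.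
have [s|s] := dyadic_child_sub hD DB DA sP ne; [left|right].
- apply: (dyadic_same_len hD DA (dyadic_lch hD DB) _ Ax (s _ Ax)).
  by rewrite (len_lch hD DB) [ancestor I n.+1]/= lP; lra.
- apply: (dyadic_same_len hD DA (dyadic_rch hD DB) _ Ax (s _ Ax)).
  by rewrite (len_rch hD DB) [ancestor I n.+1]/= lP; lra.
Qed.

Definition strict_ancestors I n : seq (set R) := [seq ancestor I k.+1 | k <- iota 0 n].

Lemma uniq_strict_ancestors I n : D I -> uniq (strict_ancestors I n).
Proof.
move=> DI; rewrite map_inj_uniq ?iota_uniq // => i j e.
have [_ l1 _] := ancestorP i.+1 DI; have [_ l2 _] := ancestorP j.+1 DI.
have i0 := dyadic_len_gt0 hD DI.
have ee : 2 ^+ i.+1 * len I = 2 ^+ j.+1 * len I by rewrite -l1 -l2 e.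
have iN0 : len I != 0 by rewrite gt_eqF.
have := mulIf iN0 ee.
by move=> /(ieexprIn (ltr0n R 2 : 0 < 2)); rewrite ?pnatr_eq1 => /(_ isT)[].
Qed.

Lemma mem_strict_ancestors I J n : D I -> J \in strict_ancestors I n ->
  [/\ D J, I `<=` J & I != J].
Proof.
move=> DI /mapP[k _ ->]; have [DA lA sA] := ancestorP k.+1 DI; split => //.
apply/eqP => e; move: lA; rewrite -e => lE.
have i0 := dyadic_len_gt0 hD DI.
have : (1 : R) < 2 ^+ k.+1 by rewrite exprn_egt1 // ltr1n.
by nra.
Qed.

Lemma strict_ancestorsP I J n : D I -> D J -> I `<=` J -> I != J ->
  len J <= 2 ^+ n * len I -> J \in strict_ancestors I n.
Proof.
move=> DI DJ IJ nIJ le; have i0 := dyadic_len_gt0 hD DI.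
have [x Ix] := dyadic_nonempty hD DI.
have lt : len I < len J.
  rewrite lt_neqAle (dyadic_sub_len hD DI DJ IJ) andbT.
  apply: contraNneq nIJ => lE; apply/eqP.
  exact: (dyadic_same_len hD DI DJ lE Ix (IJ _ Ix)).
have [a aE] := dyadic_level hD DI; have [c cE] := dyadic_level hD DJ.
have ac : a < c by rewrite -(@ltr_eXz2l R 2) ?ltr1n // -aE -cE.
have [k kE] : exists k : nat, c = a + k.+1%:Z.
  exists (`|c - a|%N.-1); rewrite prednK ?absz_gt0 ?subr_eq0 ?gt_eqF //.
  by rewrite gez0_abs ?subr_ge0 ?ltW // [RHS]addrC subrK.
have lJ : len J = 2 ^+ k.+1 * len I.
  by rewrite cE kE expfzDr ?pnatr_eq0 // -aE mulrC.
have kn : (k < n)%N.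
  move: le; rewrite lJ ler_pM2r // ler_eXn2l ?ltr1n //.
apply/mapP; exists k; first by rewrite mem_iota.
have [DA lA sA] := ancestorP k.+1 DI.
by apply: (dyadic_same_len hD DJ DA _ (IJ _ Ix) (sA _ Ix)); rewrite lA lJ.
Qed.

Definition off_midpoints s (x : R) := forall J, J \in s -> x != midpoint J.

(** Off the midpoints the Haar functions are given by [haar_children], so that the
    telescoping identity holds pointwise. *)
Lemma ae_off_midpoints s : {ae leb, forall x, off_midpoints s x}.
Proof.
elim: s => [|J s IH]; first by apply: aeW.
apply: filterS2 (ae_neq (midpoint J)) IH => x xJ xs K.
by rewrite inE => /predU1P[->|/xs].
Qed.

(** The contribution of the member I of a sparse family to the sum of the J-terms of
    the paraproduct, of its adjoint and of the martingale transform, for b the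
    multiplicity of the family and tau its density. *)
Definition product_term f I J (x : R) : R :=
  pairing \1_I (haar J) * avg f J * haar J x +
  pairing \1_I (haar J) * pairing f (haar J) * (\1_J x / len J) +
  (if `[< I `<=` J /\ I != J >] then len I / len J else 0) *
    pairing f (haar J) * haar J x.

Definition localized_average f I J (x : R) : R := len I * avg f J * (\1_J x / len J).

Lemma product_term0 f I J x : D I -> D J -> ~ (I `<=` J /\ I != J) ->
  product_term f I J x = 0.
Proof.
move=> DI DJ nIJ; rewrite /product_term asboolF //.
rewrite (pairing_haar hD DJ (grid_integrable_indic hD DI)) (half_diff_indic0 hD DI DJ nIJ).
by rewrite mulr0 !mul0r !addr0.
Qed.

(** The product rule for martingale differences: on J, [localized_average] is the
    product of the averages of 1_I and f over J.  Passing to the halves of J adds the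
    products of the difference of 1_I with the average of f, of the two differences,
    and of the average of 1_I with the difference of f.  On the half that misses I the
    new average of 1_I vanishes. *)
Lemma product_term_step f I n x : grid_integrable D f -> D I ->
  x != midpoint (ancestor I n.+1) ->
  product_term f I (ancestor I n.+1) x =
  localized_average f I (ancestor I n) x - localized_average f I (ancestor I n.+1) x.
Proof.
move=> fi DI xm; set J := ancestor I n.+1 in xm *.
have [DK lK sK] := ancestorP n DI; have [DJ lJ sJ] := ancestorP n.+1 DI.
rewrite -/J in DJ lJ sJ.
have [DJ' _ neq] : [/\ D J, I `<=` J & I != J].
  apply: (@mem_strict_ancestors I J n.+1 DI); apply/mapP; exists n => //.
  by rewrite mem_iota add0n ltnSn.
have l0 := dyadic_len_gt0 hD DJ.
set r := Num.sqrt (len J).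
have r0 : 0 < r by rewrite sqrtr_gt0.
have rE : len J = r ^+ 2 by rewrite sqr_sqrtr // ltW.
have fa := avg_averaging hD fi.
rewrite /product_term asboolT // !(pairing_haar hD) //; last exact: (grid_integrable_indic hD).
rewrite (haar_children hD DJ xm) /localized_average (indic_children hD x DJ) -/r.
have [KE|KE] := ancestor_child n DI; rewrite -/J in KE.
- have IL : I `<=` lc J by rewrite -KE.
  rewrite KE (half_diff_indic_lch hD DI DJ IL) (averaging_lch fa DJ) (len_lch hD DJ) rE.
  by set a := avg f J; set d := half_diff _ _ _ _; field; rewrite gt_eqF.
- have IL : I `<=` rc J by rewrite -KE.
  rewrite KE (half_diff_indic_rch hD DI DJ IL) (averaging_rch fa DJ) (len_rch hD DJ) rE.
  by set a := avg f J; set d := half_diff _ _ _ _; field; rewrite gt_eqF.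
Qed.

Lemma product_terms_telescope f I n x : grid_integrable D f -> D I ->
  off_midpoints (strict_ancestors I n) x ->
  \sum_(J <- strict_ancestors I n) product_term f I J x =
  avg f I * \1_I x - localized_average f I (ancestor I n) x.
Proof.
move=> fi DI; have i0 := dyadic_len_gt0 hD DI.
elim: n => [|n IH] xm.
  rewrite /strict_ancestors /= big_nil /localized_average /=.
  by field; rewrite gt_eqF.
have sE : strict_ancestors I n.+1 = strict_ancestors I n ++ [:: ancestor I n.+1].
  rewrite /strict_ancestors.
  by have -> : iota 0 n.+1 = iota 0 n ++ [:: n]; rewrite ?map_cat // -addn1 iotaD.
rewrite sE big_cat big_seq1 IH; last first.
  by move=> J Jn; apply: xm; rewrite sE mem_cat Jn.
rewrite product_term_step //; last by apply: xm; rewrite sE mem_cat inE eqxx orbT.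
by rewrite /= addrA subrK.
Qed.

End Telescoping.

(** * Sparse operators are controlled by Haar operators *)

Section UpperBound.
Variables (R : realType) (p : R) (D : set (set R)) (w : R -> R).
Hypothesis hp : 1 < p.
Hypothesis hD : dyadic_grid D.
Hypothesis hw : weight w.
Hypothesis hA : Ap D p w.
Local Notation leb := (@lebesgue_measure R).
Local Notation lc := (lch D).
Local Notation rc := (rch D).
Local Notation hd f := (half_diff lc rc (avg f)).
Local Notation q := (conjugate_exponent p).
Local Notation sigma := (dual_weight p w).
Implicit Types (I J K : set R) (f g u b : R -> R) (s t : seq (set R)).

Let p0 : 0 < p. Proof. exact: lt_trans hp. Qed.
Let pB0 : 0 < p - 1. Proof. by rewrite subr_gt0. Qed.

Lemma Ap_scalar_le (l W S Q : R) : 0 <= l -> 0 <= W -> 0 <= S ->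
  (l * W) * (l * S) `^ (p - 1) <= Q ->
  l * (S `^ q^-1 * W `^ p^-1) <= Q `^ p^-1.
Proof.
move=> l0 W0 S0 le.
have <- : (l * W * (l * S) `^ (p - 1)) `^ p^-1 = l * (S `^ q^-1 * W `^ p^-1).
  rewrite powRM ?mulr_ge0 ?powR_ge0 // -powRrM.
  have -> : (p - 1) * p^-1 = q^-1.
    by rewrite /conjugate_exponent; field; rewrite !gt_eqF.
  rewrite !powRM //.
  have l2 : l `^ p^-1 * l `^ q^-1 = l.
    rewrite -powRD; last by rewrite (conjugate_exponentP hp) oner_eq0.
    by rewrite (conjugate_exponentP hp) powRr1.
  by rewrite -[X in _ = X * _]l2; ring.
rewrite ge0_ler_powR ?nnegrE ?invr_ge0 ?(ltW p0) // ?mulr_ge0 ?powR_ge0 //.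
by rewrite (le_trans _ le) // !mulr_ge0 ?powR_ge0.
Qed.

(** The averaging operators f |-> <f>_J 1_J are bounded on L^p(w) uniformly in J, by
    Hölder and the A_p condition. *)
Lemma Ap_average_le : exists2 Q : R, 0 <= Q & forall f J, in_Lpw p w f -> D J ->
  (`|avg f J|%:E * Lpw_norm p w \1_J <= Q%:E * Lpw_norm p w f)%E.
Proof.
have [Q Q0 QJ] := Ap_bound hD hw hA.
exists (Q `^ p^-1); first exact: powR_ge0.
move=> f J fL DJ; have mJ := dyadic_measurable hD DJ.
have l0 := dyadic_len_gt0 hD DJ.
have ff := Lpw_norm_fin fL.
set phi := fine (Lpw_norm p w f).
have phi0 : 0 <= phi by rewrite fine_ge0 // Lpw_norm_ge0.
have fE : Lpw_norm p w f = phi%:E by rewrite fineK.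
have [_ /(_ J DJ) wi] := weight_grid_integrable hD hw.
have wf := integrable_fin_num mJ wi.
set W := fine (\int[leb]_(x in J) (w x)%:E)%E.
have WE : (\int[leb]_(x in J) (w x)%:E = W%:E)%E by rewrite fineK.
have W0 : 0 <= W by rewrite fine_ge0 // ltW // (integral_weight_gt0 hD hw DJ).
have sl := integral_sigma_lty hp hD hw hA DJ.
have s0 : (0 <= \int[leb]_(x in J) (sigma x)%:E)%E.
  by apply: integral_ge0 => x _; rewrite lee_fin powR_ge0.
set S := fine (\int[leb]_(x in J) (sigma x)%:E)%E.
have SE : (\int[leb]_(x in J) (sigma x)%:E = S%:E)%E by rewrite fineK // ge0_fin_numE.
have S0 : 0 <= S by rewrite fine_ge0.
have fi := Lpw_grid_integrable hp hD hw hA fL.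
have le1 : `|avg f J| <= (len J)^-1 * (phi * S `^ q^-1).
  apply: le_trans (avg_norm_le hD DJ fi) _; rewrite /avg ler_pM2l ?invr_gt0 //.
  have [_ /(_ J DJ) ai] := grid_integrable_norm fi.
  rewrite -lee_fin /Rintegral fineK; last exact: (integrable_fin_num mJ ai).
  apply: le_trans (holder_Lpw_dual hp hw (proj1 fL) mJ) _.
  by rewrite SE fE poweR_EFin -EFinM.
have le2 : ((len J)^-1 * W) * ((len J)^-1 * S) `^ (p - 1) <= Q.
  by have := QJ J DJ; rewrite /eavg WE SE -!EFinM lee_fin.
have l1 : 0 <= (len J)^-1 by rewrite invr_ge0 ltW.
have le3 := Ap_scalar_le l1 W0 S0 le2.
rewrite (Lpw_norm_indicE w hp DJ) WE fE poweR_EFin -!EFinM lee_fin.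
apply: le_trans (ler_wpM2r (powR_ge0 _ _) le1) _.
move: le3; move: (len J)^-1 (S `^ _) (W `^ _) (Q `^ _) => l a c e le3.
by rewrite mulrCA -mulrA mulrC; have := ler_wpM2r phi0 le3; rewrite -!mulrA [a * _]mulrC.
Qed.

Lemma Lpw_normD_le h k (a c : \bar R) : measurable_fun setT h -> measurable_fun setT k ->
  (Lpw_norm p w h <= a)%E -> (Lpw_norm p w k <= c)%E ->
  (Lpw_norm p w (h \+ k)%R <= a + c)%E.
Proof. by move=> mh mk ha kc; apply: le_trans (Lpw_normD hp hw mh mk) (leeD ha kc). Qed.

Definition density s J : R :=
  \sum_(I <- s) (if `[< I `<=` J /\ I != J >] then len I / len J else 0).

Lemma sum_product_term f s J x : (forall I, I \in s -> D I) -> D J ->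
  \sum_(I <- s) product_term f I J x =
  pairing (multiplicity s) (haar J) * avg f J * haar J x +
  pairing (multiplicity s) (haar J) * pairing f (haar J) * (\1_J x / len J) +
  density s J * pairing f (haar J) * haar J x.
Proof.
move=> sD DJ.
have -> : pairing (multiplicity s) (haar J) = \sum_(I <- s) pairing \1_I (haar J).
  rewrite (pairing_haar hD DJ (grid_integrable_multiplicity hD sD)).
  rewrite (half_diff_multiplicity hD sD DJ) mulr_sumr !big_seq; apply: eq_bigr => I /sD DI.
  by rewrite (pairing_haar hD DJ (grid_integrable_indic hD DI)).
by rewrite /density !mulr_suml -!big_split.
Qed.

Lemma arbitrarily_large_pow2 (X d : R) : 0 < d -> exists m : nat, X <= 2 ^+ m * d.
Proof.
move=> d0; have [n Xn] : exists n : nat, X / d < n%:R.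
  exists (Num.bound `|X / d|); apply: le_lt_trans (ler_norm _) _; exact: archi_boundP.
exists n; rewrite -ler_pdivrMr //; apply: le_trans (ltW Xn) _.
by rewrite -natrX ler_nat ltnW // ltn_expl.
Qed.

Lemma localized_average_norm_le (Q : R) f I J : D J ->
  (`|avg f J|%:E * Lpw_norm p w \1_J <= Q%:E * Lpw_norm p w f)%E ->
  (Lpw_norm p w (localized_average f I J) <= (`|len I / len J| * Q)%:E * Lpw_norm p w f)%E.
Proof.
move=> DJ h; have mJ : measurable_fun setT (\1_J : R -> R).
  by apply: measurable_indic; exact: (dyadic_measurable hD DJ).
have -> : localized_average f I J = (fun x => (len I / len J * avg f J) * \1_J x).
  by apply/funext => x; rewrite /localized_average; ring.
move: h; rewrite (Lpw_normZ hp hw (len I / len J * avg f J) mJ).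
move: (len I / len J) (avg f J) => a c h.
by rewrite normrM !EFinM -!muleA; apply: lee_wpmul2l.
Qed.

(** The three operators, applied to f, are approximated by their partial sums over a
    common finite family F that contains all ancestors up to length 2 ^ M of the
    members of s.  The terms of each member I then telescope to <f>_I 1_I minus
    the product of the averages of 1_I and f over the ancestor of length 2 ^ M; in
    L^p(w) the norm of this remainder is at most a constant times 2 ^ - M. *)
Lemma sparse_sum_le s f (M1 M2 M3 : R) : uniq s -> (forall I, I \in s -> D I) ->
  in_Lpw p w f ->
  (opnorm p w (paraproduct p w D (multiplicity s)) <= M1%:E)%E ->
  (opnorm p w (adjoint_paraproduct p w D (multiplicity s)) <= M2%:E)%E ->
  (opnorm p w (martingale_transform p w D (density s)) <= M3%:E)%E ->
  (Lpw_norm p w (fun x => \sum_(I <- s) avg f I * \1_I x)%R <=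
    (M1 + M2 + M3)%:E * Lpw_norm p w f)%E.
Proof.
move=> us sD fL o1 o2 o3.
have fi := Lpw_grid_integrable hp hD hw hA fL.
have ff := Lpw_norm_fin fL.
set phi := fine (Lpw_norm p w f).
have phi0 : 0 <= phi by rewrite fine_ge0 // Lpw_norm_ge0.
have fE : Lpw_norm p w f = phi%:E by rewrite fineK.
have [Q Q0 HQ] := Ap_average_le.
apply/lee_addgt0Pr => e e0.
pose d := e / (3 * phi + 4).
have d0 : 0 < d by rewrite divr_gt0 // ltr_wpDl // mulr_ge0.
have dE : d * (3 * phi + 4) = e by rewrite /d divfK // gt_eqF // ltr_wpDl // mulr_ge0.
have [g1 [[mg1 _] G1 N1]] := opnorm_approx o1 d0 fL.
have [g2 [[mg2 _] G2 N2]] := opnorm_approx o2 d0 fL.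
have [g3 [[mg3 _] G3 N3]] := opnorm_approx o3 d0 fL.
have [F1 [/finite_set_uniq_seq[s1 _ ->] s1D H1]] := G1 d d0.
have [F2 [/finite_set_uniq_seq[s2 _ ->] s2D H2]] := G2 d d0.
have [F3 [/finite_set_uniq_seq[s3 _ ->] s3D H3]] := G3 d d0.
pose t0 := s1 ++ s2 ++ s3.
have t0D J : J \in t0 ++ s -> D J.
  rewrite !mem_cat => /orP[/or3P[Js|Js|Js]|Js].
  - exact: s1D. - exact: s2D. - exact: s3D. - exact: sD.
have [N [? HN]] := dyadic_depth hD t0D.
have [m Hm] := arbitrarily_large_pow2 ((\sum_(I <- s) len I) * Q * phi) d0.
(* 2 ^ N bounds the lengths present, and the factor 2 ^ m makes the remainder
   smaller than d. *)
pose M := (N + m)%N.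
have lM J : J \in t0 ++ s -> len J <= 2 ^+ M.
  move=> /HN[l _]; apply: le_trans l _.
  by rewrite exprD ler_peMr ?exprn_ge0 // exprn_ege1 // ler1n.
(* n I generations separate I from its ancestor of length 2 ^ M. *)
have gap I : exists n : nat, D I -> len I <= 2 ^+ M -> 2 ^+ n * len I = 2 ^+ M.
  have [DI|nDI] := pselect (D I); last by exists 0%N.
  have [k kE] := dyadic_level hD DI.
  have [le|gt] := lerP (len I) (2 ^+ M); last by exists 0%N.
  have kM : k <= M by rewrite -(@ler_eXz2l R 2) ?ltr1n // -kE.
  exists `|M%:Z - k|%N => _ _.
  by rewrite kE exprnP gez0_abs ?subr_ge0 // -expfzDr ?pnatr_eq0 // subrK.
have [n nE] := choice gap.
pose chain I := strict_ancestors D I (n I).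
pose F := undup (t0 ++ flatten [seq chain K | K <- s]).
have nM I : I \in s -> 2 ^+ n I * len I = 2 ^+ M.
  by move=> Is; apply: nE; [exact: sD|apply: lM; rewrite mem_cat Is orbT].
have chainM I J : I \in s -> J \in chain I -> D J /\ len J <= 2 ^+ M.
  move=> Is /mapP[k]; rewrite mem_iota add0n => /andP[_ kn] ->.
  have [DA lA _] := ancestorP hD k.+1 (sD _ Is); split => //.
  rewrite lA -(nM _ Is) ler_wpM2r ?(ltW (dyadic_len_gt0 hD (sD _ Is))) //.
  by rewrite ler_eXn2l ?ltr1n.
have FM J : J \in F -> D J /\ len J <= 2 ^+ M.
  rewrite mem_undup mem_cat => /orP[Jt|/flattenP[c /mapP[I Is ->]]].
    by split; [apply: t0D|apply: lM]; rewrite mem_cat Jt.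
  exact: chainM.
have FD J : J \in F -> D J by move=> /FM[].
have sub (t : seq (set R)) : {subset t <= t0} -> [set` t] `<=` [set` F].
  by move=> tt J /= /tt Jt; rewrite mem_undup mem_cat Jt.
have s1F : [set` s1] `<=` [set` F] by apply: sub => J Js; rewrite mem_cat Js.
have s2F : [set` s2] `<=` [set` F] by apply: sub => J Js; rewrite !mem_cat Js orbT.
have s3F : [set` s3] `<=` [set` F] by apply: sub => J Js; rewrite !mem_cat Js !orbT.
have {}H1 := H1 [set` F] (finite_seq F) s1F FD.
have {}H2 := H2 [set` F] (finite_seq F) s2F FD.
have {}H3 := H3 [set` F] (finite_seq F) s3F FD.
have uF : uniq F by exact: undup_uniq.
pose u1 J x := pairing (multiplicity s) (haar J) * avg f J * haar J x.
pose u2 J x := pairing (multiplicity s) (haar J) * pairing f (haar J) * (\1_J x / len J).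
pose u3 J x := density s J * pairing f (haar J) * haar J x.
have mu k J : J \in F -> measurable_fun setT (nth u3 [:: u1; u2] k J).
  move=> /FD DJ; have mh := measurable_haar hD DJ.
  have mi : measurable_fun setT (\1_J : R -> R).
    by apply: measurable_indic; exact: (dyadic_measurable hD DJ).
  case: k => [|[|k]] /=.
  - by apply: measurable_funM => //; exact: measurable_cst.
  - by do 2 apply: measurable_funM => //; exact: measurable_cst.
  - by rewrite nth_nil; apply: measurable_funM => //; exact: measurable_cst.
pose A x := \sum_(I <- s) avg f I * \1_I x.
pose Rm x := \sum_(I <- s) localized_average f I (ancestor D I (n I)) x.
pose S1 x := \sum_(J <- F) u1 J x.
pose S2 x := \sum_(J <- F) u2 J x.
pose S3 x := \sum_(J <- F) u3 J x.
have mS1 : measurable_fun setT S1 by apply: measurable_big_seq => J; exact: (mu 0%N).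
have mS2 : measurable_fun setT S2 by apply: measurable_big_seq => J; exact: (mu 1%N).
have mS3 : measurable_fun setT S3 by apply: measurable_big_seq => J; exact: (mu 2%N).
have {}H1 : (Lpw_norm p w (fun x => S1 x - g1 x)%R < d%:E)%E.
  by move: H1; under [X in Lpw_norm _ _ X]eq_fun do rewrite -fsbig_seq //.
have {}H2 : (Lpw_norm p w (fun x => S2 x - g2 x)%R < d%:E)%E.
  by move: H2; under [X in Lpw_norm _ _ X]eq_fun do rewrite -fsbig_seq //.
have {}H3 : (Lpw_norm p w (fun x => S3 x - g3 x)%R < d%:E)%E.
  by move: H3; under [X in Lpw_norm _ _ X]eq_fun do rewrite -fsbig_seq //.
have anc I : I \in s -> D (ancestor D I (n I)) /\ len (ancestor D I (n I)) = 2 ^+ M.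
  by move=> Is; have [DA lA _] := ancestorP hD (n I) (sD _ Is); rewrite lA nM.
have mR I : I \in s -> measurable_fun setT (localized_average f I (ancestor D I (n I))).
  move=> /anc[DA _]; apply: measurable_funM; first exact: measurable_cst.
  apply: measurable_funM; last exact: measurable_cst.
  by apply: measurable_indic; exact: (dyadic_measurable hD DA).
have mRm : measurable_fun setT Rm by exact: measurable_big_seq.
have mA : measurable_fun setT A by exact: (measurable_sparse_sum hD).
have RN : (Lpw_norm p w Rm <= d%:E)%E.
  apply: le_trans (Lpw_norm_sum_le hp hw mR) _.
  apply: (@le_trans _ _ (\sum_(I <- s) (len I / 2 ^+ M * Q * phi)%:E)%E).
    rewrite !big_seq; apply: lee_sum => I Is; have [DA lA] := anc I Is.
    apply: le_trans (localized_average_norm_le I DA (HQ f _ fL DA)) _.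
    rewrite fE -EFinM lee_fin lA ger0_norm //.
    by rewrite divr_ge0 ?exprn_ge0 // ltW // (dyadic_len_gt0 hD (sD _ Is)).
  rewrite sumEFin lee_fin -!mulr_suml; move: Hm; set X := \sum_(I <- s) len I => Hm.
  have M0 : 0 < (2 : R) ^+ M by rewrite exprn_gt0.
  rewrite -mulrA mulrAC ler_pdivrMr // mulrA [leRHS]mulrC; apply: le_trans Hm _.
  by rewrite ler_wpM2r ?(ltW d0) // ler_eXn2l ?ltr1n // leq_addl.
have key : {ae leb, forall x, A x = (S1 x - g1 x) + ((S2 x - g2 x) + ((S3 x - g3 x) +
    (g1 x + (g2 x + (g3 x + Rm x)))))}.
  apply: filterS (ae_off_midpoints F) => x xF.
  have : S1 x + S2 x + S3 x = A x - Rm x.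
    rewrite /S1 /S2 /S3 -!big_split /=.
    have -> : \sum_(J <- F) (u1 J x + u2 J x + u3 J x) =
        \sum_(J <- F) \sum_(I <- s) product_term f I J x.
      by rewrite !big_seq; apply: eq_bigr => J /FD DJ; rewrite sum_product_term.
    rewrite exchange_big /A /Rm -sumrB !big_seq; apply: eq_bigr => I Is.
    have DI := sD _ Is.
    have cF : {subset chain I <= F}.
      move=> J Jc; rewrite mem_undup mem_cat; apply/orP; right.
      by apply/flattenP; exists (chain I) => //; exact: map_f.
    rewrite (big_subfamily _ (uniq_strict_ancestors hD (n I) DI) uF cF).
    have -> : \sum_(J <- [seq K <- F | K \notin chain I]) product_term f I J x = 0.
      rewrite big_seq big1 // => J; rewrite mem_filter => /andP[Jc /FM[DJ lJ]].
      apply: (product_term0 hD) => // -[IJ nIJ].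
      move/negP: Jc; apply; apply: (strict_ancestorsP hD) => //.
      by rewrite nM.
    rewrite addr0; apply: (product_terms_telescope hD) => // J Jc.
    by apply: xF; exact: cF.
  by move=> e1; rewrite (_ : A x = S1 x + S2 x + S3 x + Rm x); [ring|rewrite e1 subrK].
have m1 := measurable_funB mS1 mg1.
have m2 := measurable_funB mS2 mg2.
have m3 := measurable_funB mS3 mg3.
have m4 := measurable_funD mg3 mRm.
have m5 := measurable_funD mg2 m4.
have m6 := measurable_funD mg1 m5.
have m7 := measurable_funD m3 m6.
have m8 := measurable_funD m2 m7.
have m9 := measurable_funD m1 m8.
rewrite (Lpw_norm_eq_ae hp hw mA m9 key).
move: N1 N2 N3; rewrite fE -!EFinM => N1 N2 N3.
have n4 := Lpw_normD_le mg3 mRm N3 RN.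
have n5 := Lpw_normD_le mg2 m4 N2 n4.
have n6 := Lpw_normD_le mg1 m5 N1 n5.
have n7 := Lpw_normD_le m3 m6 (ltW H3) n6.
have n8 := Lpw_normD_le m2 m7 (ltW H2) n7.
have n9 := Lpw_normD_le m1 m8 (ltW H1) n8.
apply: le_trans n9 _; rewrite -!EFinD lee_fin -dE.
have arith (y z : R) : z + (z + (z + ((M1 + z) * y + ((M2 + z) * y + ((M3 + z) * y + z))))) <=
    (M1 + M2 + M3) * y + z * (3 * y + 4) by lra.
exact: arith.
Qed.

End UpperBound.

(** * Comparison of the suprema *)

Section Comparison.
Variables (R : realType) (p : R) (D : set (set R)) (w : R -> R) (L : R).
Hypothesis hp : 1 < p.
Hypothesis hL : 1 < L.
Hypothesis hD : dyadic_grid D.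
Hypothesis hw : weight w.
Hypothesis hA : Ap D p w.
Local Notation lc := (lch D).
Local Notation rc := (rch D).
Local Notation hd f := (half_diff lc rc (avg f)).
Implicit Types (I J K : set R) (f g u b : R -> R) (s t : seq (set R)).

(** For a symbol of norm zero, which the suprema leave out, all coefficients and hence
    the operators vanish. *)
Lemma opnorm_eq0 (E : set (set R)) (u : (R -> R) -> set R -> R -> R) :
  (forall f I x, E I -> u f I x = 0) ->
  (opnorm p w (fun f g => sums_to p w E (u f) g) <= 0)%E.
Proof.
move=> u0; apply: (opnorm_le_signed hp hw) => //.
  move=> f I fL EI; rewrite (_ : u f I = cst 0) //.
  by apply/funext => x; exact: u0.
move=> f s e fL us sE; rewrite mul0e.
rewrite (_ : (fun x => _) = cst 0) ?Lpw_norm0 //.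
apply/funext => x; rewrite big_seq big1 // => I /sE EI.
by rewrite u0 // mulr0.
Qed.

Lemma sup_norm_ge0 (tau : set R -> R) : (0 <= sup_norm D tau)%E.
Proof.
have [I0 [DI0 _ _]] := dyadic_cover hD 0 0.
apply: (@le_trans _ _ `|tau I0|%:E); first by rewrite lee_fin.
by apply: ereal_sup_ubound; exists I0.
Qed.

Lemma le_sup_norm (tau : set R -> R) J : (sup_norm D tau < +oo)%E -> D J ->
  `|tau J| <= fine (sup_norm D tau).
Proof.
move=> ty DJ; rewrite -lee_fin fineK; last by rewrite ge0_fin_numE // sup_norm_ge0.
by apply: ereal_sup_ubound; exists J.
Qed.

Lemma BMO_norm_ge0 b : locally_integrable setT b -> (0 <= BMO_norm D b)%E.
Proof.
move=> bl; have [I0 [DI0 _ _]] := dyadic_cover hD 0 0.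
apply: (@le_trans _ _ (eavg (fun x => `|b x - avg b I0|) I0)).
  rewrite /eavg mule_ge0 //.
    by rewrite lee_fin invr_ge0 ltW // (dyadic_len_gt0 hD).
  by apply: integral_ge0.
by apply: ereal_sup_ubound; exists I0.
Qed.

Lemma BMO_norm_eq0_pairing b J : in_BMO D b -> BMO_norm D b = 0%E -> D J ->
  pairing b (haar J) = 0.
Proof.
move=> bB b0 DJ; have [bl _] := bB; have bi := locally_integrable_grid hD bl.
have := BMO_carleson hD 1 bB DJ; rewrite b0 /= big_seq1 expr0n /= mulr0 mul0r.
rewrite pmulr_rle0 ?(dyadic_len_gt0 hD) // => h.
have : hd b J ^+ 2 == 0 by rewrite eq_le h sqr_ge0.
by rewrite sqrf_eq0 (pairing_haar hD DJ bi) => /eqP ->; rewrite mulr0.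
Qed.

Lemma paraproduct_opnorm_le_sup b (N : R) : in_BMO D b ->
  (paraproduct_sup D p w <= N%:E)%E ->
  (opnorm p w (paraproduct p w D b) <= (fine (BMO_norm D b) * N)%:E)%E.
Proof.
move=> bB bN; have [b0|bn0] := eqVneq (BMO_norm D b) 0%E.
  rewrite b0 mul0r; apply: opnorm_eq0 => f I x DI.
  by rewrite BMO_norm_eq0_pairing // !mul0r.
have [bl by_] := bB; have b0 := BMO_norm_ge0 bl.
have fB : 0 < fine (BMO_norm D b) by rewrite fine_gt0 // by_ andbT lt_def bn0.
have : (opnorm p w (paraproduct p w D b) * (fine (BMO_norm D b))^-1%:E <= N%:E)%E.
  apply: le_trans bN; apply: ereal_sup_ubound; exists b => //; split => //.
  exact/eqP.
by rewrite lee_pdivrMr // -EFinM mulrC.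
Qed.

Lemma adjoint_paraproduct_opnorm_le_sup b (N : R) : in_BMO D b ->
  (adjoint_paraproduct_sup D p w <= N%:E)%E ->
  (opnorm p w (adjoint_paraproduct p w D b) <= (fine (BMO_norm D b) * N)%:E)%E.
Proof.
move=> bB bN; have [b0|bn0] := eqVneq (BMO_norm D b) 0%E.
  rewrite b0 mul0r; apply: opnorm_eq0 => f I x DI.
  by rewrite BMO_norm_eq0_pairing // !mul0r.
have [bl by_] := bB; have b0 := BMO_norm_ge0 bl.
have fB : 0 < fine (BMO_norm D b) by rewrite fine_gt0 // by_ andbT lt_def bn0.
have : (opnorm p w (adjoint_paraproduct p w D b) * (fine (BMO_norm D b))^-1%:E <= N%:E)%E.
  apply: le_trans bN; apply: ereal_sup_ubound; exists b => //; split => //.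
  exact/eqP.
by rewrite lee_pdivrMr // -EFinM mulrC.
Qed.

Lemma martingale_opnorm_le_sup (tau : set R -> R) (N : R) : (sup_norm D tau < +oo)%E ->
  (martingale_sup D p w <= N%:E)%E ->
  (opnorm p w (martingale_transform p w D tau) <= (fine (sup_norm D tau) * N)%:E)%E.
Proof.
move=> ty tN; have [t0|tn0] := eqVneq (sup_norm D tau) 0%E.
  rewrite t0 mul0r; apply: opnorm_eq0 => f I x DI.
  have := le_sup_norm ty DI; rewrite t0 /= normr_le0 => /eqP ->.
  by rewrite !mul0r.
have t0 := sup_norm_ge0 tau.
have fB : 0 < fine (sup_norm D tau) by rewrite fine_gt0 // ty andbT lt_def tn0.
have : (opnorm p w (martingale_transform p w D tau) * (fine (sup_norm D tau))^-1%:E <= N%:E)%E.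
  apply: le_trans tN; apply: ereal_sup_ubound; exists tau => //; split => //.
  exact/eqP.
by rewrite lee_pdivrMr // -EFinM mulrC.
Qed.

Lemma locally_integrable_multiplicity s : (forall I, I \in s -> D I) ->
  locally_integrable setT (multiplicity s).
Proof.
elim: s => [|I s IH] sD.
  have -> : multiplicity [::] = \1_(set0 : set R) :> (R -> R).
    by apply/funext => y; rewrite /multiplicity big_nil indic0.
  by apply: locally_integrable_indic; [exact: openT|exact: measurable0].
have -> : multiplicity (I :: s) = (\1_I \+ multiplicity s) :> (R -> R).
  by apply/funext => y; rewrite /multiplicity big_cons.
apply: locally_integrableD.
  apply: locally_integrable_indic; first exact: openT.
  exact: (dyadic_measurable hD (sD _ (mem_head _ _))).
by apply: IH => K Ks; apply: sD; rewrite inE Ks orbT.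
Qed.

Lemma in_BMO_multiplicity s (l : R) : uniq s -> (forall I, I \in s -> D I) ->
  carleson D [set` s] l -> in_BMO D (multiplicity s).
Proof.
move=> us sD sC; split; first exact: locally_integrable_multiplicity.
exact: le_lt_trans (BMO_norm_multiplicity hD us sD sC) (ltry _).
Qed.

Lemma density_le s J (l : R) : uniq s -> (forall I, I \in s -> D I) ->
  carleson D [set` s] l -> D J -> 0 <= density s J <= l.
Proof.
move=> us sD sC DJ; have l0 := dyadic_len_gt0 hD DJ; apply/andP; split.
  rewrite /density big_seq sumr_ge0 // => I /sD DI; case: ifP => // _.
  by rewrite divr_ge0 // ltW // (dyadic_len_gt0 hD).
have : \sum_(I <- s | `[< I `<=` J >]) len I / len J <= l.
  by rewrite -mulr_suml ler_pdivrMr //; exact: (carleson_sum hD us sD sC DJ).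
apply: le_trans; rewrite /density [leRHS]big_mkcond !big_seq.
apply: ler_sum => I /sD DI.
have q0 : 0 <= len I / len J by rewrite divr_ge0 // ltW // (dyadic_len_gt0 hD).
by case: asboolP => [[IJ _]|_]; [rewrite asboolT|case: ifP].
Qed.

(** Signed sums are dominated by the sparse operator at |f|, and the multiplicity and
    the density of a finite L-Carleson family have norms at most 2 * L and L. *)
Lemma sparse_sup_le (N : R) : 0 <= N ->
  (paraproduct_sup D p w <= N%:E)%E -> (adjoint_paraproduct_sup D p w <= N%:E)%E ->
  (martingale_sup D p w <= N%:E)%E ->
  (sparse_sup D p L w <= (5 * L * N)%:E)%E.
Proof.
move=> N0 N1 N2 N3; have hL' := hL.
apply: ge_ereal_sup => _ [S [SD SC _] <-].
apply: (opnorm_le_signed hp hw); first by rewrite !mulr_ge0 //; lra.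
  move=> f I fL /SD DI; apply: measurable_funM; first exact: measurable_cst.
  by apply: measurable_indic; exact: (dyadic_measurable hD DI).
move=> f s e fL us sS.
have sD I : I \in s -> D I by move=> /sS/SD.
have sC : carleson D [set` s] L.
  move=> J DJ; apply: le_trans (SC J DJ).
  apply: ereal_sup_le => _ [X [fX XS] <-]; exists X => //; split => //.
  by move=> I /XS[/sS SI IJ].
have bB := in_BMO_multiplicity us sD sC.
have bn := BMO_norm_multiplicity hD us sD sC.
have bf : fine (BMO_norm D (multiplicity s)) <= 2 * L.
  rewrite -lee_fin fineK // ge0_fin_numE ?BMO_norm_ge0 //; first by case: bB.
  by case: bB.
have tb : (sup_norm D (density s) <= L%:E)%E.
  apply: ge_ereal_sup => _ [J DJ <-].
  by have /andP[d0 d1] := density_le us sD sC DJ; rewrite lee_fin ger0_norm.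
have ty : (sup_norm D (density s) < +oo)%E by exact: le_lt_trans tb (ltry _).
have tf : fine (sup_norm D (density s)) <= L.
  by rewrite -lee_fin fineK // ge0_fin_numE // sup_norm_ge0.
have := sparse_sum_le hp hD hw hA us sD (in_Lpw_norm fL)
  (paraproduct_opnorm_le_sup bB N1) (adjoint_paraproduct_opnorm_le_sup bB N2)
  (martingale_opnorm_le_sup ty N3).
rewrite Lpw_norm_abs => h.
have fi := Lpw_grid_integrable hp hD hw hA fL.
apply: (@le_trans _ _ (Lpw_norm p w
    (fun x => \sum_(I <- s) avg (fun y => `|f y|) I * \1_I x)%R)).
  apply: (Lpw_norm_le_ae hp hw).
  - apply: measurable_big_seq => I /sD DI; apply: measurable_funM; first exact: measurable_cst.
    apply: measurable_funM; first exact: measurable_cst.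
    by apply: measurable_indic; exact: (dyadic_measurable hD DI).
  - exact: (measurable_sparse_sum hD).
  - apply: aeW => x; apply: le_trans (ler_norm_sum _ _ _) _.
    apply: le_trans (ler_norm _); rewrite !big_seq; apply: ler_sum => I /sD DI.
    rewrite normrM normrX normrN1 expr1n mul1r normrM [`|\1_I x|]ger0_norm //.
    by rewrite ler_wpM2r // (avg_norm_le hD).
apply: le_trans h _; apply: lee_wpmul2r; first exact: Lpw_norm_ge0.
rewrite lee_fin -!mulrDl ler_wpM2r //; lra.
Qed.

(** The suprema are over nonempty sets: the multiplicity of a single interval has a
    nonzero Haar coefficient at the parent of that interval. *)
Lemma haar_sups_ge0 : [/\ (0 <= paraproduct_sup D p w)%E,
  (0 <= adjoint_paraproduct_sup D p w)%E & (0 <= martingale_sup D p w)%E].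
Proof.
have [I0 [DI0 _ _]] := dyadic_cover hD 0 0.
have DR := dyadic_rch hD DI0.
pose s := [:: rc I0].
have sD I : I \in s -> D I by rewrite inE => /eqP ->.
have sC : carleson D [set` s] 1.
  move=> J DJ; rewrite mul1e esum_fset; last 2 first.
  - by apply: sub_finite_set (finite_seq s) => K [].
  - by move=> K _; exact: measure_ge0.
  have [RJ|RJ] := pselect (rc I0 `<=` J).
    rewrite (_ : [set I | _] = [set rc I0]); last first.
      apply/seteqP; split => K /=; first by rewrite inE => -[/eqP].
      by move=> ->; rewrite inE eqxx.
    rewrite fsbig_set1; apply: le_measure; rewrite ?inE //.
    - exact: (dyadic_measurable hD DR).
    - exact: (dyadic_measurable hD DJ).
  rewrite (_ : [set I | _] = set0); first by rewrite fsbig_set0 measure_ge0.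
  by apply/seteqP; split => K //= []; rewrite inE => /eqP ->.
have bB := @in_BMO_multiplicity s 1 isT sD sC.
have bn0 : BMO_norm D (multiplicity s) <> 0%E.
  move=> b0; have := BMO_norm_eq0_pairing bB b0 DI0.
  rewrite (pairing_haar hD DI0 (grid_integrable_multiplicity hD sD)).
  rewrite (half_diff_multiplicity hD sD DI0) big_seq1.
  rewrite (half_diff_indic_rch hD DR DI0 (fun x Hx => Hx)).
  move/eqP; rewrite mulf_eq0 sqrtr_eq0 mulf_eq0 invr_eq0.
  by rewrite leNgt !(dyadic_len_gt0 hD) //= !gt_eqF ?(dyadic_len_gt0 hD).
have b1 : (0 <= (fine (BMO_norm D (multiplicity s)))^-1%:E)%E.
  by rewrite lee_fin invr_ge0 fine_ge0 // BMO_norm_ge0 //; case: bB.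
pose tau : set R -> R := cst 1.
have t1 : sup_norm D tau = 1%E.
  apply/eqP; rewrite eq_le; apply/andP; split.
    by apply: ge_ereal_sup => _ [J _ <-]; rewrite normr1.
  by apply: ereal_sup_ubound; exists I0 => //=; rewrite normr1.
split.
- apply: (@le_trans _ _ (opnorm p w (paraproduct p w D (multiplicity s)) *
    (fine (BMO_norm D (multiplicity s)))^-1%:E)%E).
    by rewrite mule_ge0 // opnorm_ge0.
  by apply: ereal_sup_ubound; exists (multiplicity s).
- apply: (@le_trans _ _ (opnorm p w (adjoint_paraproduct p w D (multiplicity s)) *
    (fine (BMO_norm D (multiplicity s)))^-1%:E)%E).
    by rewrite mule_ge0 // opnorm_ge0.
  by apply: ereal_sup_ubound; exists (multiplicity s).
- apply: (@le_trans _ _ (opnorm p w (martingale_transform p w D tau) *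
    (fine (sup_norm D tau))^-1%:E)%E).
    by rewrite mule_ge0 ?opnorm_ge0 // t1 /= lee_fin invr_ge0.
  apply: ereal_sup_ubound; exists tau => //; split; first by rewrite t1 ltry.
  by rewrite t1 => /eqP; rewrite onee_eq0.
Qed.

Lemma sparse_sup_ge0 : (0 <= sparse_sup D p L w)%E.
Proof.
apply: (@le_trans _ _ (opnorm p w (sparse_op p w set0))); first exact: opnorm_ge0.
apply: ereal_sup_ubound; exists set0 => //; split => //.
- move=> J DJ; rewrite (_ : [set I | _] = set0).
    by rewrite esum_set0 mule_ge0 // lee_fin; have hL' := hL; lra.
  by apply/seteqP; split => K // [].
- by move=> [I /(_ 0%N)[]].
Qed.

Lemma haar_sup_le (B : R) : 0 <= B -> (sparse_sup D p L w <= B%:E)%E ->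
  (haar_sup D p w <=
    ((2 * paraproduct_const L + 4 * stop_ratio L ^+ 2) * B)%:E)%E.
Proof.
move=> B0 sB.
have bmo b : in_BMO D b -> BMO_norm D b <> 0%E -> 0 < fine (BMO_norm D b).
  move=> [bl by_] bn0; rewrite fine_gt0 // by_ andbT lt_def BMO_norm_ge0 // andbT.
  exact/eqP.
have scale T (N X : R) : 0 < N -> (opnorm p w T <= (N * X)%:E)%E ->
    (opnorm p w T * N^-1%:E <= X%:E)%E.
  by move=> N0 h; rewrite lee_pdivrMr // -EFinM mulrC.
have -> : (2 * paraproduct_const L + 4 * stop_ratio L ^+ 2) * B =
  paraproduct_const L * B + paraproduct_const L * B + 4 * stop_ratio L ^+ 2 * B by ring.
rewrite /haar_sup !EFinD; apply: leeD; first apply: leeD.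
- apply: ge_ereal_sup => _ [b [bB bn0] <-]; have N0 := bmo _ bB bn0.
  by apply: scale => //; rewrite mulrA; exact: paraproduct_opnorm_le.
- apply: ge_ereal_sup => _ [b [bB bn0] <-]; have N0 := bmo _ bB bn0.
  by apply: scale => //; rewrite mulrA; exact: adjoint_paraproduct_opnorm_le.
- apply: ge_ereal_sup => _ [tau [ty tn0] <-].
  have N0 : 0 < fine (sup_norm D tau).
    by rewrite fine_gt0 // ty andbT lt_def sup_norm_ge0 andbT; exact/eqP.
  apply: scale => //; rewrite mulrA; apply: martingale_opnorm_le => //.
  + by move=> J DJ; exact: le_sup_norm.
  + exact: ltW.
Qed.

End Comparison.

Theorem mainTheorem5 (R : realType) (p L : R) (hp : 1 < p) (hL : 1 < L) :
  exists c C : R, [/\ 0 < c, c <= C &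
    forall (D : set (set R)) (w : R -> R),
      dyadic_grid D -> weight w -> Ap D p w ->
      (c%:E * haar_sup D p w <= sparse_sup D p L w)%E /\
      (sparse_sup D p L w <= C%:E * haar_sup D p w)%E].
Proof.
pose k := 2 * paraproduct_const L + 4 * stop_ratio L ^+ 2.
have A2 := stop_ratio_gt2 hL.
have P0 := paraproduct_const_ge0 hL.
have k1 : 1 <= k by rewrite /k; nra.
have k0 : 0 < k by lra.
exists k^-1, (5 * L); split; first by rewrite invr_gt0.
  apply: (@le_trans _ _ 1); first by rewrite invf_le1.
  lra.
move=> D w hD hw hA.
have [h1 h2 h3] := haar_sups_ge0 p w hD.
have s0 := sparse_sup_ge0 p D w hL.
have h0 : (0 <= haar_sup D p w)%E by exact: adde_ge0 (adde_ge0 h1 h2) h3.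
split.
  have [->|sy] := eqVneq (sparse_sup D p L w) +oo%E; first by rewrite leey.
  have sf : sparse_sup D p L w \is a fin_num by rewrite ge0_fin_numE // ltey.
  rewrite -(fineK sf).
  have := haar_sup_le hp hL hD hw hA (fine_ge0 s0) _.
  rewrite (fineK sf) lexx => /(_ isT) h.
  apply: (@le_trans _ _ (k^-1%:E * (k * fine (sparse_sup D p L w))%:E)%E).
    by apply: lee_wpmul2l h; rewrite lee_fin invr_ge0 ltW.
  by rewrite -EFinM mulrA mulVf ?mul1r ?fineK // gt_eqF.
have [hy|hy] := eqVneq (haar_sup D p w) +oo%E.
  by rewrite hy gt0_muley ?leey // lte_fin; lra.
have hf : haar_sup D p w \is a fin_num by rewrite ge0_fin_numE // ltey.
rewrite -(fineK hf) -EFinM.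
apply: sparse_sup_le => //; first by rewrite fine_ge0.
- by rewrite fineK //; exact: le_trans (leeDl _ h2) (leeDl _ h3).
- by rewrite fineK //; exact: le_trans (leeDr _ h1) (leeDl _ h3).
- by rewrite fineK //; exact: leeDr _ (adde_ge0 h1 h2).
Qed.
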